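(* Let $-\infty\leqslant a<b\leqslant\infty$ and let $f$ be an $\mathbb{R}$-valued measurable function on $(a,b)$. Then $$\mathfrak D^0(\Phi_f)\subset\mathfrak D(\Phi_f)\subset\mathfrak D(\Phi_{f,\mathrm{c}})\subset\mathfrak D(\Phi_{f,\mathrm{es}})=\mathfrak D(\Phi_{f,\mathrm{sym}}).$$
   Context: $ID(\mathbb{R}^d)$ ($d$ fixed) is the class of infinitely divisible distributions on $\mathbb{R}^d$. For $\mu\in ID(\mathbb{R}^d)$, the cumulant function $C_\mu$ is the unique complex-valued continuous function on $\mathbb{R}^d$ with $C_\mu(0)=0$ and $\widehat\mu(z)=e^{C_\mu(z)}$. Random measure. $X^{(\mu)}=\{X^{(\mu)}(B)\colon B\text{ bounded Borel in }\mathbb{R}\}$ is the (unique in law) $\mathbb{R}^d$-valued homogeneous independently scattered random measure on $\mathbb{R}$ such that $X^{(\mu)}((t,t+1])$ has distribution $\mu$ for all $t$. That is: (1) for disjoint bounded Borel sets $B_1,B_2,\dots$ with bounded union, $\sum_n X^{(\mu)}(B_n)$ converges a.s. and equals $X^{(\mu)}(\bigcup_n B_n)$ a.s.; (2) values on finitely many disjoint sets are independent; (3) $X^{(\mu)}(\{t\})=0$ a.s. for each $t$; and the law of $X^{(\mu)}(B+t)$ equals that of $X^{(\mu)}(B)$. Integrals. Let $\mathcal B^0_{(a,b)}$ be the class of Borel sets $B\subset(a,b)$ with $\inf B>a$ and $\sup B<b$. For a simple function $f=\sum_{j=1}^n r_j1_{B_j}$ ($B_j$ disjoint Borel in $(a,b)$,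 $r_j\in\mathbb{R}$), $\int_B f\,dX^{(\mu)}=\sum_j r_jX^{(\mu)}(B\cap B_j)$ for $B\in\mathcal B^0_{(a,b)}$. A measurable $f\colon(a,b)\to\mathbb{R}$ is locally $X^{(\mu)}$-integrable on $(a,b)$, written $f\in\mathbf L_{(a,b)}(X^{(\mu)})$, if there are simple functions $f_n\to f$ Lebesgue-a.e. on $(a,b)$ such that $\int_B f_n\,dX^{(\mu)}$ converges in probability for every $B\in\mathcal B^0_{(a,b)}$; the limit is $\int_B f(s)X^{(\mu)}(ds)$. For $a<p<q<b$, $\int_p^q f(s)X^{(\mu)}(ds)$ is the integral over $(p,q]$. Improper integrals, for $f\in\mathbf L_{(a,b)}(X^{(\mu)})$ (limits as $p\downarrow a$, $q\uparrow b$): - $\Phi_f(\mu)$ is definable if $\int_p^q f(s)X^{(\mu)}(ds)$ converges in probability; the limit is written $\int_{a+}^{b-}f(s)X^{(\mu)}(ds)$. - $\Phi_{f,\mathrm{es}}(\mu)$ is definable if there is a nonrandom $\mathbb{R}^d$-valued function $g(p,q)$ such that $\int_p^q f(s)X^{(\mu)}(ds)-g(p,q)$ converges in probability. - $\Phi_{f,\mathrm{c}}(\mu)$ is definable if there is $\theta\in\mathbb{R}^d$ such that $\int_{a+}^{b-}f(s)X^{(\mu*\delta_{-\theta})}(ds)$ is definable (in particular $f\in\mathbf L_{(a,b)}(X^{(\mu*\delta_{-\theta})})$). - $\Phi_{f,\mathrm{sym}}(\mu)$ is definable if $\int_p^q f(s)(X^{(\mu)}(ds)-X^{(\mu)\sharp}(ds))$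 converges in probability, $X^{(\mu)\sharp}$ being an independent copy of $X^{(\mu)}$. $\mathfrak D(\Phi_f)$, $\mathfrak D(\Phi_{f,\mathrm{es}})$, $\mathfrak D(\Phi_{f,\mathrm{c}})$, $\mathfrak D(\Phi_{f,\mathrm{sym}})$ are the classes of $\mu\in ID(\mathbb{R}^d)$ such that $f\in\mathbf L_{(a,b)}(X^{(\mu)})$ and respectively $\Phi_f(\mu)$, $\Phi_{f,\mathrm{es}}(\mu)$, $\Phi_{f,\mathrm{c}}(\mu)$, $\Phi_{f,\mathrm{sym}}(\mu)$ is definable. $\mathfrak D^0(\Phi_f)$ is the class of $\mu\in ID(\mathbb{R}^d)$ such that $f\in\mathbf L_{(a,b)}(X^{(\mu)})$ and $\int_a^b|C_\mu(f(s)z)|\,ds<\infty$ for all $z\in\mathbb{R}^d$. *)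

(* Defs.v *)
From HB Require Import structures.
From mathcomp Require Import all_boot all_order all_algebra.
From mathcomp Require Import complex.
From mathcomp Require Import all_classical all_reals all_analysis.
From mathcomp Require Import measurable_realfun.

Set Implicit Arguments.
Unset Strict Implicit.
Unset Printing Implicit Defensive.
Import Order.TTheory GRing.Theory Num.Theory.
Import numFieldTopology.Exports numFieldNormedType.Exports.
Local Open Scope classical_set_scope.
Local Open Scope ring_scope.

(* R^d is 'rV[R]_d, with the sigma-algebra generated by the coordinates; by
   measurable_rV_open below, it is the Borel sigma-algebra. *)
Definition rV_display : measure_display -> measure_display.
Proof. exact. Qed.

Section rV_measurable.
Context {d0 : measure_display} {T : measurableType d0} (d : nat).

Let coords : 'I_d -> 'rV[T]_d -> T := fun i v => v ord0 i.

Let rV_set0 : g_sigma_preimage coords set0.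
Proof. exact: sigma_algebra0. Qed.

Let rV_setC A : g_sigma_preimage coords A -> g_sigma_preimage coords (~` A).
Proof. exact: sigma_algebraC. Qed.

Let rV_bigcup (F : _^nat) : (forall i, g_sigma_preimage coords (F i)) ->
  g_sigma_preimage coords (\bigcup_i (F i)).
Proof. exact: sigma_algebra_bigcup. Qed.

HB.instance Definition _ := @isMeasurable.Build (rV_display d0)
  'rV[T]_d (g_sigma_preimage coords) rV_set0 rV_setC rV_bigcup.

Lemma measurable_coord (i : 'I_d) :
  measurable_fun [set: 'rV[T]_d] (fun v : 'rV[T]_d => v ord0 i).
Proof.
move=> _ Y mY; rewrite setTI; apply: sub_sigma_algebra => /=.
rewrite -bigcup_seq/=; exists i => /=; first by rewrite mem_index_enum.
by exists Y => //; rewrite setTI.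
Qed.

Lemma measurable_fun_rVP d1 (S : measurableType d1) (f : S -> 'rV[T]_d) :
  measurable_fun [set: S] f <->
  forall i : 'I_d, measurable_fun [set: S] (fun s => f s ord0 i).
Proof.
split=> [mf i|mf].
  exact: (measurableT_comp (measurable_coord i) mf).
move=> _ A mA; rewrite setTI.
pose G := [set B : set 'rV[T]_d | measurable (f @^-1` B)].
suff : measurable `<=` G by apply.
apply: smallest_sub.
  split.
  - by rewrite /G/= preimage_set0.
  - by move=> B; rewrite /G/= setTD preimage_setC; exact: measurableC.
  - by move=> F mF; rewrite /G/= preimage_bigcup; exact: bigcupT_measurable.
rewrite -bigcup_seq => B [i _ [C mC <-]]; rewrite /G/= setTI.
by have := mf i measurableT C mC; rewrite setTI.
Qed.

End rV_measurable.

Lemma measurable_rV_open (R : realType) (d : nat) :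
  @measurable _ 'rV[R]_d = <<s [set A : set 'rV[R]_d | open A] >>.
Proof.
apply/seteqP; split.
  apply: smallest_sub; first exact: smallest_sigma_algebra.
  rewrite -bigcup_seq => B [i _ [C mC <-]]; rewrite setTI.
  pose G := [set D : set R |
    <<s [set A : set 'rV[R]_d | open A] >> ((fun v : 'rV[R]_d => v ord0 i) @^-1` D)].
  have : @measurable _ R `<=` G; last exact.
  have -> : @measurable _ R = <<s [set A | exists x y : R, A = `]x, y[%classic] >>.
    exact: RGenOpens.measurableE.
  apply: smallest_sub.
    split.
    - by rewrite /G /mkset preimage_set0; exact: sigma_algebra0.
    - by move=> D; rewrite /G /mkset setTD preimage_setC; exact: sigma_algebraC.
    - move=> F mF; rewrite /G /mkset preimage_bigcup.
      exact: sigma_algebra_bigcup.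
  move=> _ [a [b ->]]; rewrite /G/=; apply: sub_sigma_algebra => /=.
  have /continuousP := @coord_continuous R 1 d ord0 i.
  by apply; exact: interval_open.
apply: smallest_sub; first exact: sigma_algebra_measurable.
move=> U /= oU.
have mball (q : 'rV[rat]_d) (n : nat) :
    measurable [set v : 'rV[R]_d | forall i, `|ratr (q ord0 i) - v ord0 i| < n.+1%:R^-1].
  rewrite [X in measurable X](_ : _ = \big[setI/setT]_(i < d)
     ((fun v : 'rV[R]_d => v ord0 i) @^-1` ball (ratr (q ord0 i) : R) n.+1%:R^-1)).
    apply: bigsetI_measurable => i _; rewrite -[X in measurable X]setTI.
    apply: measurable_coord => //; apply: open_measurable; exact: ball_open.
  apply/seteqP; split => v /=.
    by move=> h; rewrite -bigcap_seq => i _; exact: h.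
  by rewrite -bigcap_seq => h i; apply: (h i); rewrite /= mem_index_enum.
pose E (p : 'rV[rat]_d * nat) := [set v : 'rV[R]_d |
   forall i, `|ratr (p.1 ord0 i) - v ord0 i| < p.2.+1%:R^-1].
rewrite (_ : U = \bigcup_(p in [set p | E p `<=` U]) E p); last first.
  apply/seteqP; split => [v Uv|v [p /= EU Ep]]; last exact: EU.
  have := open_nbhs_nbhs (conj oU Uv); rewrite -nbhs_ballE => -[e /= e0 eU].
  have [n] : exists n : nat, n.+1%:R^-1 < e / 2.
    exists (Num.truncn (e / 2)^-1).
    rewrite invf_plt ?posrE ?divr_gt0//; exact: truncnS_gt.
  move=> ne.
  have : forall i : 'I_d, exists q : rat, `|ratr q - v ord0 i| < n.+1%:R^-1.
    move=> i; have := @rat_in_itvoo R (v ord0 i - n.+1%:R^-1) (v ord0 i + n.+1%:R^-1).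
    case=> [|q]; first by rewrite ltrBlDr -addrA ltrDl addr_gt0// invr_gt0.
    by rewrite in_itv/= => hq; exists q; rewrite ltr_distl.
  move=> /choice[q hq]; exists (\row_i q i, n) => /=; last by move=> i; rewrite /= mxE.
  move=> w /= hw; apply: eU; split => //.
  move=> i j; rewrite ord1.
  have := hw j; have := hq j; rewrite mxE => h1 h2; rewrite -ball_normE/=.
  rewrite distrC -(subrKA (ratr (q j))) (le_lt_trans (ler_normD _ _))//.
  rewrite [ltRHS]splitr ltrD// ?(lt_trans _ ne)//; by rewrite distrC.
rewrite bigcup_mkcond; apply: countable_bigcupT_measurable => [|p].
  exact: countableP.
by case: ifP => // _; exact: mball.
Qed.

Section distributions.
Context (R : realType) (d : nat).
Local Notation V := 'rV[R]_d.
Implicit Types (mu nu : probability V R).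

Definition addV (p : V * V) : V := p.1 + p.2.

Lemma measurable_addV : measurable_fun [set: V * V] addV.
Proof.
apply/measurable_fun_rVP => i.
under eq_fun do rewrite mxE.
by apply: measurable_funD;
  [apply: (measurableT_comp (measurable_coord i) measurable_fst)
  |apply: (measurableT_comp (measurable_coord i) measurable_snd)].
Qed.

HB.instance Definition _ :=
  @isMeasurableFun.Build _ _ _ _ addV measurable_addV.

Definition convolution mu nu : probability V R :=
  distribution (mu \x nu)%E addV.

Definition convolution_power nu (n : nat) : probability V R :=
  iter n (convolution nu) (dirac (0 : V)).

Definition infinitely_divisible mu : Prop :=
  forall n : nat, (0 < n)%N -> exists nu, forall A : set V, measurable A ->
    mu A = convolution_power nu n A.

Definition dotV (z x : V) : R := \sum_(i < d) z ord0 i * x ord0 i.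

Local Open Scope complex_scope.

(* The integral of exp(i <z, x>) with respect to mu(dx). *)
Definition characteristic_function mu (z : V) : R[i] :=
  (\int[mu]_x cos (dotV z x))%R +i* (\int[mu]_x sin (dotV z x))%R.

Definition expC (w : R[i]) : R[i] :=
  expR (complex.Re w) * cos (complex.Im w)
  +i* (expR (complex.Re w) * sin (complex.Im w)).

(* Continuity of C is that of its real and imaginary parts. Such a C is unique,
   and it exists whenever mu is infinitely divisible. *)
Definition is_cumulant mu (C : V -> R[i]) : Prop :=
  [/\ continuous (fun z => complex.Re (C z)),
      continuous (fun z => complex.Im (C z)),
      C 0 = 0
    & forall z, characteristic_function mu z = expC (C z)].

End distributions.

Section stochastic_integrals.
Context (R : realType) (d : nat).
Local Notation V := 'rV[R]_d.

Definition bounded_Borel (B : set R) : Prop := measurable B /\ bounded_set B.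

Definition ereal_ooitv (a b : \bar R) : set R :=
  [set s | (a < s%:E)%E /\ (s%:E < b)%E].

(* The class B^0_(a,b). *)
Definition inner_Borel (a b : \bar R) (B : set R) : Prop :=
  [/\ measurable B, B `<=` ereal_ooitv a b,
      (a < ereal_inf (EFin @` B))%E & (ereal_sup (EFin @` B) < b)%E].

(* \sum_j sf_coef j * 1_(sf_piece j). *)
Record simple_fun (a b : \bar R) := SimpleFun {
  sf_card : nat;
  sf_coef : 'I_sf_card -> R;
  sf_piece : 'I_sf_card -> set R;
  measurable_piece : forall j, measurable (sf_piece j);
  piece_sub : forall j, sf_piece j `<=` ereal_ooitv a b;
  piece_disjoint : trivIset setT sf_piece }.

Definition simple_eval (a b : \bar R) (phi : simple_fun a b) (s : R) : R :=
  \sum_(j < sf_card phi) sf_coef j * \1_(sf_piece j) s.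

(* p tends to a from the right, resp. to b from the left; the cases a = +oo
   and b = -oo do not occur when a < b. *)
Definition right_filter (a : \bar R) : set_system R :=
  match a with
  | r%:E%E => r^'+
  | -oo%E => -oo_R
  | +oo%E => +oo_R
  end.

Definition left_filter (b : \bar R) : set_system R :=
  match b with
  | r%:E%E => r^'-
  | +oo%E => +oo_R
  | -oo%E => -oo_R
  end.

Section fixed_space.
Context (dO : measure_display) (Omega : measurableType dO).
Variable P : probability Omega R.
Implicit Types (X Y : set R -> Omega -> V) (J : set R -> Omega -> V).

Definition cvg_in_probability (I : Type) (F : set_system I)
    (Z : I -> Omega -> V) (L : Omega -> V) : Prop :=
  measurable_fun setT L /\
  forall e : R, 0 < e -> P [set w | e <= `|Z i w - L w|] @[i --> F] --> 0%E.

(* X is a homogeneous independently scattered random measure on R such that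
   X((t, t+1]) has distribution mu for all t, that is, a realization of X^(mu)
   on (Omega, P); only its values on bounded Borel sets matter. *)
Record random_measure (mu : probability V R) X : Prop := RandomMeasure {
  rm_measurable : forall B, bounded_Borel B -> measurable_fun setT (X B);
  rm_sigma_additive : forall B : nat -> set R,
    (forall n, bounded_Borel (B n)) -> trivIset setT B ->
    bounded_Borel (\bigcup_n B n) ->
    {ae P, forall w,
      (fun n => \sum_(k < n) X (B k) w) @ \oo --> X (\bigcup_n B n) w};
  rm_independent : forall (n : nat) (B : 'I_n -> set R) (A : 'I_n -> set V),
    (forall i, bounded_Borel (B i)) -> trivIset setT B ->
    (forall i, measurable (A i)) ->
    P [set w | forall i, A i (X (B i) w)]
    = (\prod_(i < n) P (X (B i) @^-1` A i))%E;
  rm_atomless : forall t : R, {ae P, forall w, X [set t] w = 0};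
  rm_homogeneous : forall (t : R) (B : set R) (A : set V),
    bounded_Borel B -> measurable A ->
    P (X [set s + t | s in B] @^-1` A) = P (X B @^-1` A);
  rm_law : forall (t : R) (A : set V), measurable A ->
    P (X `]t, t + 1]%classic @^-1` A) = mu A }.

(* Independence of the families (X B)_B and (Y B)_B. *)
Definition independent_measures X Y : Prop :=
  forall (m n : nat) (B : 'I_m -> set R) (B' : 'I_n -> set R)
         (A : 'I_m -> set V) (A' : 'I_n -> set V),
    (forall i, bounded_Borel (B i)) -> (forall j, bounded_Borel (B' j)) ->
    (forall i, measurable (A i)) -> (forall j, measurable (A' j)) ->
    P ([set w | forall i, A i (X (B i) w)] `&`
       [set w | forall j, A' j (Y (B' j) w)])
    = (P [set w | forall i, A i (X (B i) w)] *
       P [set w | forall j, A' j (Y (B' j) w)])%E.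

Variables (a b : \bar R).

Definition simple_integral X (phi : simple_fun a b) (B : set R) (w : Omega) : V :=
  \sum_(j < sf_card phi) sf_coef j *: X (B `&` sf_piece j) w.

(* J is a version of B |-> \int_B f dX on B^0_(a,b); J B is determined up to
   almost sure equality. *)
Definition is_integral X (f : R -> R) J : Prop :=
  exists phi : nat -> simple_fun a b,
    {ae @lebesgue_measure R, forall s, ereal_ooitv a b s ->
      simple_eval (phi n) s @[n --> \oo] --> f s} /\
    forall B, inner_Borel a b B ->
      cvg_in_probability \oo (fun n => simple_integral X (phi n) B) (J B).

Definition locally_integrable X (f : R -> R) : Prop :=
  exists J, is_integral X f J.

Definition improper_filter : set_system (R * R) :=
  filter_prod (right_filter a) (left_filter b).

Definition improper_definable X (f : R -> R) : Prop :=
  exists J L, is_integral X f J /\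
    cvg_in_probability improper_filter
      (fun pq => J `]pq.1, pq.2]%classic) L.

Definition improper_definable_es X (f : R -> R) : Prop :=
  exists J (g : R -> R -> V) L, is_integral X f J /\
    cvg_in_probability improper_filter
      (fun pq w => J `]pq.1, pq.2]%classic w - g pq.1 pq.2) L.

End fixed_space.

Implicit Types (mu : probability V R) (a b : \bar R) (f : R -> R).

(* X^(mu) is unique in law, and the properties below only depend on its law:
   they are required of all its realizations, on all probability spaces. *)
Definition locally_integrable_for mu a b f : Prop :=
  forall (dO : measure_display) (Omega : measurableType dO)
         (P : probability Omega R) (X : set R -> Omega -> V),
    random_measure P mu X -> locally_integrable P a b X f.

Definition definable mu a b f : Prop :=
  forall (dO : measure_display) (Omega : measurableType dO)
         (P : probability Omega R) (X : set R -> Omega -> V),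
    random_measure P mu X -> improper_definable P a b X f.

Definition definable_es mu a b f : Prop :=
  forall (dO : measure_display) (Omega : measurableType dO)
         (P : probability Omega R) (X : set R -> Omega -> V),
    random_measure P mu X -> improper_definable_es P a b X f.

Definition definable_c mu a b f : Prop :=
  exists theta : V, definable (convolution mu (dirac (- theta))) a b f.

(* Two independent realizations of X^(mu) have the same law, hence Y is an
   independent copy of X. *)
Definition definable_sym mu a b f : Prop :=
  forall (dO : measure_display) (Omega : measurableType dO)
         (P : probability Omega R) (X Y : set R -> Omega -> V),
    random_measure P mu X -> random_measure P mu Y ->
    independent_measures P X Y ->
    improper_definable P a b (fun B w => X B w - Y B w) f.

Definition Dom a b f : set (probability V R) :=
  [set mu | [/\ infinitely_divisible mu, locally_integrable_for mu a b f
              & definable mu a b f]].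

Definition Dom_es a b f : set (probability V R) :=
  [set mu | [/\ infinitely_divisible mu, locally_integrable_for mu a b f
              & definable_es mu a b f]].

Definition Dom_c a b f : set (probability V R) :=
  [set mu | [/\ infinitely_divisible mu, locally_integrable_for mu a b f
              & definable_c mu a b f]].

Definition Dom_sym a b f : set (probability V R) :=
  [set mu | [/\ infinitely_divisible mu, locally_integrable_for mu a b f
              & definable_sym mu a b f]].

Definition Dom0 a b f : set (probability V R) :=
  [set mu | [/\ infinitely_divisible mu, locally_integrable_for mu a b f
    & exists C, is_cumulant mu C /\ forall z : V,
        (\int[@lebesgue_measure R]_(s in ereal_ooitv a b)
           (Normc.normc (C (f s *: z)))%:E < +oo)%E]].

End stochastic_integrals.

Arguments Dom {R} d a b f.
Arguments Dom_es {R} d a b f.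
Arguments Dom_c {R} d a b f.
Arguments Dom_sym {R} d a b f.
Arguments Dom0 {R} d a b f.

(* Main.v *)
Require Import Defs.
From mathcomp Require Import all_boot all_order all_algebra.
From mathcomp Require Import complex ring lra.
From mathcomp Require Import all_classical all_reals all_analysis.
From mathcomp Require Import measurable_realfun.

Set Implicit Arguments.
Unset Strict Implicit.
Unset Printing Implicit Defensive.
Import Order.TTheory GRing.Theory Num.Theory.
Import numFieldTopology.Exports numFieldNormedType.Exports.
Local Open Scope classical_set_scope.
Local Open Scope ring_scope.

(** All the domains are compared through the characteristic functions of the real
    variables <z, J(B)>, where J is a version of the integral of [f].

    The main tool is the Levy-Khintchine formula. If [mu] has a cumulant C, then
    the characteristic function of <z, X(B)> is exp of |B| C(z) ([process_chf]); by
    independence, for a step function e, that of the integral of e over B is the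
    exponential of the integral over B of C(e(s) z) ([lincomb_chf]). The formula
    extends to [f] ([limit_chf], [integral_chf]), although the definition of the
    integral gives no control on the cumulants of the approximating step
    functions: a gliding hump argument replaces it ([gliding_hump]). For the zero
    function, the formula says that the integral does not depend on the
    approximation ([integral_unique]). For the difference of two independent copies
    of X it holds with the cumulant ln |mu^|^2 ([sym_cumulant_process]); mu^ has no
    zeros because the values of X on short intervals tend to 0 ([charfun_neq0]).

    First inclusion: the cumulants of the integrals over the differences of two
    large intervals tend to 0 by dominated convergence, hence the improper integral
    satisfies the Cauchy criterion ([integrable_cumulant_cvg]). Second inclusion:
    take theta = 0. Third inclusion: on the product space, X(w1) - X(w2) does not
    change when X is centered. By uniqueness, the integrals J and J' with respect
    to X and to the centered measure satisfy J(w1) - J(w2) = J'(w1) - J'(w2), so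
    that J - J' is a constant ([shifted_es]).

    Last equality: the characteristic functions of the integrals with respect to
    X - Y are the squared moduli of those with respect to X, which do not see the
    centering ([es_sym]). Conversely, if J(w1) - J(w2) converges in probability, its
    limit has the form L(w1) - L(w2) ([symmetrized_limit]); then J - L is close to
    an independent copy of itself, hence to a constant ([tau_sub_cst]), which is the
    required centering ([sym_es]). *)

(** * Convergence in probability *)

Section trig.
Context (R : realType).

Lemma cos_lip (x y : R) : `|cos x - cos y| <= `|x - y|.
Proof.
wlog xy : x y / y <= x.
  by move=> h; have [/h//|/ltW/h] := leP y x; rewrite distrC (distrC y).
have [|c _ ->] := @MVT_segment R cos (fun x => - sin x) y x xy.
  by apply: continuous_subspaceT => z; exact: continuous_cos.
by rewrite normrM normrN ler_piMl// sin_max.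
Qed.

Lemma sin_lip (x y : R) : `|sin x - sin y| <= `|x - y|.
Proof.
wlog xy : x y / y <= x.
  by move=> h; have [/h//|/ltW/h] := leP y x; rewrite distrC (distrC y).
have [|c _ ->] := @MVT_segment R sin cos y x xy.
  by apply: continuous_subspaceT => z; exact: continuous_sin.
by rewrite normrM ler_piMl// cos_max.
Qed.

Lemma cosD_dist (x y : R) : `|cos (x + y) - cos x| <= 2 * Num.min 1 `|y|.
Proof.
rewrite /Num.min; case: ifPn => _.
  rewrite mulr1 (le_trans (ler_normB _ _))//.
  by rewrite (_ : 2 = 1 + 1)// lerD// cos_max.
rewrite (le_trans (cos_lip _ _))// addrAC subrr add0r.
by rewrite ler_peMl// ler1n.
Qed.

Lemma sinD_dist (x y : R) : `|sin (x + y) - sin x| <= 2 * Num.min 1 `|y|.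
Proof.
rewrite /Num.min; case: ifPn => _.
  rewrite mulr1 (le_trans (ler_normB _ _))//.
  by rewrite (_ : 2 = 1 + 1)// lerD// sin_max.
rewrite (le_trans (sin_lip _ _))// addrAC subrr add0r.
by rewrite ler_peMl// ler1n.
Qed.

End trig.

Section bounded_variables.
Context d (T : measurableType d) (R : realType) (P : probability T R).
Implicit Types (Z W : T -> R).

Lemma integrable_bounded (M : R) Z : measurable_fun setT Z ->
  (forall w, `|Z w| <= M) -> P.-integrable setT (EFin \o Z).
Proof.
move=> mZ ZM; apply: measurable_bounded_integrable => //.
  by rewrite (le_lt_trans (probability_le1 _ _))// ltry.
exists M; split; first exact: num_real.
by move=> x Mx w _; exact: le_trans (ZM w) (ltW Mx).
Qed.

Lemma bounded_cvg (M : R) (Z : nat -> T -> R) Z0 :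
  (forall n, measurable_fun setT (Z n)) -> measurable_fun setT Z0 ->
  (forall n w, `|Z n w| <= M) ->
  {ae P, forall w, Z n w @[n --> \oo] --> Z0 w} ->
  \int[P]_w Z n w @[n --> \oo] --> \int[P]_w Z0 w.
Proof.
move=> mZ mZ0 ZM cZ.
have iM : P.-integrable setT (cst M%:E).
  by apply: (@integrable_bounded `|M|) => // w; rewrite /cst.
have [|||||] := @dominated_convergence _ _ _ P setT measurableT
    (fun n => EFin \o Z n) (EFin \o Z0) (cst M%:E).
- by move=> n; exact/measurable_EFinP.
- exact/measurable_EFinP.
- by apply: filterS cZ => w cw _; exact: cvg_comp cw _.
- exact: iM.
- by apply: aeW => w n _; rewrite lee_fin.
move=> iZ0 _ h; apply: fine_cvg.
by rewrite fineK; [exact: h|exact: integrable_fin_num].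
Qed.

Lemma Rintegral_prob_cst (r : R) : \int[P]_w r = r.
Proof.
have h : fine (P setT) = 1 by rewrite probability_setT.
by rewrite Rintegral_cst// [fine _]h mulr1.
Qed.

End bounded_variables.

Section tau.
Context d (T : measurableType d) (R : realType) (P : probability T R).
Implicit Types (Z W : T -> R).

(** A distance to 0 that metrizes convergence in probability ([tau_cvgP]). *)
Definition tau Z : R := \int[P]_w Num.min 1 `|Z w|.

Let trunc_bound Z w : `|Num.min 1 `|Z w| | <= 1.
Proof. by rewrite ger0_norm ?ge_min ?lexx// le_min ler01 normr_ge0. Qed.

Lemma measurable_trunc Z : measurable_fun setT Z ->
  measurable_fun setT (fun w => Num.min 1 `|Z w|).
Proof. by move=> mZ; apply: measurable_minr => //; exact: measurableT_comp. Qed.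

Lemma integrable_trunc Z : measurable_fun setT Z ->
  P.-integrable setT (EFin \o (fun w => Num.min 1 `|Z w|)).
Proof. by move=> mZ; apply: integrable_bounded (trunc_bound Z); exact: measurable_trunc. Qed.

Lemma tau_ge0 Z : 0 <= tau Z.
Proof. by apply: Rintegral_ge0 => w _; rewrite le_min ler01 normr_ge0. Qed.

Lemma tau_le Z W : measurable_fun setT Z -> measurable_fun setT W ->
  (forall w, `|Z w| <= `|W w|) -> tau Z <= tau W.
Proof.
move=> mZ mW ZW; apply: le_Rintegral; [by []|exact: integrable_trunc|exact: integrable_trunc|].
by move=> w _; rewrite le_min !ge_min lexx ZW orbT.
Qed.

Lemma tauD Z W : measurable_fun setT Z -> measurable_fun setT W ->
  tau (fun w => Z w + W w) <= tau Z + tau W.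
Proof.
move=> mZ mW; rewrite /tau -RintegralD//; [|exact: integrable_trunc|exact: integrable_trunc].
apply: le_Rintegral => //.
- by apply: integrable_trunc; exact: measurable_funD.
- apply: (@integrable_bounded _ _ _ _ 2).
    by apply: measurable_funD; exact: measurable_trunc.
  move=> w; rewrite (_ : 2 = 1 + 1)// (le_trans (ler_normD _ _))//.
  by rewrite lerD.
- move=> w _; have := ler_normD (Z w) (W w).
  by have := normr_ge0 (Z w); have := normr_ge0 (W w);
  rewrite /Num.min; do !case: ifPn; rewrite -?leNgt; lra.
Qed.

Lemma tauZ r Z : measurable_fun setT Z ->
  tau (fun w => r * Z w) <= (1 + `|r|) * tau Z.
Proof.
move=> mZ; rewrite /tau -RintegralZl//; [|exact: integrable_trunc].
apply: le_Rintegral => //.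
- by apply: integrable_trunc; exact: measurable_funM.
- apply: (@integrable_bounded _ _ _ _ (`|1 + `|r| |)).
    by apply: measurable_funM => //; exact: measurable_trunc.
  by move=> w; rewrite normrM ler_piMr.
- move=> w _; rewrite normrM.
  have := normr_ge0 (Z w); have := normr_ge0 r.
  by rewrite /Num.min; do !case: ifPn; rewrite -?leNgt; nra.
Qed.

Lemma tau_ae Z W : measurable_fun setT Z -> measurable_fun setT W ->
  {ae P, forall w, Z w = W w} -> tau Z = tau W.
Proof.
move=> mZ mW ZW; congr fine; apply: ae_eq_integral => //.
- by apply/measurable_EFinP; exact: measurable_trunc.
- by apply/measurable_EFinP; exact: measurable_trunc.
- by apply: filterS ZW => w -> _.
Qed.

Lemma tau0_ae Z : measurable_fun setT Z -> tau Z = 0 ->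
  {ae P, forall w, Z w = 0}.
Proof.
move=> mZ Z0.
have : (\int[P]_w `|(Num.min 1 `|Z w|)%:E| = 0)%E.
  transitivity ((tau Z)%:E); last by rewrite Z0.
  rewrite /tau /Rintegral fineK; last exact: integrable_fin_num (integrable_trunc mZ).
  by apply: eq_integral => w _; rewrite gee0_abs// lee_fin le_min ler01 normr_ge0.
move/ae_eq_integral_abs => /=; case=> //.
  by apply/measurable_EFinP; exact: measurable_trunc.
move=> N h; exists N; case: h => mN N0 h; split => // w nZ; apply: h => /= H.
apply: nZ; move: (H I) => [].
by rewrite /Num.min; case: ifPn => // _ /eqP; rewrite ?normr_eq0 ?oner_eq0// => /eqP.
Qed.

Lemma tau_ae_cvg (Z : nat -> T -> R) : (forall n, measurable_fun setT (Z n)) ->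
  {ae P, forall w, Z n w @[n --> \oo] --> 0} -> tau (Z n) @[n --> \oo] --> 0.
Proof.
move=> mZ cZ; rewrite (_ : (0 : R) = \int[P]_w 0); last by rewrite Rintegral_cst// mul0r.
apply: (@bounded_cvg _ _ _ _ 1) => //.
- by move=> n; exact: measurable_trunc.
- apply: filterS cZ => w /cvg_norm; rewrite normr0 => h.
  apply: (squeeze_cvgr _ (cvg_cst 0) h); apply: nearW => n.
  by rewrite le_min ler01 normr_ge0 ge_min lexx orbT.
Qed.

Lemma measurable_tail (e : R) Z : measurable_fun setT Z ->
  measurable [set w | e <= `|Z w|].
Proof.
move=> mZ; rewrite -[X in measurable X]setTI.
have mn : measurable_fun setT (fun w => `|Z w|) by exact: measurableT_comp.
have := mn measurableT `[e, +oo[%classic (measurable_itv _).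
by congr measurable; apply/seteqP; split => w /=; rewrite in_itv/= andbT.
Qed.

Lemma tau_markov Z (e : R) : measurable_fun setT Z -> 0 < e ->
  ((Num.min 1 e)%:E * P [set w | (e <= `|Z w|)%R] <= (tau Z)%:E)%E.
Proof.
move=> mZ e0; have m0 : 0 < Num.min 1 e by rewrite lt_min ltr01.
have mA := measurable_tail e mZ.
rewrite -[X in P X]setIT -integral_indic// -ge0_integralZl//=;
  do ?[by apply/measurable_EFinP; exact: measurable_indic|by rewrite lee_fin ltW].
rewrite /tau /Rintegral fineK; last exact: integrable_fin_num (integrable_trunc mZ).
apply: ge0_le_integral => //.
  + by move=> w _; rewrite lee_fin mulr_ge0// ltW.
  + by apply/measurable_EFinP; apply: measurable_funM => //; exact: measurable_indic.
  + by apply/measurable_EFinP; exact: measurable_trunc.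
  + move=> w _; rewrite lee_fin indicE; have [wA|_] := boolP (w \in _).
      move: wA; rewrite inE/= => wA; rewrite mulr1 le_min !ge_min lexx wA/=.
      by rewrite orbT.
    by rewrite mulr0 le_min ler01 normr_ge0.
Qed.

Lemma tau_le_prob Z (e : R) : measurable_fun setT Z -> 0 <= e ->
  tau Z <= e + fine (P [set w | (e <= `|Z w|)%R]).
Proof.
move=> mZ e0.
have mA := measurable_tail e mZ.
set A := [set w | _].
have iA : P.-integrable setT (EFin \o (\1_A : T -> R)).
  apply: (@integrable_bounded _ _ _ _ 1); first exact: measurable_indic.
  by move=> w; rewrite indicE; case: (_ \in _); rewrite ?normr1// normr0.
have ie : P.-integrable setT (EFin \o (cst e : T -> R)).
  by apply: (@integrable_bounded _ _ _ _ `|e|).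
have -> : e + fine (P A) = \int[P]_w (e + \1_A w).
  rewrite RintegralD// Rintegral_prob_cst; congr (_ + _).
  by rewrite /Rintegral integral_indic// setIT.
apply: le_Rintegral => //; first exact: integrable_trunc.
  apply: (@integrable_bounded _ _ _ _ (`|e| + 1)).
    by apply: measurable_funD => //; exact: measurable_indic.
  move=> w; rewrite (le_trans (ler_normD _ _))// lerD2l indicE.
  by case: (_ \in _); rewrite ?normr1// normr0.
move=> w _; rewrite indicE; have [_|] := boolP (w \in A).
  by rewrite ge_min ler_wpDl.
by rewrite notin_setE /A/= => /negP; rewrite -ltNge addr0 ge_min => /ltW->; rewrite orbT.
Qed.

Lemma tau_cvgP (I : Type) (F : set_system I) (FF : Filter F) (Z : I -> T -> R) :
  (forall i, measurable_fun setT (Z i)) ->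
  tau (Z i) @[i --> F] --> 0 <->
  forall e : R, 0 < e -> P [set w | (e <= `|Z i w|)%R] @[i --> F] --> 0%E.
Proof.
move=> mZ; split => [h e e0|h].
  have m0 : 0 < Num.min 1 e by rewrite lt_min ltr01.
  apply: (@squeeze_cvge _ _ _ _ (cst 0%E) _ (fun i => (tau (Z i) / Num.min 1 e)%:E)).
  - apply: nearW => i; rewrite measure_ge0/= mulrC EFinM -lee_pdivrMl ?invrK//.
      exact: tau_markov.
    by rewrite invr_gt0.
  - exact: cvg_cst.
  - apply/fine_cvgP; split; first by apply: nearW.
    by rewrite -[X in _ --> X](mul0r (Num.min 1 e)^-1); exact: cvgMl.
apply/cvgrPdist_le => e e0; have e20 : 0 < e / 2 by rewrite divr_gt0.
have /fine_cvgP[_ /cvgrPdist_le/(_ _ e20)] := h _ e20.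
apply: filterS => i /=; rewrite !sub0r !normrN => H.
rewrite ger0_norm ?tau_ge0// (le_trans (tau_le_prob (mZ i) (ltW e20)))//.
by rewrite [leRHS]splitr lerD2l (le_trans (ler_norm _)).
Qed.

End tau.

(** * Characteristic functions of real random variables *)

(** Stated on the coordinates, so that no topology on [R[i]] is involved. *)
Definition ccvg (R : realType) (I : Type) (F : set_system I) (u : I -> R[i])
  (l : R[i]) : Prop :=
  complex.Re (u i) @[i --> F] --> complex.Re l /\
  complex.Im (u i) @[i --> F] --> complex.Im l.

Section ccvg.
Context (R : realType) (I : Type) (F : set_system I).
Implicit Types u v : I -> R[i].

Lemma ccvg_cst (FF : Filter F) (l : R[i]) : ccvg F (fun=> l) l.
Proof. by split; exact: cvg_cst. Qed.

Lemma ccvgM (FF : Filter F) u v (l m : R[i]) : ccvg F u l -> ccvg F v m ->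
  ccvg F (fun i => u i * v i) (l * m).
Proof.
move=> [ru iu] [rv iv].
have eRe (x y : R[i]) : complex.Re (x * y) =
    complex.Re x * complex.Re y - complex.Im x * complex.Im y.
  by case: x => ? ?; case: y.
have eIm (x y : R[i]) : complex.Im (x * y) =
    complex.Re x * complex.Im y + complex.Im x * complex.Re y.
  by case: x => ? ?; case: y.
split.
- under eq_fun do rewrite eRe.
  by rewrite eRe; apply: cvgB; exact: cvgM.
- under eq_fun do rewrite eIm.
  by rewrite eIm; apply: cvgD; exact: cvgM.
Qed.

Lemma ccvg_unique (FF : ProperFilter F) u (l m : R[i]) :
  ccvg F u l -> ccvg F u m -> l = m.
Proof.
move=> [ru iu] [rv iv]; apply/eqP; rewrite eq_complex; apply/andP.
by split; apply/eqP; [exact: cvg_unique ru rv|exact: cvg_unique iu iv].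
Qed.

End ccvg.

Section chf.
Context d (T : measurableType d) (R : realType) (P : probability T R).
Implicit Types (Z W : T -> R).

(** The characteristic function of a real random variable, at 1. *)
Definition chf Z : R[i] := Complex (\int[P]_w cos (Z w)) (\int[P]_w sin (Z w)).

Lemma integrable_cos Z : measurable_fun setT Z ->
  P.-integrable setT (EFin \o (fun w => cos (Z w))).
Proof.
move=> mZ; apply: (@integrable_bounded _ _ _ _ 1) => [|w]; last exact: cos_max.
exact: measurableT_comp (continuous_measurable_fun (@continuous_cos R)) mZ.
Qed.

Lemma integrable_sin Z : measurable_fun setT Z ->
  P.-integrable setT (EFin \o (fun w => sin (Z w))).
Proof.
move=> mZ; apply: (@integrable_bounded _ _ _ _ 1) => [|w]; last exact: sin_max.
exact: measurableT_comp (continuous_measurable_fun (@continuous_sin R)) mZ.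
Qed.

Lemma chf_ae Z W : measurable_fun setT Z -> measurable_fun setT W ->
  {ae P, forall w, Z w = W w} -> chf Z = chf W.
Proof.
move=> mZ mW ZW; congr Complex; congr fine; apply: ae_eq_integral => //;
  do ?[by apply: measurable_int; [exact: integrable_cos|exact: integrable_sin]].
- exact: measurable_int (integrable_cos mZ).
- exact: measurable_int (integrable_cos mW).
- by apply: filterS ZW => w -> _.
- exact: measurable_int (integrable_sin mZ).
- exact: measurable_int (integrable_sin mW).
- by apply: filterS ZW => w -> _.
Qed.

Lemma chf0 : chf (fun=> 0) = 1.
Proof.
by rewrite /chf cos0 sin0 !Rintegral_prob_cst.
Qed.

Lemma chfD_dist Z W : measurable_fun setT Z -> measurable_fun setT W ->
  `|complex.Re (chf (fun w => Z w + W w)) - complex.Re (chf Z)| <= 2 * tau P W /\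
  `|complex.Im (chf (fun w => Z w + W w)) - complex.Im (chf Z)| <= 2 * tau P W.
Proof.
move=> mZ mW; have mZW : measurable_fun setT (fun w => Z w + W w).
  exact: measurable_funD.
have mt := measurable_trunc mW; have it := integrable_trunc P mW.
have it2 : P.-integrable setT (EFin \o (fun w => 2 * Num.min 1 `|W w|)).
  apply: (@integrable_bounded _ _ _ _ 2) => [|w]; first exact: measurable_funM.
  by rewrite ger0_norm ?ler_piMr// ?mulr_ge0// ?ge_min ?lexx// le_min ler01 normr_ge0.
rewrite /tau -!RintegralZl//= -!RintegralB//;
  [|exact: integrable_sin|exact: integrable_sin|exact: integrable_cos|exact: integrable_cos].
split; (apply: le_trans (le_normr_Rintegral _ _) _ => //; last apply: le_Rintegral => //).
- exact: integrableB (integrable_cos mZW) (integrable_cos mZ).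
- exact: integrable_norm (integrableB _ (integrable_cos mZW) (integrable_cos mZ)).
- by move=> w _; exact: cosD_dist.
- exact: integrableB (integrable_sin mZW) (integrable_sin mZ).
- exact: integrable_norm (integrableB _ (integrable_sin mZW) (integrable_sin mZ)).
- by move=> w _; exact: sinD_dist.
Qed.

Lemma chf_cvg (I : Type) (F : set_system I) (FF : Filter F) (Z : I -> T -> R) Z0 :
  (forall i, measurable_fun setT (Z i)) -> measurable_fun setT Z0 ->
  tau P (fun w => Z i w - Z0 w) @[i --> F] --> 0 ->
  ccvg F (fun i => chf (Z i)) (chf Z0).
Proof.
move=> mZ mZ0 h.
have mB i : measurable_fun setT (fun w => Z i w - Z0 w) by exact: measurable_funB.
have e i : Z i = (fun w => Z0 w + (Z i w - Z0 w)).
  by apply/funext => w; rewrite addrC subrK.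
have {}h : 2 * tau P (fun w => Z i w - Z0 w) @[i --> F] --> 0.
  by rewrite -[X in _ --> X](mulr0 2); exact: cvgMr.
split; apply/cvgrPdist_le => r r0; move/cvgrPdist_le : h => /(_ _ r0);
  apply: filterS => i; rewrite sub0r normrN => hr; rewrite distrC (e i);
  have [h1 h2] := chfD_dist mZ0 (mB i).
- by rewrite (le_trans h1)// (le_trans (ler_norm _) hr).
- by rewrite (le_trans h2)// (le_trans (ler_norm _) hr).
Qed.

End chf.

Section cos_tau.
Context d (T : measurableType d) (R : realType) (P : probability T R).
Local Notation leb := (@lebesgue_measure R).

Lemma integral_1Bcos (M x : R) : 0 < M -> x != 0 ->
  (\int[leb]_(t in `[0%R, M]) (1 - cos (t * x))%:E = (M - sin (M * x) / x)%:E)%E.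
Proof.
move=> M0 x0.
have cf : continuous (fun t : R => 1 - cos (t * x)).
  move=> t; apply: cvgB; first exact: cvg_cst.
  apply: (@continuous_comp _ _ _ (fun t : R => t * x) cos); last exact: continuous_cos.
  by apply: cvgMl; exact: cvg_id.
have dF (t : R) : is_derive t 1 (fun t : R => t - sin (t * x) / x) (1 - cos (t * x)).
  apply: is_derive_eq.
  rewrite !scaler0 !add0r /GRing.scale/= mulr1; congr (_ - _).
  by rewrite mulrCA mulVf// mulr1.
have cF : continuous (fun t : R => t - sin (t * x) / x).
  move=> t; apply: differentiable_continuous; apply/derivable1_diffP.
  exact: (@ex_derive _ _ _ _ _ _ _ (dF t)).
rewrite (@continuous_FTC2 _ _ (fun t : R => t - sin (t * x) / x))//.
- by rewrite mul0r sin0 mul0r subr0 sube0.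
- exact: continuous_subspaceT.
- split.
  + by move=> t _; exact: (@ex_derive _ _ _ _ _ _ _ (dF t)).
  + exact: cvg_at_right_filter (cF _).
  + exact: cvg_at_left_filter (cF _).
- by move=> t _; rewrite derive1E (@derive_val _ _ _ _ _ _ _ (dF t)).
Qed.

(** By [integral_1Bcos], the integral of 1 - cos (t x) over 0 <= t <= 2 / e is
    2 / e - sin (2 x / e) / x, which is at least 1 / e as soon as e <= |x|: the
    tail is controlled by an average of the characteristic function near 0. *)
Lemma prob_le_cos (Z : T -> R) (e : R) : measurable_fun setT Z -> 0 < e ->
  (e^-1%:E * P [set w | (e <= `|Z w|)%R] <=
   \int[leb]_(t in `[0%R, (2 / e)%R]) (1 - \int[P]_w cos (t * Z w))%:E)%E.
Proof.
move=> mZ e0; set M := 2 / e; have M0 : 0 < M by rewrite divr_gt0.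
pose g (p : T * R) : \bar R := (1 - cos (p.2 * Z p.1))%:E.
have mg0 : measurable_fun [set: T * R] (fun p : T * R => 1 - cos (p.2 * Z p.1)).
  apply: measurable_funB => //.
  apply: measurableT_comp (continuous_measurable_fun (@continuous_cos R)) _.
  by apply: measurable_funM => //; exact: (measurableT_comp mZ measurable_fst).
have g0 p : (0 <= g p)%E by rewrite lee_fin subr_ge0 cos_le1.
have mI : measurable_fun [set: T * R] (fun p : T * R => \1_`[0, M] p.2 : R).
  exact: (measurableT_comp (measurable_indic (measurable_itv _)) measurable_snd).
pose h (p : T * R) : \bar R := (\1_`[0, M] p.2 * (1 - cos (p.2 * Z p.1)))%:E.
have mh : measurable_fun setT h.
  by apply/measurable_EFinP; exact: measurable_funM.
have h0 p : (0 <= h p)%E by rewrite lee_fin mulr_ge0// -lee_fin g0.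
have := @fubini_tonelli _ _ _ _ _ P leb h mh h0.
have -> : (\int[leb]_t \int[P]_w h (w, t) =
   \int[leb]_(t in `[0%R, M]) (1 - \int[P]_w cos (t * Z w))%:E)%E.
  rewrite [RHS]integral_mkcond; apply: eq_integral => t _; rewrite patchE.
  have hE w : h (w, t) = (if t \in `[0, M]%classic then 1 - cos (t * Z w) else 0)%:E.
    by rewrite /h/= indicE; case: ifP => _; rewrite ?mul1r ?mul0r.
  under eq_integral do rewrite hE.
  case: ifPn => tM; last by rewrite integral0.
  have mtZ : measurable_fun setT (fun w => t * Z w) by exact: measurable_funM.
  have i1 : P.-integrable setT (EFin \o (cst 1 : T -> R)).
    by apply: (@integrable_bounded _ _ _ _ 1) => // w; rewrite normr1.
  transitivity ((\int[P]_w (1 - cos (t * Z w)))%:E).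
    rewrite /Rintegral fineK//; apply: integrable_fin_num => //.
    exact: (integrableB _ i1 (integrable_cos P mtZ)).
  rewrite RintegralB//; last exact: integrable_cos.
  by rewrite Rintegral_prob_cst.
move=> <-.
have mA : measurable [set w | e <= `|Z w|] by exact: measurable_tail.
rewrite -[X in P X]setIT -integral_indic// -ge0_integralZl//=;
  do ?[by apply/measurable_EFinP; exact: measurable_indic|by rewrite lee_fin ltW// invr_gt0].
apply: ge0_le_integral => //.
- by move=> w _; rewrite lee_fin mulr_ge0// invr_ge0 ltW.
- by apply/measurable_EFinP; apply: measurable_funM => //; exact: measurable_indic.
- exact: measurable_fun_fubini_tonelli_F.
move=> w _; rewrite indicE; have [wA|_] := boolP (w \in _); last first.
  by rewrite -EFinM mulr0; apply: integral_ge0.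
move: wA; rewrite inE/= => wA; rewrite -EFinM mulr1.
have Zw0 : Z w != 0 by rewrite -normr_gt0 (lt_le_trans e0).
have -> : (\int[leb]_t h (w, t) = \int[leb]_(t in `[0%R, M]) (1 - cos (t * Z w))%:E)%E.
  rewrite [RHS]integral_mkcond; apply: eq_integral => t _; rewrite patchE /h/= indicE.
  by case: ifP => _; rewrite ?mul1r ?mul0r.
rewrite integral_1Bcos// lee_fin /M.
have : `|sin (2 / e * Z w) / Z w| <= e^-1.
  rewrite normrM normfV ler_pdivrMr ?normr_gt0// (le_trans (sin_max _))//.
  by rewrite ler_pdivlMl// mulr1.
by move=> /(le_trans (ler_norm _)); lra.
Qed.

(** The case of Levy's continuity theorem where the limit is 0: the averages that
    bound the tails in [prob_le_cos] tend to 0 by dominated convergence. *)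
Lemma tau_cvg_cos (Z : nat -> T -> R) : (forall n, measurable_fun setT (Z n)) ->
  (forall t : R, \int[P]_w cos (t * Z n w) @[n --> \oo] --> (1 : R)) ->
  tau P (Z n) @[n --> \oo] --> 0.
Proof.
move=> mZ h; apply/(@tau_cvgP _ _ _ P nat \oo) => // e e0.
set M := 2 / e.
have mcos n : measurable_fun setT (fun t : R => 1 - \int[P]_w cos (t * Z n w)).
  apply: measurable_funB => //.
  pose g (p : R * T) : R := cos (p.1 * Z n p.2).
  have mg : measurable_fun setT g.
    apply: measurableT_comp (continuous_measurable_fun (@continuous_cos R)) _.
    by apply: measurable_funM => //; exact: (measurableT_comp (mZ n) measurable_snd).
  have mg1 : measurable_fun setT (fun p => (1 + g p)%:E).
    by apply/measurable_EFinP; exact: measurable_funD.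
  have := @measurable_fun_fubini_tonelli_F _ _ _ _ _ P (fun p => (1 + g p)%:E) mg1.
  have g0 p : (0 <= (1 + g p)%:E)%E.
    by rewrite lee_fin -lerBlDl sub0r cos_geN1.
  move=> /(_ g0) => mF.
  have -> : (fun t => \int[P]_w cos (t * Z n w)) =
            (fun t => fine (fubini_F P (fun p => (1 + g p)%:E) t) - 1).
    apply/funext => t; rewrite /fubini_F.
    have mtZ : measurable_fun setT (fun w => t * Z n w) by exact: measurable_funM.
    rewrite -[X in _ = X - _]/(\int[P]_w (1 + g (t, w))) RintegralD//.
    - by rewrite Rintegral_prob_cst addrC addrA addNr add0r.
    - by apply: (@integrable_bounded _ _ _ _ 1) => // w; rewrite normr1.
    - exact: integrable_cos.
  by apply: measurable_funB => //; apply: measurableT_comp mF.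
have iM : leb.-integrable `[0, M]%classic (cst (2%:E : \bar R)).
  have hM : (leb `[0%R, M]%classic < +oo)%E.
    by rewrite lebesgue_measure_itv/=; case: ifPn => // _; rewrite -EFinB ltry.
  apply: (measurable_bounded_integrable (f := cst 2)) => //.
  by exists 2; split => // x x2 t _; rewrite /cst ger0_norm// ltW.
have [|||||_ _ c] := @dominated_convergence _ _ _ leb `[0, M]%classic (measurable_itv _)
    (fun n t => (1 - \int[P]_w cos (t * Z n w))%:E) (cst 0%E) (cst 2%:E) => //.
- by move=> n; apply/measurable_EFinP; exact: measurable_funS (mcos n).
- apply: aeW => t _; apply/fine_cvgP; split; first exact: nearW.
  by rewrite -[X in _ --> X](subrr 1); apply: cvgB; [exact: cvg_cst|exact: h].
- apply: aeW => t n _; rewrite lee_fin.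
  have mtZ : measurable_fun setT (fun w => t * Z n w) by exact: measurable_funM.
  rewrite (le_trans (ler_normB _ _))// normr1 (_ : 2 = 1 + 1)// lerD2l.
  apply: le_trans (le_normr_Rintegral _ (integrable_cos P mtZ)) _ => //.
  rewrite -[leRHS](Rintegral_prob_cst P); apply: le_Rintegral => //.
  + exact: integrable_norm (integrable_cos P mtZ).
  + by apply: (@integrable_bounded _ _ _ _ 1) => // w; rewrite normr1.
  + by move=> w _; exact: cos_max.
rewrite integral_cst//= mul0e in c.
apply: (@squeeze_cvge _ _ _ _ (cst 0%E) _ (fun n => e%:E *
    \int[leb]_(t in `[0%R, M]) (1 - \int[P]_w cos (t * Z n w))%:E)%E).
- apply: nearW => n; rewrite measure_ge0/= -lee_pdivrMl//; exact: prob_le_cos.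
- exact: cvg_cst.
- by rewrite -[X in _ --> X](mule0 e%:E); apply: cvgeZl.
Qed.

End cos_tau.

Lemma tau0 dT (T : measurableType dT) (R : realType) (P : probability T R) :
  tau P (fun=> 0) = 0.
Proof.
rewrite /tau; under eq_Rintegral do rewrite normr0 (min_idPr ler01).
by rewrite Rintegral_cst// mul0r.
Qed.

Lemma tau_cvg0_lin dT (T : measurableType dT) (R : realType) (P : probability T R)
    (Z W : nat -> T -> R) (r : R) :
  (forall i, measurable_fun setT (Z i)) -> (forall i, measurable_fun setT (W i)) ->
  tau P (Z i) @[i --> \oo] --> 0 -> tau P (W i) @[i --> \oo] --> 0 ->
  tau P (fun w => Z i w + r * W i w) @[i --> \oo] --> 0.
Proof.
move=> mZ mW cZ cW.
have hs : tau P (Z i) + (1 + `|r|) * tau P (W i) @[i --> \oo] --> 0.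
  rewrite -[X in _ --> X](addr0 0); apply: cvgD => //.
  by rewrite -[X in _ --> X](mulr0 (1 + `|r|)); apply: cvgMr.
apply: (squeeze_cvgr _ (cvg_cst 0) hs); apply: nearW => i.
rewrite tau_ge0/= (le_trans (tauD _ _ _))//.
  by apply: measurable_funM.
by rewrite lerD2l; exact: tauZ.
Qed.


(** * Completeness of convergence in probability *)

Section subsequences.
Context d (T : measurableType d) (R : realType) (P : probability T R).
Implicit Types (Z Y : nat -> T -> R).

(** The expectation of the sum is at most 2, hence the sum is almost surely finite. *)
Lemma ae_summable_tau Y : (forall k, measurable_fun setT (Y k)) ->
  (forall k, tau P (Y k) <= 2^-1 ^+ k) ->
  {ae P, forall w, cvgn (series (fun k => Num.min 1 `|Y k w|))}.
Proof.
move=> mY hY.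
pose f k w := (Num.min 1 `|Y k w|)%:E.
have f0 k w : (0 <= f k w)%E by rewrite lee_fin le_min ler01 normr_ge0.
have mf k : measurable_fun setT (f k).
  apply/measurable_EFinP; apply: measurable_minr => //; exact: measurableT_comp.
have fi k : (\int[P]_w f k w = (tau P (Y k))%:E)%E.
  rewrite /tau /Rintegral fineK//; apply: integrable_fin_num => //.
  apply: (@integrable_bounded _ _ _ P 1 (fun w => Num.min 1 `|Y k w|)).
    exact: measurable_trunc.
  by move=> w; rewrite ger0_norm ?ge_min ?lexx// le_min ler01 normr_ge0.
have : P.-integrable setT (fun w => \sum_(0 <= k <oo) f k w)%E.
  apply/integrableP; split.
    by apply: ge0_emeasurable_sum.
  under eq_integral do rewrite gee0_abs ?nneseries_ge0//.
  rewrite integral_nneseries//.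
  apply: (@le_lt_trans _ _ 2%:E); last by rewrite ltry.
  apply: lime_le.
    by apply: is_cvg_nneseries => k _ _; apply: integral_ge0.
  apply: nearW => n; under eq_bigr do rewrite fi.
  rewrite sumEFin lee_fin (@le_trans _ _ (series (geometric 1 2^-1) n))//.
    by rewrite /series/= ler_sum// => k _; rewrite mul1r.
  apply: (le_trans (geometric_le_lim n _ _ _)) => //.
  - by rewrite ger0_norm// invf_lt1// ltr1n.
  - have -> : (1 - 2^-1 : R) = 2^-1 by field.
    by rewrite div1r invrK.
move=> /(integrable_ae measurableT); apply: filterS => w /(_ I) fw.
apply: nondecreasing_is_cvgn.
  apply: nondecreasing_series => k _ _.
  by rewrite le_min ler01 normr_ge0.
exists (fine (\sum_(0 <= k <oo) f k w)%E) => _ [n _ <-].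
rewrite -lee_fin fineK// /series/= -sumEFin.
exact: nneseries_lim_ge.
Qed.

Lemma tau_subseq_ae Z : (forall n, measurable_fun setT (Z n)) ->
  tau P (Z n) @[n --> \oo] --> 0 ->
  exists u : nat -> nat, (forall k, (k <= u k)%N) /\
    {ae P, forall w, Z (u k) w @[k --> \oo] --> 0}.
Proof.
move=> mZ cZ.
have : forall k : nat, exists n, (k <= n)%N /\ tau P (Z n) <= 2^-1 ^+ k.
  move=> k; have k0 : (0 : R) < 2^-1 ^+ k by rewrite exprn_gt0.
  move/cvgrPdist_le : cZ => /(_ _ k0) [N _ NZ].
  exists (maxn N k); split; first exact: leq_maxr.
  have /= := NZ (maxn N k) (leq_maxl _ _).
  by rewrite sub0r normrN ger0_norm// tau_ge0.
move=> /choice[u hu]; exists u; split; first by move=> k; case: (hu k).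
have := @ae_summable_tau (fun k => Z (u k)) (fun k => mZ _) (fun k => (hu k).2).
apply: filterS => w /cvg_series_cvg_0 h.
apply/norm_cvg0P/cvgrPdist_lt => e e0.
have m0 : 0 < Num.min 1 e by rewrite lt_min ltr01.
move/cvgrPdist_lt : h => /(_ _ m0); apply: filterS => k.
rewrite !sub0r !normrN normr_id ger0_norm; last by rewrite le_min ler01 normr_ge0.
by rewrite /Num.min; do !case: ifPn; rewrite -?leNgt; lra.
Qed.

(** A subsequence whose increments are summable in [tau] converges almost surely;
    [G] replaces it by 0 on a null set to make the limit measurable. *)
Lemma tau_cauchy Z : (forall n, measurable_fun setT (Z n)) ->
  (forall e : R, 0 < e -> exists N, forall m n, (N <= m)%N -> (N <= n)%N ->
    tau P (fun w => Z m w - Z n w) <= e) ->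
  exists L : T -> R, measurable_fun setT L /\
    tau P (fun w => Z n w - L w) @[n --> \oo] --> 0.
Proof.
move=> mZ hZ.
have : forall k : nat, exists N, forall m n, (N <= m)%N -> (N <= n)%N ->
    tau P (fun w => Z m w - Z n w) <= 2^-1 ^+ k.
  by move=> k; apply: hZ; rewrite exprn_gt0.
move=> /choice[N hN].
(* [u k] and [u k.+1] are at least [N k], so that the k-th increment is at most
   2 ^- k in [tau]. *)
pose u k := (\sum_(i < k.+1) N i + k)%N.
have uN k : (N k <= u k)%N by rewrite /u big_ord_recr/= -addnA addnCA leq_addr.
have uN1 k : (N k <= u k.+1)%N.
  by rewrite (leq_trans (uN k))// /u [in leqRHS]big_ord_recr/= leq_add// leq_addr.
pose Y k w := Z (u k.+1) w - Z (u k) w.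
have mY k : measurable_fun setT (Y k) by exact: measurable_funB.
have := @ae_summable_tau Y mY (fun k => hN k _ _ (uN1 k) (uN k)).
move=> [A [mA A0 sA]].
have cZ w : ~ A w -> cvgn (fun k => Z (u k) w).
  move=> nA; have {}nA : cvgn (series (fun k => Num.min 1 `|Y k w|)).
    by apply: contrapT => h; apply: nA; exact: sA.
  have c0 := cvg_series_cvg_0 nA.
  have [K _ hK] : \forall k \near \oo, `|Y k w| = Num.min 1 `|Y k w|.
    move/cvgrPdist_lt : c0 => /(_ _ ltr01); apply: filterS => k.
    rewrite sub0r normrN ger0_norm; last by rewrite le_min ler01 normr_ge0.
    by rewrite /Num.min; case: ifPn => //; rewrite ltxx.
  have : cvgn (series (fun k => Y k w)).
    apply: normed_cvg; rewrite /= -(is_cvg_series_restrict K).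
    move: nA; rewrite -(is_cvg_series_restrict K).
    have -> // : [sequence \sum_(K <= k < n) [sequence `|Y n0 w|]_n0 k]_n =
        [sequence \sum_(K <= k < n) Num.min 1 `|Y k w|]_n :> (nat -> R).
    apply/funext => n; rewrite /= !big_nat; apply: eq_bigr => k /andP[Kk _].
    exact: hK.
  have -> : series (fun k => Y k w) = (fun k => Z (u k) w - Z (u 0%N) w).
    apply/funext => n; rewrite /series/=.
    by rewrite (telescope_sumr (fun k => Z (u k) w)).
  move=> h; rewrite (_ : (fun k => Z (u k) w) =
    (fun k => (Z (u k) w - Z (u 0%N) w) + Z (u 0%N) w)).
    by apply: is_cvgD => //; exact: is_cvg_cst.
  by apply/funext => k; rewrite subrK.
pose G k w := Z (u k) w * \1_(~` A) w.
have cG w : G ^~ w @ \oo --> limn (G ^~ w).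
  have [wA|wA] := boolP (w \in ~` A).
    rewrite (_ : G ^~ w = (fun k => Z (u k) w)).
      by apply: cZ; move: wA; rewrite inE.
    by apply/funext => k; rewrite /G indicE wA mulr1.
  rewrite (_ : G ^~ w = cst 0); first exact: is_cvg_cst.
  by apply/funext => k; rewrite /G indicE (negbTE wA) mulr0.
pose L w := limn (G ^~ w).
have mG k : measurable_fun setT (G k).
  by apply: measurable_funM => //; apply: measurable_indic; exact: measurableC.
have mL : measurable_fun setT L.
  exact: (@measurable_fun_cvg _ _ _ _ G L mG (fun w _ => cG w)).
exists L; split => //.
have hu : tau P (fun w => Z (u k) w - L w) @[k --> \oo] --> 0.
  apply: tau_ae_cvg => [k|]; first exact: measurable_funB.
  exists A; split => // w /= h; apply: contrapT => nA; apply: h.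
  rewrite -(subrr (L w)); apply: cvgB; last exact: cvg_cst.
  rewrite (_ : (fun k => Z (u k) w) = G ^~ w); first exact: cG.
  by apply/funext => k; rewrite /G indicE mem_set// mulr1.
apply/cvgrPdist_le => e e0; have e20 : 0 < e / 2 by rewrite divr_gt0.
have [N0 hN0] := hZ _ e20.
move/cvgrPdist_le : hu => /(_ _ e20)[K _ hK].
pose k := maxn K N0.
have uk : (N0 <= u k)%N by rewrite (leq_trans (leq_maxr K N0))// /u leq_addl.
exists N0 => // n /= N0n; rewrite sub0r normrN ger0_norm ?tau_ge0//.
have -> : (fun w => Z n w - L w) =
    (fun w => (Z n w - Z (u k) w) + (Z (u k) w - L w)).
  by apply/funext => w; rewrite addrA subrK.
apply: le_trans (tauD _ _ _) _; [exact: measurable_funB|exact: measurable_funB|].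
rewrite [leRHS]splitr; apply: lerD; first exact: hN0.
have /= := hK k (leq_maxl _ _).
by rewrite sub0r normrN ger0_norm// tau_ge0.
Qed.

End subsequences.

(** * Independence *)

Section independence.
Context d (T : measurableType d) (R : realType) (P : probability T R).

Lemma indep_sigma_algebra (E : set T) (G : set (set T)) : measurable E ->
  setI_closed G -> G `<=` measurable ->
  (forall F, G F -> P (E `&` F) = (P E * P F)%E) ->
  forall F, <<s G >> F -> P (E `&` F) = (P E * P F)%E.
Proof.
move=> mE GI Gm GE.
pose H := [set F | measurable F /\ P (E `&` F) = (P E * P F)%E].
suff HG : <<s G >> `<=` H by move=> F /HG [].
have PEfin : P E \is a fin_num by exact: fin_num_measure.
apply: (@lambda_system_subset _ _ GI setT).
- apply/dynkin_lambda_system; split.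
  + by split => //; rewrite setIT probability_setT mule1.
  + move=> F [mF hF]; split; first exact: measurableC.
    rewrite probability_setC// -setDE measureD//; last first.
      by rewrite (le_lt_trans (probability_le1 _ _)) ?ltry.
    transitivity (P E - P E * P F)%E; first by congr (_ - _)%E.
    by rewrite muleBr ?mule1// fin_num_adde_defl// fin_numN fin_num_measure.
  + move=> F tF HF; have mF n : measurable (F n) by case: (HF n).
    split; first exact: bigcupT_measurable.
    rewrite setI_bigcupr !measure_bigcup//; last 2 first.
    * by move=> n _; exact: measurableI.
    * by apply: trivIset_setIl.
    rewrite -(fineK PEfin) -nneseriesZl//.
    by apply: eq_eseriesr => n _; rewrite fineK//; case: (HF n).
- by move=> F GF; split; [exact: Gm|exact: GE].
- by move=> X _.
Qed.

(** The pi-system of the events that constrain finitely many variables. *)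
Definition cylinders dV (V : measurableType dV) n (U : 'I_n -> T -> V) :
    set (set T) :=
  [set F | exists A : 'I_n -> set V, (forall i, measurable (A i)) /\
     F = [set w | forall i, A i (U i w)]].

Lemma cylinders_measurable dV (V : measurableType dV) n (U : 'I_n -> T -> V) :
  (forall i, measurable_fun setT (U i)) -> cylinders U `<=` measurable.
Proof.
move=> mU _ [A [mA ->]].
rewrite (_ : [set w | _] = \big[setI/setT]_(i < n) (U i @^-1` A i)).
  by apply: bigsetI_measurable => i _; rewrite -[X in measurable X]setTI; exact: mU.
apply/seteqP; split => w /=.
  by move=> h; rewrite -bigcap_seq => i _; exact: h.
by rewrite -bigcap_seq => h i; apply: (h i); rewrite /= mem_index_enum.
Qed.

Lemma cylinders_setI dV (V : measurableType dV) n (U : 'I_n -> T -> V) :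
  setI_closed (cylinders U).
Proof.
move=> _ _ [A [mA ->]] [B [mB ->]]; exists (fun i => A i `&` B i); split.
  by move=> i; exact: measurableI.
by apply/seteqP; split => w /= => [[h1 h2] i|h]; [split|split=> i; case: (h i)].
Qed.

Lemma measurable_cylinder dV (V : measurableType dV) n (U : 'I_n -> T -> V) i :
  measurable_fun (setT : set (g_sigma_algebraType (cylinders U))) (U i).
Proof.
move=> _ A mA; rewrite setTI; apply: sub_sigma_algebra.
exists (fun j => if j == i then A else setT); split.
  by move=> j; case: ifP.
by apply/seteqP; split => w /= => [h j|/(_ i)]; [case: eqP => // ->|rewrite eqxx].
Qed.

Lemma indep_cylinders dV (V : measurableType dV) n (U : 'I_n -> T -> V)
    (E : set T) (W : T -> R) (B : set R) :
  measurable E -> (forall i, measurable_fun setT (U i)) ->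
  (forall A, (forall i, measurable (A i)) ->
    P (E `&` [set w | forall i, A i (U i w)]) =
    (P E * P [set w | forall i, A i (U i w)])%E) ->
  measurable_fun (setT : set (g_sigma_algebraType (cylinders U))) W ->
  measurable B ->
  P (E `&` W @^-1` B) = (P E * P (W @^-1` B))%E.
Proof.
move=> mE mU hE mW mB.
apply: (indep_sigma_algebra mE (@cylinders_setI _ _ _ U)).
- exact: cylinders_measurable.
- by move=> _ [A [mA ->]]; exact: hE.
- by have := mW measurableT B mB; rewrite setTI.
Qed.

Lemma indep_Rintegral (U W : T -> R) (f g : R -> R) :
  measurable_fun setT U -> measurable_fun setT W ->
  (forall A B, measurable A -> measurable B ->
    P (U @^-1` A `&` W @^-1` B) = (P (U @^-1` A) * P (W @^-1` B))%E) ->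
  measurable_fun setT f -> measurable_fun setT g ->
  (forall x, `|f x| <= 1) -> (forall x, `|g x| <= 1) ->
  \int[P]_w (f (U w) * g (W w)) = (\int[P]_w f (U w)) * (\int[P]_w g (W w)).
Proof.
move=> mU mW UW mf mg f1 g1.
have mUW : measurable_fun setT (fun w => (U w, W w)) by exact: measurable_fun_pair.
pose Up : {mfun T >-> R} := mfun_Sub (mem_set mU).
pose Wp : {mfun T >-> R} := mfun_Sub (mem_set mW).
pose UWp : {mfun T >-> (R * R)%type} := mfun_Sub (mem_set mUW).
pose m1 := distribution P Up; pose m2 := distribution P Wp.
pose m := distribution P UWp.
have mE X : measurable X -> (m1 \x m2)%E X = m X.
  by apply: product_measure_unique => A B mA mB; rewrite -UW.
pose h (p : R * R) : \bar R := (f p.1 * g p.2)%:E.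
have mh : measurable_fun setT h.
  apply/measurable_EFinP; apply: measurable_funM.
    exact: measurableT_comp mf measurable_fst.
  exact: measurableT_comp mg measurable_snd.
have h1 p : `|f p.1 * g p.2| <= 1 by rewrite normrM mulr_ile1.
have i1 : (m1 \x m2)%E.-integrable setT h.
  by apply: (@integrable_bounded _ _ _ _ 1 (fun p => f p.1 * g p.2)) => //; exact/measurable_EFinP.
have := @integral12_prod_meas1 _ _ _ _ _ m1 m2 h i1.
have -> : (\int[m1 \x m2]_z h z = \int[P]_w (f (U w) * g (W w))%:E)%E.
  rewrite (@eq_measure_integral _ _ _ _ m) => [|A mA _]; last exact: mE.
  rewrite integral_distribution//.
  apply: (@integrable_bounded _ _ _ _ 1 (fun w => f (U w) * g (W w))) => //.
    apply: measurable_funM.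
      exact: measurableT_comp mf mU.
    exact: measurableT_comp mg mW.
  by move=> w; exact: (h1 (U w, W w)).
have ig : P.-integrable setT (EFin \o (g \o W)).
  by apply: (@integrable_bounded _ _ _ _ 1) => [|w] /=; [exact: measurableT_comp mg mW|].
have if_ : P.-integrable setT (EFin \o (f \o U)).
  by apply: (@integrable_bounded _ _ _ _ 1) => [|w] /=; [exact: measurableT_comp mf mU|].
have ig2 : m2.-integrable setT (EFin \o g).
  exact: (@integrable_bounded _ _ _ _ 1).
have if1 : m1.-integrable setT (EFin \o f).
  exact: (@integrable_bounded _ _ _ _ 1).
have e2 : (\int[m2]_y (g y)%:E)%E = (\int[P]_w g (W w))%:E.
  rewrite integral_distribution//; last exact/measurable_EFinP.
  by rewrite /Rintegral fineK//; exact: integrable_fin_num ig.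
have -> : (\int[m1]_x fubini_F m2 h x =
    \int[m1]_x ((f x)%:E * (\int[P]_w g (W w))%:E))%E.
  apply: eq_integral => x _; rewrite /fubini_F /h/=.
  under eq_integral do rewrite EFinM.
  by rewrite (integralZl _ ig2)// e2.
rewrite integralZr//.
rewrite integral_distribution//; last exact/measurable_EFinP.
by move=> e; rewrite {1}/Rintegral -e fineM//=; exact: integrable_fin_num if_.
Qed.

Lemma chf_indep (U W : T -> R) :
  measurable_fun setT U -> measurable_fun setT W ->
  (forall A B, measurable A -> measurable B ->
    P (U @^-1` A `&` W @^-1` B) = (P (U @^-1` A) * P (W @^-1` B))%E) ->
  chf P (fun w => U w + W w) = chf P U * chf P W.
Proof.
move=> mU mW UW.
have mc := continuous_measurable_fun (@continuous_cos R).
have ms := continuous_measurable_fun (@continuous_sin R).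
have c1 := @cos_max R; have s1 := @sin_max R.
have I f g : measurable_fun setT f -> measurable_fun setT g ->
    (forall x : R, `|f x : R| <= 1) -> (forall x : R, `|g x : R| <= 1) ->
    P.-integrable setT (EFin \o (fun w => f (U w) * g (W w))).
  move=> mf mg f1 g1; apply: (@integrable_bounded _ _ _ _ 1).
    by apply: measurable_funM; [exact: measurableT_comp mf mU|exact: measurableT_comp mg mW].
  by move=> w; rewrite normrM mulr_ile1.
have -> : chf P (fun w => U w + W w) =
   Complex (\int[P]_w (cos (U w) * cos (W w) - sin (U w) * sin (W w)))
           (\int[P]_w (sin (U w) * cos (W w) + cos (U w) * sin (W w))).
  congr Complex; apply: eq_Rintegral => w _; [exact: cosD|exact: sinD].
rewrite RintegralB//; [|exact: I|exact: I].
rewrite RintegralD//; [|exact: I|exact: I].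
rewrite !indep_Rintegral//.
by apply/eqP; rewrite eq_complex/=; apply/andP; split; apply/eqP => //; rewrite addrC.
Qed.

End independence.

(** * Complex exponentials and continuous roots of unity *)

Section complex_exponential.
Context (R : realType).
Implicit Types (u v : R[i]).

Lemma expC0 : expC (0 : R[i]) = 1.
Proof. by rewrite /expC/= expR0 cos0 sin0 mulr1 mulr0. Qed.

Lemma expCD u v : expC (u + v) = expC u * expC v.
Proof.
case: u => a b; case: v => x y; apply/eqP; rewrite eq_complex/= expRD cosD sinD.
by apply/andP; split; apply/eqP; ring.
Qed.

Lemma expC_neq0 u : expC u != 0.
Proof.
have : expC u * expC (- u) = 1 by rewrite -expCD subrr expC0.
by move=> h; apply/eqP => u0; move/eqP: h; rewrite u0 mul0r eq_sym oner_eq0.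
Qed.

Lemma expCMn u n : expC u ^+ n = expC (n%:R * u).
Proof.
elim: n => [|n ih]; first by rewrite expr0 mul0r expC0.
by rewrite exprS ih -expCD -natr1 mulrDl mul1r addrC.
Qed.

Lemma ccvg_expC (I : Type) (F : set_system I) (FF : Filter F) (u : I -> R[i]) (l : R[i]) :
  ccvg F u l -> ccvg F (fun i => expC (u i)) (expC l).
Proof.
move=> [ru iu].
have e := cvg_comp _ _ ru (@continuous_expR R _).
have c := cvg_comp _ _ iu (@continuous_cos R _).
have s := cvg_comp _ _ iu (@continuous_sin R _).
by split; exact: cvgM.
Qed.

Lemma ccvgZ (I : Type) (F : set_system I) (FF : Filter F) (r : I -> R) (l : R) u :
  r i @[i --> F] --> l -> ccvg F (fun i => (r i)%:C%C * u) (l%:C%C * u).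
Proof.
by move=> rl; apply: ccvgM; [split=> //; exact: cvg_cst|exact: ccvg_cst].
Qed.

Lemma ccvgX (I : Type) (F : set_system I) (FF : Filter F) (u : I -> R[i]) (l : R[i]) n :
  ccvg F u l -> ccvg F (fun i => u i ^+ n) (l ^+ n).
Proof.
move=> h; elim: n => [|n ih]; first by rewrite expr0; under eq_fun do rewrite expr0; exact: ccvg_cst.
by rewrite exprS; under eq_fun do rewrite exprS; exact: ccvgM.
Qed.

Lemma ReD u v : complex.Re (u + v) = complex.Re u + complex.Re v.
Proof. by case: u; case: v. Qed.

Lemma ImD u v : complex.Im (u + v) = complex.Im u + complex.Im v.
Proof. by case: u; case: v. Qed.

Lemma ccvgD (I : Type) (F : set_system I) (FF : Filter F) (u v : I -> R[i]) (l m : R[i]) :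
  ccvg F u l -> ccvg F v m -> ccvg F (fun i => u i + v i) (l + m).
Proof.
by move=> [ru iu] [rv iv]; split; [rewrite ReD; under eq_fun do rewrite ReD|
  rewrite ImD; under eq_fun do rewrite ImD]; exact: cvgD.
Qed.

Lemma ccvg_sum (I : Type) (F : set_system I) (FF : Filter F) n
    (u : nat -> I -> R[i]) (l : nat -> R[i]) :
  (forall k, ccvg F (u k) (l k)) ->
  ccvg F (fun i => \sum_(k < n) u k i) (\sum_(k < n) l k).
Proof.
move=> h; elim: n => [|n ih].
  by rewrite big_ord0; under eq_fun do rewrite big_ord0; exact: ccvg_cst.
by rewrite big_ord_recr; under eq_fun do rewrite big_ord_recr; exact: ccvgD.
Qed.

(** A continuous n-th root of unity that is 1 at some point is 1 everywhere:
    near a point where it is 1, the factor [1 + rho + ... + rho ^ (n - 1)] of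
    [rho ^ n - 1] does not vanish, so that the points where it is 1 form an open
    set, which is also closed. *)
Lemma continuous_unity_root (rho : R -> R[i]) n :
  (forall t, ccvg (nbhs t) rho (rho t)) -> rho 0 = 1 ->
  (forall t, rho t ^+ n.+1 = 1) -> forall t, rho t = 1.
Proof.
move=> crho rho0 rhon.
pose B := [set t | rho t = 1].
suff : B = setT by move=> BT t; have : B t by rewrite BT.
have /connected_intervalP cT : is_interval [set: R] by [].
apply: cT; first by exists 0.
- exists B; last by rewrite setTI.
  rewrite openE => t0 /= Bt0.
  pose q t := \sum_(k < n.+1) rho t ^+ k.
  have : ccvg (nbhs t0) q (\sum_(k < n.+1) rho t0 ^+ k).
    apply: (@ccvg_sum _ (nbhs t0) _ n.+1 (fun k t => rho t ^+ k) (fun k => rho t0 ^+ k)).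
    by move=> k; exact: ccvgX.
  rewrite /= Bt0; under eq_bigr do rewrite expr1n.
  rewrite sumr_const card_ord => -[rq _].
  have : 0 < complex.Re (n.+1%:R : R[i]).
    have : (0 : R[i]) < n.+1%:R by rewrite ltr0n.
    by rewrite ltcE => /andP[].
  move=> /(cvgr_gt _ rq); apply: filterS => t /= qt.
  have := subrX1 (rho t) n.+1; rewrite rhon subrr.
  move=> /esym/eqP; rewrite mulf_eq0 => /orP[|/eqP q0].
    by rewrite subr_eq0 => /eqP.
  by move: qt; rewrite /q q0 ltxx.
- exists B; last by rewrite setTI.
  have -> : B = (fun t => complex.Re (rho t)) @^-1` [set 1] `&`
      (fun t => complex.Im (rho t)) @^-1` [set 0].
    apply/seteqP; split => t /=; first by rewrite /B/= => ->.
    by move=> [re im]; apply/eqP; rewrite eq_complex/=; apply/andP; split; apply/eqP.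
  apply: closedI; apply: closed_comp => //; do ?exact: closed_eq.
  + by move=> t _; case: (crho t).
  + by move=> t _; case: (crho t).
Qed.

End complex_exponential.

Section chf_continuity.
Context d (T : measurableType d) (R : realType) (P : probability T R).

Lemma chf_scale_continuous (Z : T -> R) (t0 : R) : measurable_fun setT Z ->
  ccvg (nbhs t0) (fun t => chf P (fun w => t * Z w)) (chf P (fun w => t0 * Z w)).
Proof.
move=> mZ; have mtZ (t : R) : measurable_fun setT (fun w => t * Z w).
  exact: measurable_funM.
apply: chf_cvg => //.
apply/(@cvg_nbhsP _ R^o) => u ut0; apply: tau_ae_cvg.
  by move=> n; exact: measurable_funB.
apply: aeW => w; rewrite -[X in _ --> X](subrr (t0 * Z w)); apply: cvgB; last exact: cvg_cst.
exact: cvgMl.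
Qed.

End chf_continuity.

(** * Independently scattered real processes *)

Section weighted_sets.
Context (R : realType).
Implicit Types (l : seq (R * set R)).

(** A list of pairs (r, B) stands for the step function sum of the r 1_B. The
    default value (0, set0) makes the positions beyond its end harmless. *)
Definition weight l i := (nth (0, set0) l i).1.
Definition cell l i := (nth (0, set0) l i).2.

Definition bounded_cells l := forall i, bounded_Borel (cell l i).
Definition disjoint_cells l := trivIset setT (cell l).

Definition step l (s : R) : R := \sum_(p <- l) p.1 * \1_p.2 s.

Definition lincomb (T : Type) (s : set R -> T -> R) l (w : T) : R :=
  \sum_(p <- l) p.1 * s p.2 w.

Lemma bounded_BorelP (B : set R) : bounded_Borel B <->
  measurable B /\ exists N : nat, B `<=` `]- N%:R, N%:R]%classic.
Proof.
split=> [[mB [M [_ hM]]]|[mB [N BN]]]; split => //.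
  exists (Num.truncn (`|M| + 1)).+1 => x Bx.
  have h : `|M| + 1 < (Num.truncn (`|M| + 1)).+1%:R by exact: truncnS_gt.
  have : `|x| <= `|M| + 1 by apply: hM => //; rewrite ltr_pwDr// ler_norm.
  by rewrite /= in_itv/= ler_norml => /andP[? ?]; apply/andP; split; lra.
exists N%:R; split; first exact: num_real.
move=> M NM x /BN /=; rewrite in_itv/= ler_norml => /andP[? ?].
by apply/andP; split; lra.
Qed.

Lemma bounded_Borel0 : bounded_Borel (set0 : set R).
Proof. by apply/bounded_BorelP; split => //; exists 0%N. Qed.

Lemma bounded_BorelS (A B : set R) : measurable A -> A `<=` B -> bounded_Borel B ->
  bounded_Borel A.
Proof.
move=> mA AB /bounded_BorelP[_ [N BN]]; apply/bounded_BorelP; split => //.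
by exists N; exact: subset_trans AB BN.
Qed.

Lemma bounded_BorelU (A B : set R) : bounded_Borel A -> bounded_Borel B ->
  bounded_Borel (A `|` B).
Proof.
move=> /bounded_BorelP[mA [N AN]] /bounded_BorelP[mB [M BM]].
apply/bounded_BorelP; split; first exact: measurableU.
exists (maxn N M) => x [/AN|/BM] /=; rewrite !in_itv/= => /andP[x1 x2].
- have : N%:R <= (maxn N M)%:R :> R by rewrite ler_nat leq_maxl.
  by move=> ?; apply/andP; split; lra.
- have : M%:R <= (maxn N M)%:R :> R by rewrite ler_nat leq_maxr.
  by move=> ?; apply/andP; split; lra.
Qed.

Lemma bounded_BorelI (A B : set R) : measurable A -> bounded_Borel B ->
  bounded_Borel (A `&` B).
Proof.
move=> mA bB; have [mB _] := bB.
by apply: bounded_BorelS bB; [exact: measurableI|exact: subIsetr].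
Qed.

Lemma bounded_BorelD (A B : set R) : measurable A -> bounded_Borel B ->
  bounded_Borel (B `\` A).
Proof.
move=> mA bB; have [mB _] := bB.
by apply: bounded_BorelS bB; [exact: measurableD|exact: subDsetl].
Qed.

Lemma bounded_Borel_itv (x y : R) : bounded_Borel `]x, y]%classic.
Proof.
apply/bounded_BorelP; split; first exact: measurable_itv.
exists (Num.truncn (`|x| + `|y|)).+1 => z /=; rewrite !in_itv/= => /andP[xz zy].
have : `|x| + `|y| < (Num.truncn (`|x| + `|y|)).+1%:R by exact: truncnS_gt.
have := ler_norm y; have := ler_norm (- x); rewrite normrN.
have := normr_ge0 y; have := normr_ge0 x.
by move=> *; apply/andP; split; lra.
Qed.

Lemma bounded_Borel_lebesgue (A : set R) : bounded_Borel A ->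
  (@lebesgue_measure R A < +oo)%E.
Proof.
move=> /bounded_BorelP[mA [N AN]].
apply: (@le_lt_trans _ _ (lebesgue_measure `]- N%:R : R, N%:R]%classic)).
  by apply: le_measure => //; rewrite inE//; exact: measurable_itv.
by rewrite lebesgue_measure_itv/=; case: ifPn => // _; rewrite -EFinB ltry.
Qed.

End weighted_sets.

(** What is used of the process B |-> <z, X(B)> for a random measure X.
    Independence and homogeneity are kept only as identities between
    characteristic functions, which the difference of two independent random
    measures inherits at once; [c] is the cumulant on the line spanned by z. *)
Record cumulant_process d (T : measurableType d) (R : realType) (P : probability T R)
    (s : set R -> T -> R) (c : R -> R[i]) : Prop := CumulantProcess {
  cp_measurable : forall B, bounded_Borel B -> measurable_fun setT (s B);
  cp_sigma_additive : forall B : nat -> set R,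
    (forall n, bounded_Borel (B n)) -> trivIset setT B ->
    bounded_Borel (\bigcup_n B n) ->
    {ae P, forall w,
      (fun n => \sum_(k < n) s (B k) w) @ \oo --> s (\bigcup_n B n) w};
  cp_independent : forall l, bounded_cells l -> disjoint_cells l ->
    chf P (lincomb s l) = \prod_(p <- l) chf P (fun w => p.1 * s p.2 w);
  cp_homogeneous : forall t p h : R,
    chf P (fun w => t * s `]p, p + h]%classic w) =
    chf P (fun w => t * s `]0, h]%classic w);
  cp_law : forall t, chf P (fun w => t * s `]0, 1]%classic w) = expC (c t);
  cp_cumulant0 : c 0 = 0;
  cp_cumulant_continuous : forall t, ccvg (nbhs t) c (c t) }.

Section additivity.
Context d (T : measurableType d) (R : realType) (P : probability T R).
Variable s : set R -> T -> R.
Hypothesis s_sigma : forall B : nat -> set R,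
  (forall n, bounded_Borel (B n)) -> trivIset setT B ->
  bounded_Borel (\bigcup_n B n) ->
  {ae P, forall w, (fun n => \sum_(k < n) s (B k) w) @ \oo --> s (\bigcup_n B n) w}.

Lemma additive_set0 : {ae P, forall w, s set0 w = 0}.
Proof.
have := @s_sigma (fun=> set0) (fun=> @bounded_Borel0 R).
rewrite bigcup0// => h.
have tI : trivIset setT (fun _ : nat => set0 : set R).
  by move=> i j _ _ [x [h1 _]].
apply: filterS (h tI (@bounded_Borel0 R)) => w {}h.
have : series (fun=> s set0 w) @ \oo --> s set0 w.
  by apply: cvg_trans h; apply: near_eq_cvg; apply: nearW => n; rewrite /series/= big_mkord.
move=> /cvgP/cvg_series_cvg_0 c0.
by apply: (cvg_unique _ _ c0) => //; exact: cvg_cst.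
Qed.

Lemma additiveU A B : bounded_Borel A -> bounded_Borel B -> A `&` B = set0 ->
  {ae P, forall w, s (A `|` B) w = s A w + s B w}.
Proof.
move=> bA bB AB.
have := @s_sigma (bigcup2 A B).
rewrite bigcup2E => h.
have /h{h} h : forall n, bounded_Borel (bigcup2 A B n).
  by move=> [|[|n]]//=; exact: bounded_Borel0.
have /h{h} h : trivIset setT (bigcup2 A B) by rewrite -trivIset_bigcup2.
have {}h := h (bounded_BorelU bA bB).
apply: filterS2 additive_set0 h => w s0 h.
suff h2 : \sum_(k < n) s (bigcup2 A B k) w @[n --> \oo] --> s A w + s B w.
  exact: (cvg_unique _ h h2).
rewrite -(cvg_shiftn 2)/=.
rewrite (_ : (fun n => _) = cst (s A w + s B w)); first exact: cvg_cst.
apply/funext => n; rewrite addn2 big_ord_recl big_ord_recl /= addrA big1 ?addr0//.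
Qed.

Lemma additive_ndseq (B : nat -> set R) : (forall n, bounded_Borel (B n)) ->
  nondecreasing_seq B -> bounded_Borel (\bigcup_n B n) ->
  {ae P, forall w, s (B n) w @[n --> \oo] --> s (\bigcup_n B n) w}.
Proof.
move=> bB ndB bU.
have bD n : bounded_Borel (seqD B n).
  apply: bounded_BorelS (bB n); last by case: n => [//|n] x [].
  by case: n => [|n] /=; [case: (bB 0%N)|apply: measurableD; [case: (bB n.+1)|case: (bB n)]].
have := @s_sigma (seqD B) bD (trivIset_seqD ndB).
rewrite eq_bigcup_seqD => /(_ bU) h.
have : forall n, {ae P, forall w, s (B n.+1) w = s (B n) w + s (seqD B n.+1) w}.
  move=> n; rewrite (setU_seqD ndB); apply: additiveU => //.
  by apply/seteqP; split => // x /= [? []].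
move=> /ae_foralln; apply: filterS2 h => w h a.
have e n : s (B n) w = \sum_(k < n.+1) s (seqD B k) w.
  elim: n => [|n ih]; first by rewrite big_ord_recr big_ord0/= add0r.
  by rewrite big_ord_recr/= -ih a.
under eq_fun do rewrite e.
by rewrite -(cvg_shiftS (fun n => \sum_(k < n) s (seqD B k) w)) in h.
Qed.

End additivity.

Section process_characteristic_function.
Context d (T : measurableType d) (R : realType) (P : probability T R).
Variables (s : set R -> T -> R) (c : R -> R[i]).
Hypothesis sc : cumulant_process P s c.
Local Notation leb := (@lebesgue_measure R).
Local Notation phi t B := (chf P (fun w => t * s B w)).

Let ms (t : R) B : bounded_Borel B -> measurable_fun setT (fun w => t * s B w).
Proof. by move=> bB; apply: measurable_funM => //; exact: (cp_measurable sc). Qed.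

Let phi0 t : phi t set0 = 1.
Proof.
rewrite -(chf0 P); apply: chf_ae => //; first exact: ms (@bounded_Borel0 R).
apply: filterS (additive_set0 (cp_sigma_additive sc)) => w ->; exact: mulr0.
Qed.

Let phiU t A B : bounded_Borel A -> bounded_Borel B -> A `&` B = set0 ->
  phi t (A `|` B) = phi t A * phi t B.
Proof.
move=> bA bB AB; pose l := [:: (t, A); (t, B)].
have mA := ms t bA; have mB := ms t bB.
have -> : phi t (A `|` B) = chf P (lincomb s l).
  apply: chf_ae; first exact: ms (bounded_BorelU bA bB).
    rewrite (_ : lincomb s l = fun w => t * s A w + t * s B w).
      exact: measurable_funD.
    by apply/funext => w; rewrite /lincomb !big_cons big_nil addr0.
  apply: filterS (additiveU (cp_sigma_additive sc) bA bB AB) => w ->.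
  by rewrite /lincomb !big_cons big_nil addr0 mulrDr.
rewrite (cp_independent sc) ?big_cons ?big_nil ?mulr1//.
- by move=> [|[|i]]//; rewrite /cell /= nth_nil; exact: bounded_Borel0.
- move=> i j _ _ [x []]; move: i j => [|[|i]] [|[|j]]; rewrite /cell//= ?nth_nil//.
  + by move=> Ax Bx; have : (A `&` B) x by []; rewrite AB.
  + by move=> Bx Ax; have : (A `&` B) x by []; rewrite AB.
Qed.

Let itvU (p x y : R) : 0 <= x -> 0 <= y ->
  `]p, p + (x + y)]%classic = `]p, p + x]%classic `|` `]p + x, p + x + y]%classic.
Proof.
move=> x0 y0; rewrite addrA; apply/seteqP; split => z /=; rewrite !in_itv/=.
  move=> /andP[pz zx]; have [h|h] := leP z (p + x); [left|right]; apply/andP; split; lra.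
by move=> [|] /andP[? ?]; apply/andP; split; lra.
Qed.

Let phi_mul t (p h : R) k : 0 <= h ->
  phi t `]p, p + k%:R * h]%classic = phi t `]0, h]%classic ^+ k.
Proof.
move=> h0; elim: k => [|k ih].
  by rewrite expr0 mul0r addr0 set_itvoc0.
rewrite -natr1 mulrDl mul1r itvU ?mulr_ge0// phiU; [|exact: bounded_Borel_itv|exact: bounded_Borel_itv|].
  by rewrite ih exprSr (cp_homogeneous sc).
by apply/seteqP; split => // z /=; rewrite !in_itv/= => -[/andP[_ ?] /andP[? _]]; lra.
Qed.

(** Both sides are n-th roots of the characteristic function of the unit
    interval that are continuous in [t] and equal to 1 at 0, hence they agree by
    [continuous_unity_root]. *)
Let phi_root t n : phi t `]0, n.+1%:R^-1]%classic = expC ((n.+1%:R^-1)%:C%C * c t).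
Proof.
pose r : R := n.+1%:R^-1; have r0 : 0 <= r by rewrite invr_ge0.
have nr : n.+1%:R * r = 1 by rewrite divff.
pose rho t := phi t `]0, r]%classic * expC (- (r%:C%C * c t)).
suff : rho t = 1.
  move=> /(congr1 (fun x => x * expC (r%:C%C * c t))).
  by rewrite /rho -mulrA -expCD addNr expC0 mulr1 mul1r.
apply: (@continuous_unity_root R rho n) => [{}t||{}t].
- apply: ccvgM.
    by apply: chf_scale_continuous; exact: (cp_measurable sc (bounded_Borel_itv _ _)).
  apply: ccvg_expC; rewrite -mulrN.
  have [rc ic] := cp_cumulant_continuous sc t.
  under eq_fun do rewrite -mulrN; apply: ccvgM; first exact: ccvg_cst.
  have ReN (u : R[i]) : complex.Re (- u) = - complex.Re u by case: u.
  have ImN (u : R[i]) : complex.Im (- u) = - complex.Im u by case: u.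
  by split; [under eq_fun do rewrite ReN; rewrite ReN|under eq_fun do rewrite ImN; rewrite ImN];
    exact: cvgN.
- rewrite /rho (cp_cumulant0 sc) mulr0 oppr0 expC0 mulr1.
  by under eq_fun do rewrite mul0r; exact: chf0.
- rewrite /rho exprMn expCMn -(phi_mul _ 0)// nr add0r (cp_law sc) -expCD.
  have -> : n.+1%:R * - (r%:C%C * c t) = - c t.
    rewrite mulrN mulrA; congr (- _).
    have -> : (n.+1%:R : R[i]) = (n.+1%:R)%:C%C by rewrite rmorph_nat.
    by rewrite -rmorphM nr mul1r.
  by rewrite addrN expC0.
Qed.

Let phi_rat t p (k n : nat) :
  phi t `]p, p + k%:R / n.+1%:R]%classic = expC ((k%:R / n.+1%:R)%:C%C * c t).
Proof.
have -> : (k%:R / n.+1%:R)%:C%C * c t = k%:R * ((n.+1%:R^-1)%:C%C * c t).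
  by rewrite rmorphM rmorph_nat mulrA.
by rewrite -expCMn -phi_root; apply: phi_mul; rewrite invr_ge0.
Qed.

Let lebI (A B : set R) : measurable A -> measurable B -> bounded_Borel A ->
  fine (leb A) = fine (leb (A `&` B)) + fine (leb (A `\` B)).
Proof.
move=> mA mB bA.
have f X : measurable X -> leb (A `&` X) \is a fin_num.
  move=> mX; rewrite ge0_fin_numE//; apply: bounded_Borel_lebesgue.
  by rewrite setIC; exact: bounded_BorelI.
have fD : leb (A `\` B) \is a fin_num by rewrite setDE f//; exact: measurableC.
have -> : leb A = (leb (A `&` B) + leb (A `\` B))%E by rewrite addeC; exact: measureDI.
by apply: fineD => //; exact: f.
Qed.

Let interval (N : nat) : set R := `]- N%:R, N%:R]%classic.

Let good (N : nat) := [set B : set R | measurable B /\ forall t,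
  phi t (interval N `&` B) = expC ((fine (leb (interval N `&` B)))%:C%C * c t)].

Let lebesgue_interval (p h : R) : 0 <= h -> fine (leb `]p, p + h]%classic) = h.
Proof.
move=> h0; rewrite lebesgue_measure_itv/= lte_fin; case: ifPn => [_|].
  by rewrite -EFinB/= addrC addKr.
rewrite -leNgt => ?; rewrite /=; lra.
Qed.

Let good_ray N (q : rat) : good N `]ratr q, +oo[%classic.
Proof.
split=> [|t]; first exact: measurable_itv.
have [qN|Nq] := leP (N%:R : R) (ratr q).
  rewrite (_ : _ `&` _ = set0); last first.
    by apply/seteqP; split => // z []; rewrite /interval/= !in_itv/= andbT => /andP[? ?] ?; lra.
  by rewrite phi0 measure0 mul0r expC0.
have [m [n [qE h0]]] : exists (m n : nat),
    interval N `&` `]ratr q, +oo[%classic = `]N%:R - m%:R / n.+1%:R, N%:R]%classic /\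
    (0 : R) <= m%:R / n.+1%:R.
  have [qN'|Nq'] := leP (ratr q) (- N%:R : R).
    exists (2 * N)%N, 0%N; rewrite divr1; split => //.
    rewrite natrM; apply/seteqP; split => z; rewrite /interval/= !in_itv/= ?andbT.
      by move=> [/andP[? ?] ?]; apply/andP; split; lra.
    by move=> /andP[? ?]; split; [apply/andP; split|]; lra.
  pose x : rat := N%:R - q.
  have x0 : 0 < x by rewrite subr_gt0 -(ltr_rat R) rmorph_nat.
  exists `|numq x|%N, `|denq x|.-1.
  have e : (`|numq x|%N%:R / `|denq x|.-1.+1%:R : R) = N%:R - ratr q.
    rewrite prednK ?absz_gt0 ?denq_neq0// -(rmorph_nat (@ratr R) N) -rmorphB -/x.
    by rewrite -[in RHS](divq_num_den x) rmorph_div ?unitfE ?intr_eq0 ?denq_neq0//=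
      !ratr_int !natr_absz ger0_norm ?numq_ge0 ?(ltW x0)// gtr0_norm ?denq_gt0.
  rewrite e; split; last by rewrite subr_ge0 ltW.
  rewrite opprB addrCA subrr addr0; apply/seteqP; split => z; rewrite /interval/= !in_itv/= ?andbT.
    by move=> [/andP[? ?] ?]; apply/andP; split; lra.
  by move=> /andP[? ?]; split; [apply/andP; split|]; lra.
rewrite qE -[X in `]_, X]%classic](subrK (m%:R / n.+1%:R)) phi_rat.
by rewrite lebesgue_interval.
Qed.

Let good_lambda N : lambda_system setT (good N).
Proof.
have bI : bounded_Borel (interval N) by exact: bounded_Borel_itv.
have bIA A : measurable A -> bounded_Borel (interval N `&` A).
  by move=> mA; rewrite setIC; exact: bounded_BorelI.
split => //.
- split => // t; have := (good_ray N (- N%:R)).2 t.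
  rewrite setIT rmorphN rmorph_nat (_ : _ `&` _ = interval N)//.
  apply/seteqP; split => z; rewrite /interval/= !in_itv/= ?andbT; first by move=> [].
  by move=> /andP[? ?]; split => //; apply/andP.
- move=> A B BA [mA gA] [mB gB]; split; first exact: measurableD.
  move=> t.
  have -> : interval N `&` (A `\` B) = (interval N `&` A) `\` (interval N `&` B).
    apply/seteqP; split => z /=; first by move=> [? [? ?]]; split => // -[].
    by move=> [[? ?] h]; split => //; split => // ?; exact: h.
  have e : (interval N `&` A) `&` (interval N `&` B) = interval N `&` B.
    by apply/seteqP; split => z /= [] => [[? ?] [? ?]//|? ?]; split => //; split => //; exact: BA.
  have := lebI (bIA A mA).1 (bIA B mB).1 (bIA A mA); rewrite e => L.
  have := gA t; rewrite L rmorphD mulrDl expCD -gB.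
  have bD : bounded_Borel ((interval N `&` A) `\` (interval N `&` B)).
    by apply: bounded_BorelD (bIA A mA); exact: (bIA B mB).1.
  have {1}-> : interval N `&` A = (interval N `&` B) `|` ((interval N `&` A) `\` (interval N `&` B)).
    apply/seteqP; split => z; last by case=> [[? ?]|[]//]; split => //; exact: BA.
    by have [?|?] := pselect ((interval N `&` B) z); [left|right].
  rewrite phiU ?setDIK//; last exact: bIA.
  by move/mulfI; apply; rewrite gB expC_neq0.
- move=> F ndF gF; have mF n : measurable (F n) by case: (gF n).
  have mU : measurable (\bigcup_n F n) by exact: bigcupT_measurable.
  split => // t; rewrite setI_bigcupr.
  have bU : bounded_Borel (\bigcup_n (interval N `&` F n)).
    by rewrite -setI_bigcupr; exact: bIA.
  have ndIF : nondecreasing_seq (fun n => interval N `&` F n).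
    move=> m n mn; have /subsetPset FF := ndF _ _ mn; apply/subsetPset => z [? ?].
    by split => //; exact: FF.
  have bIF n : bounded_Borel (interval N `&` F n) by exact: bIA.
  apply: (@ccvg_unique _ _ \oo _ (fun n => phi t (interval N `&` F n))).
    apply: chf_cvg => [n||]; [exact: ms|exact: ms|].
    apply: tau_ae_cvg => [n|]; first by apply: measurable_funB; exact: ms.
    have := additive_ndseq (cp_sigma_additive sc) bIF ndIF bU.
    apply: filterS => w h; rewrite -(subrr (t * s (\bigcup_n (interval N `&` F n)) w)).
    by apply: cvgB; [exact: cvgMr|exact: cvg_cst].
  under eq_fun do rewrite (gF _).2.
  apply: ccvg_expC; apply: ccvgZ.
  apply: fine_cvg; rewrite fineK.
    by apply: nondecreasing_cvg_mu => // [n|]; [exact: (bIF n).1|exact: bU.1].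
  by rewrite ge0_fin_numE//; exact: bounded_Borel_lebesgue.
Qed.

(** Intervals of rational length are unions of translates of those of [phi_root];
    the formula extends to Borel sets by the pi-lambda theorem, with the rays of
    rational origin as pi-system, inside a bounded interval. *)
Lemma process_chf B (t : R) : bounded_Borel B ->
  phi t B = expC ((fine (leb B))%:C%C * c t).
Proof.
move=> /bounded_BorelP[mB [N BN]].
suff : good N B.
  by move=> [_ /(_ t)]; rewrite (_ : _ `&` _ = B)//; apply/seteqP; split => [z []//|z Bz]; split => //; exact: BN.
pose G := [set (`]ratr q, +oo[%classic : set R) | q in [set: rat]].
suff : <<s G >> B.
  apply: (@lambda_system_subset _ G _ setT _ (good_lambda N)) => //.
  - move=> _ _ [q _ <-] [r _ <-]; have [qr|rq] := leP q r.
      exists r => //; rewrite -(ler_rat R) in qr.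
      apply/seteqP; split => z /=; rewrite !in_itv/= !andbT; last by move=> [].
    by move=> ?; split => //; lra.
    exists q => //; rewrite -(ltr_rat R) in rq.
    apply/seteqP; split => z /=; rewrite !in_itv/= !andbT; last by move=> [].
    by move=> ?; split => //; lra.
  - by move=> _ [q _ <-]; exact: good_ray.
have : @measurable _ R B by [].
have -> : @measurable _ R = <<s [set A : set R | exists x : R, A = `]x, +oo[%classic] >>.
  exact: RGenOInfty.measurableE.
apply: smallest_sub; first exact: smallest_sigma_algebra.
move=> _ [x ->].
have [up upP] : exists up : nat -> option rat, forall q, exists n, up n = Some q.
  by exists unpickle => q; exists (pickle q); exact: pickleK.
pose F n := if up n is Some q then
  if x < ratr (q : rat) then `]ratr q, +oo[%classic else set0 else set0 : set R.
have -> : `]x, +oo[%classic = \bigcup_n F n.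
  apply/seteqP; split => z /=; rewrite in_itv/= andbT.
    move=> xz; have [q] := @rat_in_itvoo R x z xz; rewrite in_itv/= => /andP[xq qz].
    have [n nq] := upP q; exists n => //; rewrite /F nq xq /= in_itv/= andbT.
    exact: qz.
  move=> [n _]; rewrite /F; case: (up n) => // q; case: ifPn => // xq /=.
  by rewrite in_itv/= andbT; exact: lt_trans.
apply: sigma_algebra_bigcup => n; rewrite /F.
case: (up n) => [q|]; last exact: sigma_algebra0.
case: ifPn => _; last exact: sigma_algebra0.
by apply: sub_sigma_algebra; exists q.
Qed.

End process_characteristic_function.

(** * The Levy-Khintchine formula for step functions *)

Definition cintegral (R : realType) (B : set R) (f : R -> R[i]) : R[i] :=
  Complex (\int[@lebesgue_measure R]_(x in B) complex.Re (f x))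
          (\int[@lebesgue_measure R]_(x in B) complex.Im (f x)).

Section refinement.
Context (R : realType).
Local Notation leb := (@lebesgue_measure R).
Implicit Types (l : seq (R * set R)) (K : set R).

(** The values of the process are independent on disjoint sets, hence this list of
    disjoint cells, which represents [r0 + step l] on [K]. *)
Fixpoint refine K (r0 : R) l : seq (R * set R) :=
  if l is p :: l' then refine (K `&` p.2) (r0 + p.1) l' ++ refine (K `\` p.2) r0 l'
  else [:: (r0, K)].

Lemma cell_cat l l' i : cell (l ++ l') i =
  if (i < size l)%N then cell l i else cell l' (i - size l)%N.
Proof. by rewrite /cell nth_cat; case: ifP. Qed.

Lemma bounded_cells_cons p l : bounded_cells (p :: l) ->
  bounded_Borel p.2 /\ bounded_cells l.
Proof. by move=> h; split; [exact: (h 0%N)|move=> i; exact: (h i.+1)]. Qed.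

Lemma refine_bounded K r0 l : bounded_Borel K -> bounded_cells l ->
  bounded_cells (refine K r0 l).
Proof.
elim: l K r0 => [|p l ih] K r0 bK.
  by move=> _ [|i]//; rewrite /cell/= nth_nil; exact: bounded_Borel0.
move=> /bounded_cells_cons[[mp _] bl] i /=; rewrite cell_cat; case: ifP => _; apply: ih => //.
  by rewrite setIC; exact: bounded_BorelI.
exact: bounded_BorelD.
Qed.

Lemma refine_sub K r0 l i : cell (refine K r0 l) i `<=` K.
Proof.
elim: l K r0 i => [|p l ih] K r0 i; first by case: i => [|i] x //; rewrite /cell/= nth_nil.
rewrite /= cell_cat; case: ifP => _; apply: subset_trans (ih _ _ _) _.
  exact: subIsetl.
exact: subDsetl.
Qed.

Lemma refine_disjoint K r0 l : disjoint_cells (refine K r0 l).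
Proof.
elim: l K r0 => [|p l ih] K r0.
  by move=> [|i] [|j] _ _ // [x []]; rewrite /cell/= nth_nil.
move=> i j _ _; rewrite /= !cell_cat; case: ifP => il; case: ifP => jl.
- exact: ih.
- by move=> [x [/refine_sub[_ px] /refine_sub[_ npx]]].
- by move=> [x [/refine_sub[_ npx] /refine_sub[_ px]]].
- move=> /(ih _ _ _ _ I I) /(congr1 (addn^~ (size (refine (K `&` p.2) (r0 + p.1) l)))).
  by rewrite !subnK// leqNgt ?il ?jl.
Qed.

Lemma step_cons p l x : step (p :: l) x = p.1 * \1_p.2 x + step l x.
Proof. by rewrite /step big_cons. Qed.

Lemma bounded_step (g : R -> R) K r0 l : measurable K -> bounded_cells l ->
  measurable_fun K (fun x => g (r0 + step l x)) /\
  exists M, forall x, K x -> `|g (r0 + step l x)| <= M.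
Proof.
elim: l K r0 => [|p l ih] K r0 mK bl.
  have e x : g (r0 + step [::] x) = g r0 by rewrite /step big_nil addr0.
  by under eq_fun do rewrite e; split => //; exists `|g r0| => x _; rewrite e.
have [[mp _] bl'] := bounded_cells_cons bl.
have mI : measurable (K `&` p.2) by exact: measurableI.
have mD : measurable (K `\` p.2) by exact: measurableD.
have [m1 [M1 b1]] := ih _ (r0 + p.1) mI bl'.
have [m2 [M2 b2]] := ih _ r0 mD bl'.
have f1 x : (K `&` p.2) x -> g (r0 + p.1 + step l x) = g (r0 + step (p :: l) x).
  by move=> [_ px]; rewrite step_cons indicE mem_set// mulr1 addrA.
have f2 x : (K `\` p.2) x -> g (r0 + step l x) = g (r0 + step (p :: l) x).
  by move=> [_ px]; rewrite step_cons indicE memNset// mulr0 add0r.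
have KE : K = (K `&` p.2) `|` (K `\` p.2) by rewrite setUIDK.
split.
  rewrite KE; apply/measurable_funU => //; split.
  - by apply: eq_measurable_fun m1 => x; rewrite inE => /f1.
  - by apply: eq_measurable_fun m2 => x; rewrite inE => /f2.
exists (Num.max M1 M2) => x; rewrite {1}KE => -[h|h].
- by rewrite -f1// le_max b1.
- by rewrite -f2// le_max b2// orbT.
Qed.

Lemma integrable_step (g : R -> R) K r0 l : bounded_Borel K -> bounded_cells l ->
  leb.-integrable K (EFin \o (fun x => g (r0 + step l x))).
Proof.
move=> bK bl; have [mK _] := bK.
have [mg [M gM]] := bounded_step g r0 mK bl.
apply: measurable_bounded_integrable => //; first exact: bounded_Borel_lebesgue.
exists M; split; first exact: num_real.
by move=> N MN x Kx; exact: le_trans (gM x Kx) (ltW MN).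
Qed.

Lemma step_integral (g : R -> R) K r0 l : bounded_Borel K -> bounded_cells l ->
  \int[leb]_(x in K) g (r0 + step l x) =
    \sum_(p <- refine K r0 l) fine (leb p.2) * g p.1.
Proof.
elim: l K r0 => [|p l ih] K r0 bK bl.
  rewrite /= big_cons big_nil addr0 mulrC; have [mK _] := bK.
  rewrite -(Rintegral_cst leb mK); apply: eq_Rintegral => x _.
  by rewrite /step big_nil addr0.
have [bp bl'] := bounded_cells_cons bl; have [mp _] := bp; have [mK _] := bK.
have bI : bounded_Borel (K `&` p.2) by rewrite setIC; exact: bounded_BorelI.
have bD : bounded_Borel (K `\` p.2) by exact: bounded_BorelD.
have KE : K = (K `&` p.2) `|` (K `\` p.2) by rewrite setUIDK.
rewrite /= big_cat/= -!ih// [in LHS]KE Rintegral_setU -?KE//.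
- congr (_ + _); apply: eq_Rintegral => x; rewrite inE => -[_ px]; rewrite step_cons indicE.
  + by rewrite mem_set// mulr1 addrA.
  + by rewrite memNset// mulr0 add0r.
- by case: bI.
- by case: bD.
- exact: integrable_step.
- by apply/disj_setPS => x [[_ ?] []].
Qed.

End refinement.

Lemma measurable_lincomb d (T : measurableType d) (R : realType) (s : set R -> T -> R)
    (l : seq (R * set R)) :
  (forall B, bounded_Borel B -> measurable_fun setT (s B)) -> bounded_cells l ->
  measurable_fun setT (lincomb s l).
Proof.
move=> ms; elim: l => [|p l ih] bl.
  rewrite (_ : lincomb s [::] = cst 0)//.
  by apply/funext => w; rewrite /lincomb big_nil.
have [bp /ih ml] := bounded_cells_cons bl.
rewrite (_ : lincomb s _ = fun w => p.1 * s p.2 w + lincomb s l w).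
  by apply: measurable_funD => //; apply: measurable_funM => //; exact: ms.
by apply/funext => w; rewrite /lincomb big_cons.
Qed.

Section lincomb_characteristic_function.
Context d (T : measurableType d) (R : realType) (P : probability T R).
Variables (s : set R -> T -> R) (c : R -> R[i]).
Hypothesis sc : cumulant_process P s c.
Local Notation leb := (@lebesgue_measure R).
Implicit Types (l : seq (R * set R)) (K : set R).

Definition restrict_cells K l := [seq (p.1, K `&` p.2) | p <- l].

Lemma bounded_restrict_cells K l : bounded_Borel K -> bounded_cells l ->
  bounded_cells (restrict_cells K l).
Proof.
elim: l => [|p l ih] bK bl.
  by move=> i; rewrite /cell nth_nil; exact: bounded_Borel0.
have [[mp _] bl'] := bounded_cells_cons bl.
move=> [|i]; rewrite /cell/=; last exact: ih.
by rewrite setIC; exact: bounded_BorelI.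
Qed.

Lemma refine_lincomb K r0 l : bounded_Borel K -> bounded_cells l ->
  {ae P, forall w, lincomb s (refine K r0 l) w =
                   r0 * s K w + lincomb s (restrict_cells K l) w}.
Proof.
elim: l K r0 => [|p l ih] K r0 bK bl.
  by apply: aeW => w; rewrite /lincomb/= big_cons !big_nil addr0.
have [bp bl'] := bounded_cells_cons bl; have [mp _] := bp; have [mK _] := bK.
have bI : bounded_Borel (K `&` p.2) by rewrite setIC; exact: bounded_BorelI.
have bD : bounded_Borel (K `\` p.2) by exact: bounded_BorelD.
have split_at : forall B, bounded_Borel B ->
   {ae P, forall w, s (K `&` B) w = s (K `&` p.2 `&` B) w + s ((K `\` p.2) `&` B) w}.
  move=> B [mB _].
  have h1 : bounded_Borel (K `&` p.2 `&` B) by rewrite setIC; exact: bounded_BorelI.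
  have h2 : bounded_Borel ((K `\` p.2) `&` B) by rewrite setIC; exact: bounded_BorelI.
  have -> : K `&` B = (K `&` p.2 `&` B) `|` ((K `\` p.2) `&` B) by rewrite -setIUl setUIDK.
  apply: (additiveU (cp_sigma_additive sc)) => //.
  by apply/seteqP; split => // x [[[_ ?] _] [[]]].
have sl : {ae P, forall w, lincomb s (restrict_cells K l) w =
   lincomb s (restrict_cells (K `&` p.2) l) w + lincomb s (restrict_cells (K `\` p.2) l) w}.
  move: bl'; clear -split_at; elim: l => [|q l ih] bl.
    by apply: aeW => w; rewrite /lincomb/= !big_nil addr0.
  have [bq /ih hl] := bounded_cells_cons bl.
  apply: filterS2 (split_at _ bq) hl => w e1 e2.
  by move: e2; rewrite /lincomb/= !big_cons/= => ->; rewrite e1; ring.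
have sK := split_at K bK; rewrite setIid in sK.
have := ih _ (r0 + p.1) bI bl'; have := ih _ r0 bD bl'.
apply: filterS3 (filterI sl sK) => w [e3 e4] e2 e1.
rewrite /= /lincomb big_cat/= -!/(lincomb _ _ _) e1 e2 /lincomb/= big_cons/= -!/(lincomb _ _ _) e3.
rewrite e4 setIAC setIid; have -> : (K `\` p.2) `&` K = K `\` p.2 by rewrite setIidl//; exact: subDsetl.
ring.
Qed.

Lemma prod_expC (I : Type) (r : seq I) (u : I -> R[i]) :
  \prod_(i <- r) expC (u i) = expC (\sum_(i <- r) u i).
Proof.
elim: r => [|i r ih]; first by rewrite !big_nil expC0.
by rewrite !big_cons ih expCD.
Qed.

(** The Levy-Khintchine formula for step functions: on disjoint cells
    characteristic functions multiply, and [process_chf] gives each factor. *)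
Lemma lincomb_chf K l : bounded_Borel K -> bounded_cells l ->
  chf P (lincomb s (restrict_cells K l)) = expC (cintegral K (fun x => c (step l x))).
Proof.
move=> bK bl; have br := refine_bounded 0 bK bl.
transitivity (chf P (lincomb s (refine K 0 l))).
  apply: chf_ae; [|exact: measurable_lincomb (cp_measurable sc) br|].
    exact: measurable_lincomb (cp_measurable sc) (bounded_restrict_cells bK bl).
  by apply: filterS (refine_lincomb 0 bK bl) => w ->; rewrite mul0r add0r.
rewrite (cp_independent sc) //; last exact: refine_disjoint.
rewrite (big_nth (0, set0)); under eq_bigr => i _.
  rewrite (process_chf sc _ (br i)); over.
rewrite prod_expC -(big_nth (0, set0) xpredT (fun p => (fine (leb p.2))%:C%C * c p.1)).
have E (g : R -> R) : \int[leb]_(x in K) g (step l x) =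
    \sum_(p <- refine K 0 l) fine (leb p.2) * g p.1.
  by rewrite -step_integral//; apply: eq_Rintegral => x _; rewrite add0r.
rewrite /cintegral (E (fun r => complex.Re (c r))) (E (fun r => complex.Im (c r))).
congr expC; elim: (refine K 0 l) => [|p r ih]; first by rewrite !big_nil.
by rewrite !big_cons ih; case: (c p.1) => x y; apply/eqP; rewrite eq_complex/=;
  apply/andP; split; apply/eqP; ring.
Qed.

End lincomb_characteristic_function.

(** * Gliding hump *)

Section gliding_hump.
Context d (T : measurableType d) (R : realType) (mu : {measure set T -> \bar R}).
Variables (K : set T) (f : nat -> T -> R).
Hypothesis mK : measurable K.
Hypothesis finK : (mu K < +oo)%E.
Hypothesis intf : forall n, mu.-integrable K (EFin \o f n).
Hypothesis f0 : forall n x, 0 <= f n x.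
Hypothesis cvgf : {ae mu, forall x, K x -> f n x @[n --> \oo] --> 0}.

Let subset_int n A B : measurable A -> measurable B -> A `<=` B -> B `<=` K ->
  \int[mu]_(x in A) f n x <= \int[mu]_(x in B) f n x.
Proof.
move=> mA mB AB BK.
have iB : mu.-integrable B (EFin \o f n) by exact: integrableS (intf n).
have iA : mu.-integrable A (EFin \o f n) by exact: integrableS iB.
apply: fine_le; [exact: integrable_fin_num iA|exact: integrable_fin_num iB|].
apply: ge0_subset_integral => //; first exact: measurable_int iB.
by move=> x _; rewrite lee_fin.
Qed.

Let abs_cont n : exists r : R, 0 < r /\ forall A, measurable A -> A `<=` K ->
  (mu A < r%:E)%E -> \int[mu]_(x in A) f n x <= 2^-1 ^+ n.
Proof.
have i1 : mu.-integrable setT (EFin \o (f n \_ K)).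
  by have := (integrable_mkcond (EFin \o f n) mK).1 (intf n); rewrite restrict_EFin.
have e0 : (0 : R) < 2^-1 ^+ n by rewrite exprn_gt0.
have [r [r0 h]] := integral_normr_continuous i1 e0.
exists r; split => // A mA AK Ar; apply: le_trans (ltW (h A mA Ar)).
rewrite le_eqVlt; apply/orP; left; apply/eqP; apply: eq_Rintegral => x.
by rewrite inE => /AK Kx; rewrite patchE mem_set// ger0_norm.
Qed.

Let almost_uniform n (e : R) : 0 < e -> exists m A, [/\ (n < m)%N, measurable A,
  A `<=` K, (mu A < e%:E)%E & \int[mu]_(x in K `\` A) f m x <= 2^-1 ^+ n].
Proof.
move=> e0; pose M := fine (mu K) + 1.
have muK0 : 0 <= fine (mu K) by rewrite fine_ge0.
have M0 : 0 < M by rewrite ltr_wpDl.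
have mf k : measurable_fun K (f k) by apply/measurable_EFinP; exact: measurable_int (intf k).
have [B [mB Be uB]] := @ae_pointwise_almost_uniform _ _ _ _ f (fun=> 0 : R) K e mf
  (measurable_cst (0 : R)) mK finK cvgf e0.
pose h : R := 2^-1 ^+ n / M; have h0 : 0 < h by rewrite divr_gt0// exprn_gt0.
have nb : nbhs ((fun=> 0) : {uniform` (K `\` B) -> R})
    [set g : T -> R | forall x, (K `\` B) x -> ball (0 : R) h (g x)].
  apply/uniform_nbhs; exists [set xy | ball xy.1 h xy.2]; split => //.
  exact: entourage_ball (PosNum h0).
have [N _ hN] := uB _ nb; pose m := maxn N n.+1.
have fm x : (K `\` B) x -> f m x <= h.
  move=> /(hN m (leq_maxl _ _)); rewrite /ball/= sub0r normrN => /ltW.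
  exact: le_trans (ler_norm _).
exists m, (K `&` B); split.
- by rewrite leq_maxr.
- exact: measurableI.
- exact: subIsetl.
- apply: le_lt_trans Be; apply: le_measure; rewrite ?inE//; first exact: measurableI.
have -> : K `\` (K `&` B) = K `\` B by rewrite setDIr setDv set0U.
have mKB : measurable (K `\` B) by exact: measurableD.
have finKB : (mu (K `\` B) < +oo)%E.
  by apply: le_lt_trans finK; apply: le_measure; rewrite ?inE.
apply: (@le_trans _ _ (\int[mu]_(x in K `\` B) h)).
  apply: le_Rintegral => //.
  - by apply: integrableS (intf m).
  - apply: measurable_bounded_integrable => //.
    by exists `|h|; split; [exact: num_real|move=> ? /ltW ? ? _].
rewrite Rintegral_cst// /h -mulrA ler_piMr// ?exprn_ge0//.
rewrite mulrC ler_pdivrMr// mul1r /M.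
have : fine (mu (K `\` B)) <= fine (mu K).
  apply: fine_le; rewrite ?ge0_fin_numE//.
  by apply: le_measure; rewrite ?inE.
by move=> ?; lra.
Qed.

(** The integrals of a sequence that tends to 0 almost everywhere need not tend
    to 0, but the mass of a late term is carried by a set too small for the
    earlier terms to notice ([abs_cont], [almost_uniform]); hence two
    subsequences whose masses vanish on complementary sets. *)
Lemma gliding_hump : exists E (u v : nat -> nat),
  [/\ measurable E, E `<=` K, forall k, (k <= u k)%N, forall k, (k <= v k)%N &
   (\int[mu]_(x in E) f (u k) x @[k --> \oo] --> 0 /\
    \int[mu]_(x in K `\` E) f (v k) x @[k --> \oo] --> 0)].
Proof.
have [r /all_and2 [r0 hr]] := choice abs_cont.
pose D := fix D n := if n is m.+1 then Num.min (D m) (r n) else r 0%N.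
have D0 n : 0 < D n by elim: n => [|n ih] //=; rewrite lt_min ih r0.
have Dnd i n : (i <= n)%N -> D n <= D i.
  elim: n => [|n ih]; first by rewrite leqn0 => /eqP->.
  by rewrite leq_eqVlt => /orP[/eqP->//|/ih h] /=; rewrite ge_min h.
have Dr n : D n <= r n by case: n => [|n] //=; rewrite ge_min lexx orbT.
(* With this bound on the measure of [A n], that of the union [U k] below is at
   most [D (n_ k) / 2]. *)
have De n : 0 < D n / 2 / (2 ^ n.+1)%:R by rewrite !divr_gt0// ltr0n expn_gt0.
have := fun n => almost_uniform n (De n).
move=> /choice[m] /choice[A hA].
pose n_ k := iter k m 0%N; pose G k := A (n_ k.-1).
have mn k : (n_ k < n_ k.+1)%N by case: (hA (n_ k)).
have len k : (k <= n_ k)%N.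
  by elim: k => // k ih; exact: leq_ltn_trans ih (mn k).
have ndn i k : (n_ k <= n_ (k + i))%N.
  by elim: i => [|i ih]; [rewrite addn0|rewrite addnS (leq_trans ih)// ltnW].
have mG k : measurable (G k) by case: (hA (n_ k.-1)).
have GK k : G k `<=` K by case: (hA (n_ k.-1)).
pose U k := \bigcup_i G (k + i).+1.
have mU k : measurable (U k) by exact: bigcupT_measurable.
have UK k : U k `<=` K by apply: bigcup_sub => i _; exact: GK.
have intU k : \int[mu]_(x in U k) f (n_ k) x <= 2^-1 ^+ k.
  apply: (@le_trans _ _ (2^-1 ^+ n_ k)); last first.
    by rewrite ler_wiXn2l// ?invr_ge0// invf_le1// ler1n.
  apply: hr => //; apply: (@le_lt_trans _ _ (D (n_ k) / 2)%:E); last first.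
    by rewrite lte_fin (lt_le_trans _ (Dr _))// ltr_pdivrMr// ltr_pMr// ltr1n.
  have h : (mu (U k) <= \sum_(i <oo) mu (G (k + i).+1))%E.
    by apply: (measure_sigma_subadditive _ (fun i => mG (k + i).+1) _ _).
  have tr : (\sum_(i <oo) (D (n_ k) / 2 / (2 ^ i.+1)%:R)%:E <= (D (n_ k) / 2)%:E)%E.
    by apply: (epsilon_trick0 xpredT); rewrite divr_ge0// ltW.
  apply: le_trans h (le_trans _ tr).
  apply: lee_nneseries => // i _.
  have [_ _ _ /ltW h _] := hA (n_ (k + i)); apply: le_trans h _.
  rewrite lee_fin; apply: ler_pM.
  - by rewrite divr_ge0// ltW.
  - by rewrite invr_ge0.
  - by rewrite ler_pM2r// Dnd.
  - rewrite lef_pV2 ?posrE ?ltr0n ?expn_gt0// ler_nat leq_exp2l// ltnS.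
    by rewrite (leq_trans (leq_addl k i)).
have intG k : \int[mu]_(x in K `\` G k.+1) f (n_ k.+1) x <= 2^-1 ^+ k.
  apply: (@le_trans _ _ (2^-1 ^+ n_ k)); first by case: (hA (n_ k)).
  by rewrite ler_wiXn2l// ?invr_ge0// invf_le1// ler1n.
have small k X : measurable X -> X `<=` K -> X `<=` (K `\` G k.+1) `|` U k.+1 ->
    \int[mu]_(x in X) f (n_ k.+1) x <= 2 * 2^-1 ^+ k.
  move=> mX XK XGU; have mXG : measurable (X `&` G k.+1) by exact: measurableI.
  have mXD : measurable (X `\` G k.+1) by exact: measurableD.
  have XE : X = (X `&` G k.+1) `|` (X `\` G k.+1) by rewrite setUIDK.
  rewrite [in leLHS]XE Rintegral_setU -?XE//.
  - rewrite (_ : 2 = 1 + 1)// mulrDl mul1r lerD//.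
    + apply: le_trans (subset_int _ mXG (mU k.+1) _ (@UK _)) _.
        by move=> x [/XGU[[]//|//]].
      rewrite (le_trans (intU _))// exprS ler_piMl// ?exprn_ge0// ?invr_ge0//.
      by rewrite invf_le1// ler1n.
    + apply: le_trans (intG k); apply: subset_int => //.
      * exact: measurableD.
      * by move=> x [/XK].
  - by apply: integrableS (intf _).
  - by apply/disj_setPS => x [[_ ?] []].
have cvg_small (N : nat -> nat) (X : set T) : (forall k, (k <= N k)%N) ->
    measurable X -> X `<=` K -> (forall k, X `<=` (K `\` G (N k).+1) `|` U (N k).+1) ->
    \int[mu]_(x in X) f (n_ (N k).+1) x @[k --> \oo] --> 0.
  move=> kN mX XK XGU.
  have c0 : (geometric (2 : R) 2^-1) @ \oo --> 0.
    by apply: cvg_geometric; rewrite ger0_norm ?invr_ge0// invf_lt1// ltr1n.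
  apply: (squeeze_cvgr _ (cvg_cst 0) c0); apply: nearW => k.
  rewrite Rintegral_ge0//= (le_trans (small _ _ mX XK (XGU k)))//.
  by rewrite ler_pM2l// ler_wiXn2l// ?invr_ge0// invf_le1// ler1n.
have GU a b : (a < b)%N -> G b `<=` U a.
  by move=> ab x Gx; exists (b - a.+1)%N => //; rewrite -addSn subnKC.
(* [f (n_ k)] is small outside [G k], and on the union [U k] of the later sets:
   terms of even index are small on the sets of odd index, and conversely. *)
pose E := \bigcup_k (G k.*2.+1 `\` U k.*2.+1).
have mE : measurable E by apply: bigcupT_measurable => k; exact: measurableD.
have EK : E `<=` K by apply: bigcup_sub => k _ x [/GK].
have dbl k : (k <= k.*2)%N by rewrite -addnn leq_addr.
exists E, (fun k => n_ k.*2.+2), (fun k => n_ k.*2.+1); split => //.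
- by move=> k; apply: leq_trans (len _); exact/leqW/leqW/dbl.
- by move=> k; apply: leq_trans (len _); exact/leqW/dbl.
split.
- apply: (cvg_small (fun k => k.*2.+1)) => // [k|k x Ex].
    exact/leqW/dbl.
  have [Gx|nGx] := pselect (G k.*2.+2 x); last by left; split => //; exact: EK.
  right; have [j _ [Gj nUj]] := Ex.
  have [jk|kj] := leqP j.*2.+1 k.*2.+1; first by exfalso; apply: nUj; exact: (GU _ k.*2.+2).
  apply: (GU _ j.*2.+1) => //.
  move: kj; rewrite !ltnS leq_eqVlt => /orP[/eqP kj|//].
  by have := congr1 odd kj; rewrite /= !odd_double.
- have mKE : measurable (K `\` E) by exact: measurableD.
  apply: (cvg_small (fun k => k.*2) _ dbl mKE (@subDsetl _ _ _)) => k x [Kx nEx].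
  have [Gx|nGx] := pselect (G k.*2.+1 x); last by left.
  by right; apply: contrapT => nU; apply: nEx; exists k.
Qed.

End gliding_hump.

(** * The Levy-Khintchine formula for limits *)

Section integrable_difference.
Context d (T : measurableType d) (R : realType) (mu : {measure set T -> \bar R}).

Lemma integrable_fun_sub (D : set T) (f g : T -> R) : measurable D ->
  mu.-integrable D (EFin \o f) -> mu.-integrable D (EFin \o g) ->
  mu.-integrable D (EFin \o (fun x => f x - g x)).
Proof.
move=> mD fi gi.
have -> : EFin \o (fun x => f x - g x) = (fun x => (EFin \o f) x - (EFin \o g) x)%E.
  by apply/funext => x.
exact: integrableB.
Qed.

Lemma integrable_fun_dist (D : set T) (f g : T -> R) : measurable D ->
  mu.-integrable D (EFin \o f) -> mu.-integrable D (EFin \o g) ->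
  mu.-integrable D (EFin \o (fun x => `|f x - g x|)).
Proof.
by move=> mD fi gi; exact: integrable_norm (integrable_fun_sub mD fi gi).
Qed.

Lemma integrable_fun_add (D : set T) (f g : T -> R) : measurable D ->
  mu.-integrable D (EFin \o f) -> mu.-integrable D (EFin \o g) ->
  mu.-integrable D (EFin \o (fun x => f x + g x)).
Proof.
move=> mD fi gi.
have -> : EFin \o (fun x => f x + g x) = ((EFin \o f) \+ (EFin \o g))%E.
  by apply/funext => x.
exact: integrableD.
Qed.

(** Filter rules at an abstract measure, where the filter instance is immediate. *)
Lemma ae_mono (Q Q' : T -> Prop) : (forall x, Q x -> Q' x) ->
  {ae mu, forall x, Q x} -> {ae mu, forall x, Q' x}.
Proof. by move=> QQ; apply: filterS. Qed.

Lemma Rintegral_cvg (g : nat -> T -> R) (h : T -> R) (e : nat -> T -> R) (A : set T) :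
  measurable A ->
  (forall n, mu.-integrable A (EFin \o g n)) -> mu.-integrable A (EFin \o h) ->
  (forall n, mu.-integrable A (EFin \o e n)) ->
  (forall n x, A x -> `|g n x - h x| <= e n x) ->
  \int[mu]_(x in A) e n x @[n --> \oo] --> 0 ->
  \int[mu]_(x in A) g n x @[n --> \oo] --> \int[mu]_(x in A) h x.
Proof.
move=> mA ig ih ie ge e0; apply/cvgrPdist_le => r r0.
move/cvgrPdist_le : e0 => /(_ _ r0); apply: filterS => n; rewrite sub0r normrN => er.
have igh := integrable_fun_sub mA (ig n) ih.
rewrite distrC -RintegralB//.
apply: (le_trans (le_normr_Rintegral mA igh)).
apply: le_trans (le_trans (ler_norm _) er).
by apply: le_Rintegral => //; [exact: integrable_fun_dist|exact: ge].
Qed.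

End integrable_difference.

Lemma ae_mono2 dT (T : measurableType dT) (R : realType) (mu : {measure set T -> \bar R})
    (Q Q' Q'' : T -> Prop) : (forall x, Q x -> Q' x -> Q'' x) ->
  {ae mu, forall x, Q x} -> {ae mu, forall x, Q' x} -> {ae mu, forall x, Q'' x}.
Proof. exact: filterS2. Qed.

Section limit_characteristic_function.
Context d (T : measurableType d) (R : realType) (P : probability T R).
Variables (s : set R -> T -> R) (c : R -> R[i]).
Hypothesis sc : cumulant_process P s c.
Local Notation leb := (@lebesgue_measure R).

(** The Levy-Khintchine formula for a limit of integrals of step functions. The
    cumulants [c (step (l n) x)] converge almost everywhere to [c (f x)], possibly
    not in mean. But on each of the two complementary sets given by
    [gliding_hump] a subsequence of them does; the formula follows on these two
    sets, since the integrals over both converge, and then on their union by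
    additivity of the exponents. *)
Lemma limit_chf (l : nat -> seq (R * set R)) (f : R -> R) (K : set R)
    (J : set R -> T -> R) :
  (forall n, bounded_cells (l n)) -> bounded_Borel K ->
  measurable_fun K f ->
  {ae leb, forall x, K x -> step (l n) x @[n --> \oo] --> f x} ->
  leb.-integrable K (EFin \o (fun x => complex.Re (c (f x)))) ->
  leb.-integrable K (EFin \o (fun x => complex.Im (c (f x)))) ->
  (forall B, measurable B -> B `<=` K -> measurable_fun setT (J B) /\
    tau P (fun w => lincomb s (restrict_cells B (l n)) w - J B w) @[n --> \oo] --> 0) ->
  chf P (J K) = expC (cintegral K (fun x => c (f x))).
Proof.
move=> bl bK mf lf iRe iIm hJ; have [mK _] := bK.
have iR n A : measurable A -> A `<=` K ->
    leb.-integrable A (EFin \o (fun x => complex.Re (c (step (l n) x)))).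
  move=> mA AK; have := integrable_step (fun r => complex.Re (c r)) 0 (bounded_BorelS mA AK bK) (bl n).
  by congr (_.-integrable _ _); apply/funext => x /=; rewrite add0r.
have iI n A : measurable A -> A `<=` K ->
    leb.-integrable A (EFin \o (fun x => complex.Im (c (step (l n) x)))).
  move=> mA AK; have := integrable_step (fun r => complex.Im (c r)) 0 (bounded_BorelS mA AK bK) (bl n).
  by congr (_.-integrable _ _); apply/funext => x /=; rewrite add0r.
pose e n x := `|complex.Re (c (step (l n) x)) - complex.Re (c (f x))| +
              `|complex.Im (c (step (l n) x)) - complex.Im (c (f x))|.
have ie n : leb.-integrable K (EFin \o e n).
  apply: integrable_fun_add => //.
  - by apply: integrable_fun_dist => //; exact: iR.
  - by apply: integrable_fun_dist => //; exact: iI.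
have e0 n x : 0 <= e n x by rewrite addr_ge0.
have ec : {ae leb, forall x, K x -> e n x @[n --> \oo] --> 0}.
  have pt (x : R) : step (l n) x @[n --> \oo] --> f x -> e n x @[n --> \oo] --> 0.
    move=> h; have [hR hI] := cp_cumulant_continuous sc (f x).
    have cR := cvg_comp _ _ h hR; have cI := cvg_comp _ _ h hI.
    have dist0 (v : nat -> R) (y : R) : v @ \oo --> y -> `|v n - y| @[n --> \oo] --> 0.
      move=> vy; rewrite -(normr0 R) -(subrr y); apply: cvg_norm.
      by apply: cvgB => //; exact: cvg_cst.
    by rewrite -(addr0 0); apply: cvgD; apply: dist0.
  by move: lf; apply: ae_mono => x h Kx; exact: pt (h Kx).
have [E [u [v [mE EK ku kv [cu cv]]]]] :=
  @gliding_hump _ _ R leb K e mK (bounded_Borel_lebesgue bK) ie e0 ec.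
have to_oo (w : nat -> nat) : (forall k, (k <= w k)%N) -> w @ \oo --> \oo.
  move=> kw A [N _ NA]; exists N => // k /= Nk; apply: NA => /=; exact: leq_trans Nk (kw k).
have chfJ B : measurable B -> B `<=` K ->
    ccvg \oo (fun n => expC (cintegral B (fun x => c (step (l n) x)))) (chf P (J B)).
  move=> mB BK; have [mJ cJ] := hJ B mB BK.
  have bB := bounded_BorelS mB BK bK.
  under eq_fun do rewrite -(lincomb_chf sc bB (bl _)).
  apply: chf_cvg => // n; apply: (measurable_lincomb (cp_measurable sc)); exact: bounded_restrict_cells.
have ccvg_sub (w : nat -> nat) (z : nat -> R[i]) y : w @ \oo --> \oo -> ccvg \oo z y ->
    ccvg \oo (z \o w) y.
  by move=> cw [z1 z2]; split; [exact: cvg_comp cw z1|exact: cvg_comp cw z2].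
have part B w : measurable B -> B `<=` K -> w @ \oo --> \oo ->
    \int[leb]_(x in B) e (w k) x @[k --> \oo] --> 0 ->
    chf P (J B) = expC (cintegral B (fun x => c (f x))).
  move=> mB BK cw we.
  apply: (ccvg_unique _ (ccvg_sub _ _ _ cw (chfJ B mB BK))).
  apply: ccvg_expC; split; apply: Rintegral_cvg => //.
  - by move=> n; exact: iR.
  - exact: integrableS iRe.
  - by move=> k; exact: integrableS (ie (w k)).
  - by move=> k x _; rewrite /e lerDl.
  - exact: we.
  - by move=> n; exact: iI.
  - exact: integrableS iIm.
  - by move=> k; exact: integrableS (ie (w k)).
  - by move=> k x _; rewrite /e lerDr.
  - exact: we.
have KE : K = E `|` (K `\` E) by rewrite setDUK.
have mKE : measurable (K `\` E) by exact: measurableD.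
have KEK : K `\` E `<=` K by exact: subDsetl.
have dE : [disjoint E & K `\` E] by apply/disj_setPS => x [? []].
have cintU (g : R -> R[i]) : leb.-integrable K (EFin \o (fun x => complex.Re (g x))) ->
    leb.-integrable K (EFin \o (fun x => complex.Im (g x))) ->
    cintegral K g = cintegral E g + cintegral (K `\` E) g.
  have U (h : R -> R) : leb.-integrable K (EFin \o h) ->
      \int[leb]_(x in K) h x = \int[leb]_(x in E) h x + \int[leb]_(x in K `\` E) h x.
    by move=> ih; rewrite [in LHS]KE Rintegral_setU -?KE.
  by move=> i1 i2; rewrite /cintegral (U _ i1) (U _ i2).
rewrite cintU// expCD -(part E _ mE EK (to_oo _ ku) cu) -(part _ _ mKE KEK (to_oo _ kv) cv).
apply: (ccvg_unique _ (chfJ K mK (@subset_refl _ _))).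
under eq_fun => n.
  rewrite cintU ?expCD; [|exact: iR|exact: iI]; over.
by apply: ccvgM; exact: chfJ.
Qed.

End limit_characteristic_function.

(** * Random measures and their differences *)

Section scalar_product.
Context (R : realType) (d : nat).
Implicit Types (z x y : 'rV[R]_d).

Lemma dotVD z x y : dotV z (x + y) = dotV z x + dotV z y.
Proof. by rewrite /dotV -big_split; apply: eq_bigr => i _; rewrite mxE mulrDr. Qed.

Lemma dotVB z x y : dotV z (x - y) = dotV z x - dotV z y.
Proof. by rewrite dotVD; congr (_ + _); rewrite /dotV -sumrN; apply: eq_bigr => i _; rewrite mxE mulrN. Qed.

Lemma dotVZ z (r : R) x : dotV z (r *: x) = r * dotV z x.
Proof. by rewrite /dotV mulr_sumr; apply: eq_bigr => i _; rewrite mxE mulrCA. Qed.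

Lemma dotVZl z (r : R) x : dotV (r *: z) x = r * dotV z x.
Proof. by rewrite /dotV mulr_sumr; apply: eq_bigr => i _; rewrite mxE mulrA. Qed.

Lemma dotV0 z : dotV z 0 = 0.
Proof. by rewrite /dotV big1// => i _; rewrite mxE mulr0. Qed.

Lemma dotV_sum z (I : Type) (r : seq I) (x : I -> 'rV[R]_d) :
  dotV z (\sum_(i <- r) x i) = \sum_(i <- r) dotV z (x i).
Proof. exact: (big_morph (dotV z) (dotVD z) (dotV0 z)). Qed.

Lemma dotV_delta (i : 'I_d) x : dotV (delta_mx ord0 i) x = x ord0 i.
Proof.
rewrite /dotV (bigD1 i)//= mxE !eqxx mul1r big1 ?addr0// => j ji.
by rewrite mxE eqxx (negbTE ji) mul0r.
Qed.

Lemma cvg_dotV z (I : Type) (F : set_system I) (FF : Filter F) (x : I -> 'rV[R]_d) l :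
  x @ F --> l -> dotV z (x i) @[i --> F] --> dotV z l.
Proof.
move=> xl; rewrite /dotV; elim: (index_enum _) => [|j r ih].
  by rewrite big_nil; under eq_fun do rewrite big_nil; exact: cvg_cst.
rewrite big_cons; under eq_fun do rewrite big_cons.
apply: cvgD => //; apply: cvgMr.
exact: cvg_comp xl (@coord_continuous R 1 d ord0 j l).
Qed.

Lemma measurable_dotV dT (T : measurableType dT) z (Y : T -> 'rV[R]_d) :
  measurable_fun setT Y -> measurable_fun setT (fun w => dotV z (Y w)).
Proof.
move=> mY; apply: measurable_sum => i; apply: measurable_funM => //.
by move/measurable_fun_rVP : mY.
Qed.

Lemma measurable_rVD dT (T : measurableType dT) (Y Z : T -> 'rV[R]_d) :
  measurable_fun setT Y -> measurable_fun setT Z ->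
  measurable_fun setT (fun w => Y w + Z w).
Proof.
move=> /measurable_fun_rVP mY /measurable_fun_rVP mZ; apply/measurable_fun_rVP => i.
by under eq_fun do rewrite mxE; exact: measurable_funD.
Qed.

Lemma measurable_rVB dT (T : measurableType dT) (Y Z : T -> 'rV[R]_d) :
  measurable_fun setT Y -> measurable_fun setT Z ->
  measurable_fun setT (fun w => Y w - Z w).
Proof.
move=> /measurable_fun_rVP mY /measurable_fun_rVP mZ; apply/measurable_fun_rVP => i.
by under eq_fun do rewrite !mxE; exact: measurable_funB.
Qed.

End scalar_product.

Section law.
Context dT (T : measurableType dT) dT' (T' : measurableType dT') (R : realType) (d : nat).
Variables (P : probability T R) (P' : probability T' R).

Lemma law_chf (Y : T -> 'rV[R]_d) (Y' : T' -> 'rV[R]_d) z :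
  measurable_fun setT Y -> measurable_fun setT Y' ->
  (forall A, measurable A -> P (Y @^-1` A) = P' (Y' @^-1` A)) ->
  chf P (fun w => dotV z (Y w)) = chf P' (fun w => dotV z (Y' w)).
Proof.
move=> mY mY' YY'.
pose Yp : {mfun T >-> 'rV[R]_d} := mfun_Sub (mem_set mY).
pose Yp' : {mfun T' >-> 'rV[R]_d} := mfun_Sub (mem_set mY').
have md : measurable_fun setT (fun x : 'rV[R]_d => dotV z x).
  by apply: measurable_dotV; exact: measurable_id.
have E (g : R -> R) : measurable_fun setT g -> (forall x, `|g x| <= 1) ->
    \int[P]_w g (dotV z (Y w)) = \int[P']_w g (dotV z (Y' w)).
  move=> mg g1; congr fine.
  have mgd : measurable_fun setT (fun x : 'rV[R]_d => (g (dotV z x))%:E).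
    by apply/measurable_EFinP; exact: measurableT_comp mg md.
  rewrite -(@integral_distribution _ _ _ _ _ P Yp (fun x => (g (dotV z x))%:E))//; last first.
    apply: (@integrable_bounded _ _ _ P 1 (fun w => g (dotV z (Y w)))) => //.
    exact: measurableT_comp mg (measurable_dotV z mY).
  rewrite -(@integral_distribution _ _ _ _ _ P' Yp' (fun x => (g (dotV z x))%:E))//; last first.
    apply: (@integrable_bounded _ _ _ P' 1 (fun w => g (dotV z (Y' w)))) => //.
    exact: measurableT_comp mg (measurable_dotV z mY').
  by apply: eq_measure_integral => A mA _; exact: YY'.
by congr Complex; apply: E; do ?[exact: cos_max|exact: sin_max|
  exact: (continuous_measurable_fun (@continuous_cos R))|
  exact: (continuous_measurable_fun (@continuous_sin R))].
Qed.

End law.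

Lemma charfun_chf (R : realType) (d : nat) (mu : probability 'rV[R]_d R) z :
  characteristic_function mu z = chf mu (dotV z).
Proof. by []. Qed.

(** What random measures and the differences of two independent ones have in
    common; independence is kept as an identity between characteristic functions,
    which passes to differences. *)
Record scattered dT (T : measurableType dT) (R : realType) (d : nat) (P : probability T R)
    (S : set R -> T -> 'rV[R]_d) : Prop := Scattered {
  sp_measurable : forall B, bounded_Borel B -> measurable_fun setT (S B);
  sp_sigma_additive : forall B : nat -> set R,
    (forall n, bounded_Borel (B n)) -> trivIset setT B ->
    bounded_Borel (\bigcup_n B n) ->
    {ae P, forall w,
      (fun n => \sum_(k < n) S (B k) w) @ \oo --> S (\bigcup_n B n) w};
  sp_independent : forall z l, bounded_cells l -> disjoint_cells l ->
    chf P (lincomb (fun B w => dotV z (S B w)) l) =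
    \prod_(p <- l) chf P (fun w => p.1 * dotV z (S p.2 w));
  sp_homogeneous : forall z (p h : R),
    chf P (fun w => dotV z (S `]p, p + h]%classic w)) =
    chf P (fun w => dotV z (S `]0, h]%classic w)) }.

Section scattered.
Context dT (T : measurableType dT) (R : realType) (d : nat) (P : probability T R).
Implicit Types (S : set R -> T -> 'rV[R]_d).

Lemma scattered_dotV_sigma_additive S z : scattered P S -> forall B : nat -> set R,
    (forall n, bounded_Borel (B n)) -> trivIset setT B ->
    bounded_Borel (\bigcup_n B n) ->
    {ae P, forall w, (fun n => \sum_(k < n) dotV z (S (B k) w)) @ \oo -->
      dotV z (S (\bigcup_n B n) w)}.
Proof.
move=> hS B bB tB bU; apply: filterS (sp_sigma_additive hS bB tB bU) => w h.
by under eq_fun do rewrite -dotV_sum; exact: cvg_dotV h.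
Qed.

Lemma scattered_dotVU S z A B : scattered P S -> bounded_Borel A -> bounded_Borel B ->
  A `&` B = set0 ->
  {ae P, forall w, dotV z (S (A `|` B) w) = dotV z (S A w) + dotV z (S B w)}.
Proof.
move=> hS; exact: (@additiveU _ _ _ _ (fun B w => dotV z (S B w))
  (scattered_dotV_sigma_additive z hS)).
Qed.

Lemma scattered_cumulant_process S z c : scattered P S ->
  (forall t, chf P (fun w => t * dotV z (S `]0, 1]%classic w)) = expC (c t)) ->
  c 0 = 0 -> (forall t, ccvg (nbhs t) c (c t)) ->
  cumulant_process P (fun B w => dotV z (S B w)) c.
Proof.
move=> hS hc c0 cc; split => //.
- by move=> B bB; apply: measurable_dotV; exact: (sp_measurable hS).
- exact: scattered_dotV_sigma_additive.
- exact: (sp_independent hS).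
- move=> t p h.
  by under eq_fun do rewrite -dotVZl; rewrite (sp_homogeneous hS);
    under eq_fun do rewrite dotVZl.
Qed.

End scattered.

Section random_measures.
Context dT (T : measurableType dT) (R : realType) (d : nat) (P : probability T R).
Variable mu : probability 'rV[R]_d R.
Implicit Types (X Y : set R -> T -> 'rV[R]_d).

Lemma shift_itv (p h : R) : `]p, p + h]%classic = [set s + p | s in `]0, h]%classic].
Proof.
apply/seteqP; split => x /=; rewrite !in_itv/=.
  move=> /andP[? ?]; exists (x - p); last by rewrite subrK.
  by rewrite /= in_itv/=; apply/andP; split; lra.
by move=> [y]; rewrite /= in_itv/= => /andP[? ?] <-; apply/andP; split; lra.
Qed.

Lemma measurable_lincomb_cylinders X z l :
  measurable_fun (setT : set (g_sigma_algebraType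
     (cylinders (fun i : 'I_(size l) => X (cell l i)))))
    (lincomb (fun B w => dotV z (X B w)) l).
Proof.
rewrite (_ : lincomb _ l =
    fun w => \sum_(i < size l) weight l i * dotV z (X (cell l i) w)).
  apply: measurable_sum => i; apply: measurable_funM => //.
  apply: measurable_dotV.
  exact: (@measurable_cylinder _ _ _ _ _ (fun i : 'I_(size l) => X (cell l i)) i).
by apply/funext => w; rewrite /lincomb (big_nth (0, set0)) big_mkord.
Qed.

Lemma random_measure_scattered X : random_measure P mu X -> scattered P X.
Proof.
move=> rX; split.
- exact: (rm_measurable rX).
- exact: (rm_sigma_additive rX).
- move=> z; elim=> [|p l ih] bl dl.
    rewrite big_nil -(chf0 P); congr chf.
    by apply/funext => w; rewrite /lincomb big_nil.
  have [bp bl'] := bounded_cells_cons bl.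
  have dl' : disjoint_cells l.
    by move=> i j _ _ h; have := dl i.+1 j.+1 I I h; case.
  have mXp := rm_measurable rX bp.
  have mU : measurable_fun setT (fun w => p.1 * dotV z (X p.2 w)).
    by apply: measurable_funM => //; exact: measurable_dotV.
  have mW : measurable_fun setT (lincomb (fun B w => dotV z (X B w)) l).
    by apply: measurable_lincomb => // B bB; apply: measurable_dotV; exact: (rm_measurable rX).
  rewrite big_cons -ih//.
  rewrite (_ : lincomb _ (p :: l) = fun w => p.1 * dotV z (X p.2 w) +
      lincomb (fun B w => dotV z (X B w)) l w); last first.
    by apply/funext => w; rewrite /lincomb big_cons.
  apply: chf_indep => // A B mA mB.
  pose A' : set 'rV[R]_d := [set x | A (p.1 * dotV z x)].
  have mA' : measurable A'.
    have md : measurable_fun setT (fun x : 'rV[R]_d => p.1 * dotV z x).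
      by apply: measurable_funM => //; apply: measurable_dotV; exact: measurable_id.
    by rewrite -[A']setTI; exact: md.
  have mE : measurable (X p.2 @^-1` A') by rewrite -[X in measurable X]setTI; exact: mXp.
  have mXl (i : 'I_(size l)) : measurable_fun setT (X (cell l i)).
    exact: (rm_measurable rX).
  have -> : (fun w => p.1 * dotV z (X p.2 w)) @^-1` A = X p.2 @^-1` A' by [].
  apply: (@indep_cylinders _ _ _ P _ _ _ _ (X p.2 @^-1` A') _ B mE mXl _
    (@measurable_lincomb_cylinders X z l) mB).
  move=> C mC.
  have := @rm_independent _ _ _ _ _ _ _ rX (size l) (fun i => cell l i) C (fun i => bl' i).
  have tl : trivIset setT (fun i : 'I_(size l) => cell l i).
    by move=> i j _ _ /(dl' i j I I) /val_inj.
  move=> /(_ tl mC) hl.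
  have := @rm_independent _ _ _ _ _ _ _ rX (size l).+1 (fun i => cell (p :: l) i)
    (fun i => if unlift ord0 i is Some j then C j else A') (fun i => bl i).
  have tpl : trivIset setT (fun i : 'I_(size l).+1 => cell (p :: l) i).
    by move=> i j _ _ /(dl i j I I) /val_inj.
  have mC' (i : 'I_(size l).+1) : measurable (if unlift ord0 i is Some j then C j else A').
    by case: unlift => [j|].
  move=> /(_ tpl mC'); rewrite big_ord_recl unlift_none.
  under eq_bigr do rewrite liftK.
  rewrite hl => <-; congr (P _); apply/seteqP; split => w /=.
    by move=> [Aw h] i; case: unliftP => [j ->|->] //; exact: h.
  by move=> h; split; [have := h ord0; rewrite unlift_none|
    move=> i; have := h (lift ord0 i); rewrite liftK].
- move=> z p h; rewrite shift_itv.
  apply: law_chf.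
  + rewrite -shift_itv; exact: (rm_measurable rX (bounded_Borel_itv _ _)).
  + exact: (rm_measurable rX (bounded_Borel_itv _ _)).
  + by move=> A mA; apply: (rm_homogeneous rX) => //; exact: bounded_Borel_itv.
Qed.


(** Independence passes from cylinders to functions of finitely many values. *)
Lemma lincomb_indep X Y z l l' (A B : set R) :
  random_measure P mu X -> random_measure P mu Y -> independent_measures P X Y ->
  bounded_cells l -> bounded_cells l' -> measurable A -> measurable B ->
  P (lincomb (fun B w => dotV z (X B w)) l @^-1` A `&`
     lincomb (fun B w => dotV z (Y B w)) l' @^-1` B) =
  (P (lincomb (fun B w => dotV z (X B w)) l @^-1` A) *
   P (lincomb (fun B w => dotV z (Y B w)) l' @^-1` B))%E.
Proof.
move=> rX rY XY bl bl' mA mB.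
have mXl (i : 'I_(size l)) : measurable_fun setT (X (cell l i)).
  exact: (rm_measurable rX).
have mYl (i : 'I_(size l')) : measurable_fun setT (Y (cell l' i)).
  exact: (rm_measurable rY).
have mW : measurable (lincomb (fun B w => dotV z (X B w)) l @^-1` A).
  have mlX : measurable_fun setT (lincomb (fun B w => dotV z (X B w)) l).
    by apply: measurable_lincomb => // C bC; apply: measurable_dotV; exact: (rm_measurable rX).
  by rewrite -[X in measurable X]setTI; exact: mlX.
apply: (@indep_cylinders _ _ _ P _ _ _ _ _ _ B mW mYl _
    (@measurable_lincomb_cylinders Y z l') mB) => D mD.
rewrite setIC muleC.
have mE : measurable [set w | forall i : 'I_(size l'), D i (Y (cell l' i) w)].
  by apply: (cylinders_measurable mYl); exists D.
apply: (@indep_cylinders _ _ _ P _ _ _ _ _ _ A mE mXl _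
    (@measurable_lincomb_cylinders X z l) mA) => C mC.
by rewrite setIC muleC; apply: XY.
Qed.

Lemma chfN (Z : T -> R) : measurable_fun setT Z ->
  chf P (fun w => - Z w) = (chf P Z)^*%C.
Proof.
move=> mZ; rewrite /chf; apply/eqP; rewrite eq_complex/=; apply/andP; split; apply/eqP.
  by apply: eq_Rintegral => w _; rewrite cosN.
rewrite -mulN1r -RintegralZl//; last exact: integrable_sin.
by apply: eq_Rintegral => w _; rewrite sinN mulN1r.
Qed.

Lemma lincomb_sub_chf X Y z l :
  random_measure P mu X -> random_measure P mu Y -> independent_measures P X Y ->
  bounded_cells l ->
  chf P (lincomb (fun B w => dotV z (X B w - Y B w)) l) =
  chf P (lincomb (fun B w => dotV z (X B w)) l) *
  (chf P (lincomb (fun B w => dotV z (Y B w)) l))^*%C.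
Proof.
move=> rX rY XY bl.
have mX : measurable_fun setT (lincomb (fun B w => dotV z (X B w)) l).
  by apply: measurable_lincomb => // C bC; apply: measurable_dotV; exact: (rm_measurable rX).
have mY : measurable_fun setT (lincomb (fun B w => dotV z (Y B w)) l).
  by apply: measurable_lincomb => // C bC; apply: measurable_dotV; exact: (rm_measurable rY).
have -> : lincomb (fun B w => dotV z (X B w - Y B w)) l =
    fun w => lincomb (fun B w => dotV z (X B w)) l w +
             - lincomb (fun B w => dotV z (Y B w)) l w.
  apply/funext => w; rewrite /lincomb -sumrB; apply: eq_bigr => p _.
  by rewrite dotVB mulrBr.
have mNY : measurable_fun setT (fun w => - lincomb (fun B w => dotV z (Y B w)) l w).
  exact: measurableT_comp.
rewrite -chfN//; apply: chf_indep => // A B mA mB.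
have -> : (fun w => - lincomb (fun B w => dotV z (Y B w)) l w) @^-1` B =
    lincomb (fun B w => dotV z (Y B w)) l @^-1` (-%R @^-1` B) by [].
apply: lincomb_indep => //; rewrite -[X in measurable X]setTI.
exact: (oppr_measurable measurableT).
Qed.

Lemma lincomb1 (S : set R -> T -> 'rV[R]_d) z r B :
  lincomb (fun B w => dotV z (S B w)) [:: (r, B)] = fun w => r * dotV z (S B w).
Proof. by apply/funext => w; rewrite /lincomb big_cons big_nil addr0. Qed.

Lemma bounded_cells1 (r : R) B : bounded_Borel B -> bounded_cells [:: (r, B)].
Proof. by move=> bB [|i]//; rewrite /cell/= nth_nil; exact: bounded_Borel0. Qed.

Lemma scattered_sub X Y :
  random_measure P mu X -> random_measure P mu Y -> independent_measures P X Y ->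
  scattered P (fun B w => X B w - Y B w).
Proof.
move=> rX rY XY; have sX := random_measure_scattered rX.
have sY := random_measure_scattered rY.
split.
- by move=> B bB; apply: measurable_rVB; [exact: (rm_measurable rX)|exact: (rm_measurable rY)].
- move=> B bB tB bU; have := rm_sigma_additive rY bB tB bU.
  apply: filterS2 (rm_sigma_additive rX bB tB bU) => w hX hY.
  by under eq_fun do rewrite sumrB; exact: cvgB.
- move=> z l bl dl; rewrite lincomb_sub_chf// (sp_independent sX)// (sp_independent sY)//.
  rewrite rmorph_prod -big_split/= !(big_nth (0, set0)); apply: eq_bigr => i _.
  have b1 := bounded_cells1 (weight l i) (bl i).
  by have := lincomb_sub_chf z rX rY XY b1; rewrite !lincomb1 => ->.
- move=> z p h.
  have E q : chf P (fun w => dotV z (X `]q, q + h]%classic w - Y `]q, q + h]%classic w)) =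
     chf P (fun w => dotV z (X `]q, q + h]%classic w)) *
     (chf P (fun w => dotV z (Y `]q, q + h]%classic w)))^*%C.
    have b1 := bounded_cells1 1 (bounded_Borel_itv q (q + h)).
    have := lincomb_sub_chf z rX rY XY b1; rewrite !lincomb1.
    have one (f : T -> R) : (fun w => 1 * f w) = f by apply/funext => w; rewrite mul1r.
    by rewrite !one.
  have := E 0; rewrite add0r => E0.
  by rewrite E E0 (sp_homogeneous sX) (sp_homogeneous sY).
Qed.

End random_measures.

(** * Cumulants of random measures *)

Lemma expC_ln_normc (R : realType) (u : R[i]) : 0 < Normc.normc u ^+ 2 ->
  u * u^*%C = expC (ln (Normc.normc u ^+ 2))%:C%C.
Proof.
move=> u0; rewrite /expC [complex.Re _]/= [complex.Im _]/= lnK ?posrE//.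
rewrite cos0 sin0 mulr1 mulr0; case: u u0 => x y _.
rewrite /Normc.normc sqr_sqrtr ?addr_ge0 ?sqr_ge0//.
apply/eqP; rewrite eq_complex/=; apply/andP; split; apply/eqP; ring.
Qed.

Section unit_law.
Context dT (T : measurableType dT) (R : realType) (d : nat) (P : probability T R).
Variable mu : probability 'rV[R]_d R.
Implicit Types (X Y : set R -> T -> 'rV[R]_d).

Lemma unit_chf X z : random_measure P mu X ->
  chf P (fun w => dotV z (X `]0, 1]%classic w)) = characteristic_function mu z.
Proof.
move=> rX; rewrite charfun_chf.
apply: (@law_chf _ _ _ _ _ _ P mu (X `]0, 1]%classic) id z).
- exact: (rm_measurable rX (bounded_Borel_itv _ _)).
- exact: measurable_id.
- by move=> A mA; rewrite -(rm_law rX 0 mA) add0r.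
Qed.

Lemma unit_scaled_chf X z t : random_measure P mu X ->
  chf P (fun w => t * dotV z (X `]0, 1]%classic w)) = characteristic_function mu (t *: z).
Proof.
move=> rX; rewrite -(unit_chf _ rX); congr chf.
by apply/funext => w; rewrite dotVZl.
Qed.

Lemma random_measure_cumulant_process X z C : random_measure P mu X ->
  is_cumulant mu C ->
  cumulant_process P (fun B w => dotV z (X B w)) (fun t => C (t *: z)).
Proof.
move=> rX [cRe cIm C0 hC]; apply: scattered_cumulant_process.
- exact: random_measure_scattered rX.
- by move=> t; rewrite unit_scaled_chf.
- by rewrite scale0r.
- move=> t; have h : (fun t : R => t *: z) @ t --> t *: z by apply: cvgZl; exact: cvg_id.
  split; [exact: cvg_comp h (cRe _)|exact: cvg_comp h (cIm _)].
Qed.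

Lemma small_interval_chf X z (n : nat) : random_measure P mu X ->
  characteristic_function mu z =
  chf P (fun w => dotV z (X `]0, n.+1%:R^-1]%classic w)) ^+ n.+1.
Proof.
move=> rX; have sX := random_measure_scattered rX.
set h := n.+1%:R^-1 : R; have h0 : 0 < h by rewrite invr_gt0.
suff H k : chf P (fun w => dotV z (X `]0, k%:R * h]%classic w)) =
    chf P (fun w => dotV z (X `]0, h]%classic w)) ^+ k.
  by rewrite -H -(unit_chf _ rX) /h mulfV.
elim: k => [|k ih].
  rewrite mul0r expr0 -(chf0 P); apply: chf_ae => //.
    by apply: measurable_dotV; exact: (rm_measurable rX (bounded_Borel_itv _ _)).
  rewrite set_itv_ge ?bnd_simp ?ltxx//.
  exact: (@additive_set0 _ _ _ _ (fun B w => dotV z (X B w)) (scattered_dotV_sigma_additive z sX)).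
have k0 : 0 <= k%:R * h by rewrite mulr_ge0// ltW.
pose l : seq (R * set R) := [:: (1, `]0, k%:R * h]%classic); (1, `]k%:R * h, k%:R * h + h]%classic)].
have bl : bounded_cells l.
  by move=> [|[|i]]; rewrite /cell/= ?nth_nil; do ?[exact: bounded_Borel_itv|exact: bounded_Borel0].
have dI : `]0, k%:R * h]%classic `&` `]k%:R * h, k%:R * h + h]%classic = set0.
  by apply/seteqP; split => x //=; rewrite !in_itv/= => -[/andP[_ ?] /andP[? _]]; lra.
have dl : disjoint_cells l.
  move=> [|[|i]] [|[|j]] _ _; rewrite /cell/= ?nth_nil//; rewrite ?dI ?set0I ?setI0; case => //.
  by rewrite setIC dI.
have := sp_independent sX z bl dl.
rewrite /l !big_cons big_nil mulr1 /=.
have one (g : T -> R) : (fun w => 1 * g w) = g by apply/funext => w; rewrite mul1r.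
rewrite !one (sp_homogeneous sX) ih -exprSr => <-.
apply: chf_ae.
- by apply: measurable_dotV; exact: (rm_measurable rX (bounded_Borel_itv _ _)).
- apply: measurable_lincomb => // B bB; apply: measurable_dotV; exact: (rm_measurable rX).
- have := scattered_dotVU z sX (bounded_Borel_itv _ _)
    (bounded_Borel_itv _ _) dI.
  have -> : `]0, k%:R * h] `|` `]k%:R * h, k%:R * h + h] = `]0, k.+1%:R * h]%classic.
    rewrite -(natr1 k) mulrDl mul1r.
    apply/seteqP; split => x /=; rewrite !in_itv/=.
      by move=> [/andP[? ?]|/andP[? ?]]; apply/andP; split; lra.
    move=> /andP[x0 x1]; have [xk|xk] := leP x (k%:R * h).
      by left; rewrite x0.
    by right; rewrite x1.
  apply: filterS => w ->; rewrite /lincomb !big_cons big_nil/=.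
  by rewrite !mul1r addr0.
Qed.

(** The mass of the interval from 0 to 1/n tends to 0, hence its characteristic
    function is nonzero for some n, and so is its n-th power. *)
Lemma charfun_neq0 X z : random_measure P mu X -> characteristic_function mu z != 0.
Proof.
move=> rX; have sX := random_measure_scattered rX.
pose I n : set R := `]0, n.+1%:R^-1]%classic.
pose B n : set R := `]n.+1%:R^-1, 1]%classic.
have ms A : bounded_Borel A -> measurable_fun setT (fun w => dotV z (X A w)).
  by move=> bA; apply: measurable_dotV; exact: (rm_measurable rX).
have n1 (n : nat) : (n.+1%:R^-1 : R) <= 1 by rewrite invf_le1// ler1n.
have n0 (n : nat) : (0 : R) < n.+1%:R^-1 by rewrite invr_gt0.
have BU : \bigcup_n B n = `]0, 1]%classic.
  apply/seteqP; split => x /=.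
    move=> [n _]; rewrite /B/= !in_itv/= => /andP[? ->]; rewrite andbT.
    exact: lt_trans (n0 n) _.
  rewrite in_itv/= => /andP[x0 x1]; exists (Num.truncn x^-1) => //.
  rewrite /B/= in_itv/= x1 andbT invf_plt ?posrE//.
  exact: truncnS_gt.
have cvgB0 : {ae P, forall w, dotV z (X (B n) w) @[n --> \oo] --> dotV z (X `]0, 1]%classic w)}.
  have H := @additive_ndseq _ _ _ _ (fun B w => dotV z (X B w))
    (scattered_dotV_sigma_additive z sX) B.
  rewrite -BU; apply: H.
  - by move=> n; exact: bounded_Borel_itv.
  - move=> m n mn; apply/subsetPset => x; rewrite /B/= !in_itv/= => /andP[h ->].
    by rewrite andbT (le_lt_trans _ h)// lef_pV2 ?posrE// ler_nat.
  - by rewrite BU; exact: bounded_Borel_itv.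
have IB n : {ae P, forall w, dotV z (X `]0, 1]%classic w) =
    dotV z (X (I n) w) + dotV z (X (B n) w)}.
  have -> : `]0, 1]%classic = I n `|` B n.
    apply/seteqP; split => x /=; rewrite /I /B/= !in_itv/=.
      move=> /andP[x0 x1]; have [xk|xk] := leP x n.+1%:R^-1; first by left; rewrite x0.
      by right; rewrite x1.
    move=> [/andP[x0 xn]|/andP[x0 x1]]; apply/andP; split => //.
      exact: le_trans xn (n1 n).
    exact: lt_trans (n0 n) x0.
  apply: (scattered_dotVU z sX); do ?exact: bounded_Borel_itv.
  apply/seteqP; split => x //=; rewrite /I /B/=; rewrite !in_itv/=.
  by move=> -[/andP[_ xn] /andP[nx _]]; move: (lt_le_trans nx xn); rewrite ltxx.
have cI : {ae P, forall w, dotV z (X (I n) w) @[n --> \oo] --> 0}.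
  have := (ae_foralln IB).
  apply: filterS2 cvgB0 => w hB hI.
  rewrite -(subrr (dotV z (X `]0, 1]%classic w))).
  have -> : (fun n => dotV z (X (I n) w)) =
      (fun n => dotV z (X `]0, 1]%classic w) - dotV z (X (B n) w)).
    by apply/funext => n; rewrite (hI n) addrK.
  by apply: cvgB => //; exact: cvg_cst.
have tI := tau_ae_cvg (fun n => ms _ (bounded_Borel_itv _ _)) cI.
have [cR _] : ccvg \oo (fun n => chf P (fun w => dotV z (X (I n) w))) (chf P (fun=> 0)).
  apply: chf_cvg => //; first by move=> n; exact: ms (bounded_Borel_itv _ _).
  by under eq_fun do under [X in tau P X]eq_fun do rewrite subr0.
rewrite chf0 /= in cR.
have [n] : exists n, 0 < complex.Re (chf P (fun w => dotV z (X (I n) w))).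
  have /cvgrPdist_lt /(_ _ ltr01) [N _ /(_ N (leqnn _))] := cR.
  rewrite /= => h; exists N; move: h; rewrite ltr_norml => /andP[_ h]; lra.
move=> h; rewrite (small_interval_chf z n rX) expf_eq0/=.
by apply: contraTN h => /eqP ->; rewrite ltxx.
Qed.

(** The characteristic function of the difference of two independent copies is a
    squared modulus. By [charfun_neq0] it is positive, so that its logarithm is a
    cumulant. *)
Definition sym_cumulant (z : 'rV[R]_d) (t : R) : R[i] :=
  (ln (Normc.normc (characteristic_function mu (t *: z)) ^+ 2))%:C%C.

Lemma sym_cumulant_process X Y z : random_measure P mu X -> random_measure P mu Y ->
  independent_measures P X Y ->
  cumulant_process P (fun B w => dotV z (X B w - Y B w)) (sym_cumulant z).
Proof.
move=> rX rY XY; have neq0 t := charfun_neq0 (t *: z) rX.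
have pos t : 0 < Normc.normc (characteristic_function mu (t *: z)) ^+ 2.
  rewrite exprn_gt0// lt_def; apply/andP; split; last first.
    by case: (characteristic_function _ _) => x y; exact: sqrtr_ge0.
  by apply: contra (neq0 t) => /eqP/Normc.eq0_normc ->.
apply: scattered_cumulant_process.
- exact: (scattered_sub rX rY XY).
- move=> t; have b1 := bounded_cells1 t (bounded_Borel_itv 0 1).
  have := lincomb_sub_chf z rX rY XY b1; rewrite !lincomb1 => ->.
  by rewrite !unit_scaled_chf//; exact: expC_ln_normc.
- have n00 : Normc.normc (characteristic_function mu (0 *: z)) = 1.
    rewrite scale0r charfun_chf.
    have -> : dotV (0 : 'rV[R]_d) = fun=> 0.
      by apply/funext => x; rewrite /dotV big1// => i _; rewrite mxE mul0r.
    by rewrite chf0 Normc.normc1.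
  by rewrite /sym_cumulant n00 expr1n ln1.
- move=> t; split; last exact: cvg_cst.
  have [cr ci] := chf_scale_continuous P t (measurable_dotV z (rm_measurable rX (bounded_Borel_itv 0 1))).
  have E s : Normc.normc (characteristic_function mu (s *: z)) ^+ 2 =
      complex.Re (chf P (fun w => s * dotV z (X `]0, 1]%classic w))) ^+ 2 +
      complex.Im (chf P (fun w => s * dotV z (X `]0, 1]%classic w))) ^+ 2.
    rewrite unit_scaled_chf//; case: (characteristic_function _ _) => x y /=.
    by rewrite sqr_sqrtr ?addr_ge0 ?sqr_ge0.
  have h : (fun s => Normc.normc (characteristic_function mu (s *: z)) ^+ 2) @ t -->
      Normc.normc (characteristic_function mu (t *: z)) ^+ 2.
    under eq_fun do rewrite E; rewrite E.
    by apply: cvgD; rewrite !expr2; [exact: (cvgM cr cr)|exact: (cvgM ci ci)].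
  have H : ln (Normc.normc (characteristic_function mu (s *: z)) ^+ 2) @[s --> t] -->
      ln (Normc.normc (characteristic_function mu (t *: z)) ^+ 2).
    by apply: continuous_cvg h; exact: continuous_ln (pos t).
  exact: H.
Qed.

End unit_law.

(** * Integrals and their uniqueness *)

Section coordinates.
Context (R : realType) (d : nat).
Implicit Types (x z : 'rV[R]_d).

Lemma coord_le_norm x i : `|x ord0 i| <= `|x|.
Proof. by rewrite [leRHS]mx_normrE (le_bigmax_cond _ (fun i => `|x i.1 i.2|) (j := (ord0, i))). Qed.

Lemma norm_ge_coord (e : R) x : 0 < e -> e <= `|x| -> exists i, e <= `|x ord0 i|.
Proof.
move=> e0 ex; have : mx_norm x != 0 by rewrite gt_eqF// (lt_le_trans e0 ex).
by move=> /mx_norm_neq0[[j i] /= xi]; exists i; move: ex; rewrite [`|x|]xi ord1.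
Qed.

Lemma dotV_le_norm z x : `|dotV z x| <= (\sum_(i < d) `|z ord0 i|) * `|x|.
Proof.
rewrite /dotV (le_trans (ler_norm_sum _ _ _))// mulr_suml; apply: ler_sum => i _.
by rewrite normrM ler_wpM2l// coord_le_norm.
Qed.

End coordinates.

Section convergence_in_probability.
Context dT (T : measurableType dT) (R : realType) (d : nat) (P : probability T R).
Implicit Types (L : T -> 'rV[R]_d).

Lemma measurable_norm_tail (e : R) (Z : T -> 'rV[R]_d) : 0 < e ->
  measurable_fun setT Z -> measurable [set w | e <= `|Z w|].
Proof.
move=> e0 mZ.
rewrite (_ : [set w | _] = \big[setU/set0]_(i < d) [set w | e <= `|Z w ord0 i|]).
  apply: bigsetU_measurable => i _; apply: measurable_tail.
  by move/measurable_fun_rVP : mZ.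
apply/seteqP; split => w /=.
  by move=> /(norm_ge_coord e0)[i ei]; rewrite -bigcup_seq; exists i => //=; rewrite mem_index_enum.
by rewrite -bigcup_seq => -[i _ /= ei]; exact: le_trans ei (coord_le_norm _ _).
Qed.

Lemma cvg_in_probability_tau (I : Type) (F : set_system I) (FF : ProperFilter F)
    (Z : I -> T -> 'rV[R]_d) L :
  (forall i, measurable_fun setT (Z i)) -> measurable_fun setT L ->
  (cvg_in_probability P F Z L <->
   forall z, tau P (fun w => dotV z (Z i w - L w)) @[i --> F] --> 0).
Proof.
move=> mZ mL; have mZL i : measurable_fun setT (fun w => Z i w - L w) by exact: measurable_rVB.
split => [[_ h] z|h].
  apply/(@tau_cvgP _ _ _ P _ F FF (fun i w => dotV z (Z i w - L w))) => [i|e e0].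
    exact: measurable_dotV.
  have C0 : 0 <= \sum_(i < d) `|z ord0 i| by apply: sumr_ge0.
  set C := \sum_(i < d) _ in C0.
  have C1 : 0 < C + 1 by rewrite ltr_wpDl.
  have eC : 0 < e / (C + 1) by rewrite divr_gt0.
  apply: (@squeeze_cvge _ _ _ _ (cst 0%E) _ (fun i => P [set w | e / (C + 1) <= `|Z i w - L w|])).
  - apply: nearW => i; rewrite measure_ge0/=; apply: le_measure.
    + by rewrite inE; apply: measurable_tail; exact: measurable_dotV.
    + by rewrite inE; exact: measurable_norm_tail.
    + move=> w /= ez; rewrite ler_pdivrMr// mulrC (le_trans ez)//.
      by rewrite (le_trans (dotV_le_norm _ _))// ler_wpM2r// lerDl.
  - exact: cvg_cst.
  - exact: h.
split => // e e0.
apply: (@squeeze_cvge _ _ _ _ (cst 0%E) _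
  (fun i => \sum_(j < d) P [set w | (e <= `|dotV (delta_mx ord0 j) (Z i w - L w)|)%R])%E).
- apply: nearW => i; rewrite measure_ge0/=.
  have mS j : measurable [set w | e <= `|dotV (delta_mx ord0 j) (Z i w - L w)|].
    by apply: measurable_tail; exact: measurable_dotV.
  apply: (@le_trans _ _ (P (\big[setU/set0]_(j < d)
      [set w | e <= `|dotV (delta_mx ord0 j) (Z i w - L w)|]))).
    apply: le_measure.
    + by rewrite inE; exact: measurable_norm_tail.
    + by rewrite inE; exact: bigsetU_measurable.
    + move=> w /= /(norm_ge_coord e0)[j ej]; rewrite -bigcup_seq; exists j => /=.
        by rewrite mem_index_enum.
      by rewrite dotV_delta.
  have := @big_ind2 _ _ (fun A x => measurable A /\ (P A <= x)%E) set0 setU 0%E +%E _ _ 'I_d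
    (index_enum 'I_d) xpredT (fun j => [set w | e <= `|dotV (delta_mx ord0 j) (Z i w - L w)|])
    (fun j => P [set w | e <= `|dotV (delta_mx ord0 j) (Z i w - L w)|]).
  move=> H; apply: (H _ _ _).2; [by rewrite measure0| |by move=> j _; split].
  move=> A x B y [mA Ax] [mB By]; split; first exact: measurableU.
  by rewrite (le_trans (measureU2 _ mA mB))// leeD.
- exact: cvg_cst.
- have E0 : (\sum_(j < d) (fun=> 0) j = 0 :> \bar R)%E by rewrite big1.
  rewrite -[X in _ --> X]E0; apply: cvg_nnesum => [j _|j _].
    by apply: nearW => i; exact: measure_ge0.
  apply: (@tau_cvgP _ _ _ P _ F FF (fun i w => dotV (delta_mx ord0 j) (Z i w - L w)) _).1 => //.
  by move=> i; exact: measurable_dotV.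
Qed.

Lemma cvg_in_probability_tau_seq (Z : nat -> T -> 'rV[R]_d) L :
  (forall n, measurable_fun setT (Z n)) -> measurable_fun setT L ->
  (cvg_in_probability P \oo Z L <->
   forall z, tau P (fun w => dotV z (Z n w - L w)) @[n --> \oo] --> 0).
Proof. exact: cvg_in_probability_tau. Qed.

Lemma tau_cvg_dotV (Z : nat -> T -> 'rV[R]_d) : (forall n, measurable_fun setT (Z n)) ->
  (forall j, tau P (fun w => Z n w ord0 j) @[n --> \oo] --> 0) ->
  forall z, tau P (fun w => dotV z (Z n w)) @[n --> \oo] --> 0.
Proof.
move=> mZ hZ z; rewrite /dotV; elim: (index_enum _) => [|i r ih].
  under eq_fun do under [X in tau P X]eq_fun do rewrite big_nil.
  by rewrite tau0; exact: cvg_cst.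
have mZi n j : measurable_fun setT (fun w => Z n w ord0 j).
  by move/measurable_fun_rVP : (mZ n).
have -> : (fun n => tau P (fun w => \sum_(i <- i :: r) z ord0 i * Z n w ord0 i)) =
   fun n => tau P (fun w => (\sum_(i <- r) z ord0 i * Z n w ord0 i) + z ord0 i * Z n w ord0 i).
  by apply/funext => n; congr tau; apply/funext => w; rewrite big_cons addrC.
apply: (@tau_cvg0_lin _ _ _ _ _ _ (z ord0 i) _ _ ih (hZ i)) => n //.
by apply: measurable_sum => j; exact: measurable_funM.
Qed.

Lemma tau_dotV0_ae (Z : T -> 'rV[R]_d) : measurable_fun setT Z ->
  (forall z, tau P (fun w => dotV z (Z w)) = 0) -> {ae P, forall w, Z w = 0}.
Proof.
move=> mZ h.
have : forall j : 'I_d, {ae P, forall w, Z w ord0 j = 0}.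
  move=> j; have := tau0_ae (measurable_dotV _ mZ) (h (delta_mx ord0 j)).
  by apply: filterS => w; rewrite dotV_delta.
move=> hj.
apply: filterS (filter_forall _ hj) => w E; apply/rowP => j; by rewrite mxE E.
Qed.

End convergence_in_probability.

Section inner_sets.
Context (R : realType) (a b : \bar R).
Implicit Types (A B K : set R).

Lemma inner_bounded B : inner_Borel a b B -> bounded_Borel B.
Proof.
move=> [mB Bab aB Bb]; apply/bounded_BorelP; split => //.
have lo : exists N : nat, forall x, B x -> - N%:R < x.
  case E : (ereal_inf (EFin @` B)) => [r| |].
  - exists (Num.truncn `|r|).+1 => x Bx.
    have : (r%:E <= x%:E)%E by rewrite -E; apply: ereal_inf_lbound; exists x.
    rewrite lee_fin; apply: lt_le_trans; rewrite ltrNl (le_lt_trans _ (truncnS_gt _))//.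
    by rewrite -normrN ler_norm.
  - exists 0%N => x Bx; have := @ereal_inf_lbound _ (EFin @` B) x%:E.
    by rewrite E => /(_ (imageP _ Bx)); rewrite leye_eq.
  - by move: aB; rewrite E ltNge leNye.
have hi : exists N : nat, forall x, B x -> x <= N%:R.
  case E : (ereal_sup (EFin @` B)) => [r| |].
  - exists (Num.truncn `|r|).+1 => x Bx.
    have : (x%:E <= r%:E)%E by rewrite -E; apply: ereal_sup_ubound; exists x.
    rewrite lee_fin => /le_trans; apply; rewrite (le_trans (ler_norm _))// ltW//.
    exact: truncnS_gt.
  - by move: Bb; rewrite E ltNge leey.
  - exists 0%N => x Bx; have := @ereal_sup_ubound _ (EFin @` B) x%:E.
    by rewrite E => /(_ (imageP _ Bx)); rewrite leeNy_eq.
have [M hM] := lo; have [N hN] := hi; exists (maxn M N) => x Bx /=.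
rewrite in_itv/=; apply/andP; split.
  by rewrite (le_lt_trans _ (hM _ Bx))// lerN2 ler_nat leq_maxl.
by rewrite (le_trans (hN _ Bx))// ler_nat leq_maxr.
Qed.

Lemma inner_subset A B : measurable A -> A `<=` B -> inner_Borel a b B -> inner_Borel a b A.
Proof.
move=> mA AB [mB Bab aB Bb]; split => //.
- exact: subset_trans Bab.
- by rewrite (lt_le_trans aB)//; apply: ereal_inf_le_tmp; exact: image_subset.
- by rewrite (le_lt_trans _ Bb)//; apply: ereal_sup_le; exact: image_subset.
Qed.

Lemma inner_itv (p q : R) : (a < p%:E)%E -> (q%:E < b)%E -> inner_Borel a b `]p, q]%classic.
Proof.
move=> ap qb; split.
- exact: measurable_itv.
- move=> x /=; rewrite in_itv/= => /andP[px xq]; split.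
    by rewrite (lt_trans ap)// lte_fin.
  by rewrite (le_lt_trans _ qb)// lee_fin.
- rewrite (lt_le_trans ap)//; apply: le_ereal_inf_tmp => _ [x /= + <-].
  by rewrite in_itv/= lee_fin => /andP[/ltW].
- rewrite (le_lt_trans _ qb)//; apply: ge_ereal_sup => _ [x /= + <-].
  by rewrite in_itv/= lee_fin => /andP[].
Qed.

Lemma measurable_ereal_ooitv : measurable (ereal_ooitv a b).
Proof.
rewrite (_ : ereal_ooitv a b = EFin @^-1` `]a, b[%classic).
  by rewrite -[X in measurable X]setTI; apply: EFin_measurable => //; exact: emeasurable_itv.
by apply/seteqP; split => x; rewrite /= in_itv/= => /andP.
Qed.

End inner_sets.

Section simple_integrals.
Context dT (T : measurableType dT) (R : realType) (d : nat) (P : probability T R).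
Context (a b : \bar R).
Implicit Types (S : set R -> T -> 'rV[R]_d) (phi : simple_fun a b).

Definition simple_cells phi B : seq (R * set R) :=
  [seq (sf_coef j, B `&` sf_piece j) | j <- index_enum 'I_(sf_card phi)].

Lemma dotV_simple_integral S phi z B w :
  dotV z (simple_integral S phi B w) =
  lincomb (fun B w => dotV z (S B w)) (simple_cells phi B) w.
Proof.
rewrite /simple_integral dotV_sum /lincomb big_map.
by apply: eq_bigr => j _; rewrite dotVZ.
Qed.

Lemma bounded_cells_map (I : Type) (h : I -> R * set R) (s : seq I) :
  (forall j, bounded_Borel (h j).2) -> bounded_cells [seq h j | j <- s].
Proof.
move=> hb; elim: s => [|j s ih] [|i]; rewrite /cell/= ?nth_nil.
- exact: bounded_Borel0.
- exact: bounded_Borel0.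
- exact: hb.
- exact: (ih i).
Qed.

Lemma bounded_simple_cells phi B : bounded_Borel B -> bounded_cells (simple_cells phi B).
Proof.
move=> bB; apply: bounded_cells_map => j /=; rewrite setIC.
by apply: bounded_BorelI => //; exact: measurable_piece.
Qed.

Lemma restrict_simple_cells phi A B : A `<=` B ->
  restrict_cells A (simple_cells phi B) = simple_cells phi A.
Proof.
move=> AB; rewrite /restrict_cells /simple_cells -map_comp; apply: eq_map => j /=.
by rewrite setIA (setIidl AB).
Qed.

Lemma step_simple_cells phi B x : B x -> step (simple_cells phi B) x = simple_eval phi x.
Proof.
move=> Bx; rewrite /step big_map; apply: eq_bigr => j _ /=.
by rewrite !indicE in_setI mem_set.
Qed.

Lemma measurable_simple_integral S phi B :
  (forall B, bounded_Borel B -> measurable_fun setT (S B)) -> bounded_Borel B ->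
  measurable_fun setT (simple_integral S phi B).
Proof.
move=> mS bB; apply/measurable_fun_rVP => i.
under eq_fun do rewrite -dotV_delta dotV_simple_integral.
apply: measurable_lincomb; last exact: bounded_simple_cells.
by move=> A bA; apply: measurable_dotV; exact: mS.
Qed.

Lemma integral_measurable S f J B : is_integral P a b S f J -> inner_Borel a b B ->
  measurable_fun setT (J B).
Proof. by move=> [phi [_ h]] /h[]. Qed.

Lemma integral_tau S (phi : nat -> simple_fun a b) J B :
  (forall B, bounded_Borel B -> measurable_fun setT (S B)) -> inner_Borel a b B ->
  cvg_in_probability P \oo (fun n => simple_integral S (phi n) B) (J B) ->
  forall z, tau P (fun w => lincomb (fun B w => dotV z (S B w)) (simple_cells (phi n) B) w
                        - dotV z (J B w)) @[n --> \oo] --> 0.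
Proof.
move=> mS iB h z; have mJ := h.1.
under eq_fun do under [X in tau P X]eq_fun do rewrite -dotV_simple_integral -dotVB.
have mI n : measurable_fun setT (simple_integral S (phi n) B).
  by apply: measurable_simple_integral => //; exact: inner_bounded iB.
exact: ((@cvg_in_probability_tau_seq _ _ _ _ P (fun n => simple_integral S (phi n) B)
  (J B) mI mJ).1 h z).
Qed.

(** The Levy-Khintchine formula for the integral of [f]. *)
Lemma integral_chf S z c f J K :
  (forall B, bounded_Borel B -> measurable_fun setT (S B)) ->
  cumulant_process P (fun B w => dotV z (S B w)) c ->
  measurable_fun (ereal_ooitv a b) f -> is_integral P a b S f J -> inner_Borel a b K ->
  (@lebesgue_measure R).-integrable K (EFin \o (fun x => complex.Re (c (f x)))) ->
  (@lebesgue_measure R).-integrable K (EFin \o (fun x => complex.Im (c (f x)))) ->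
  chf P (fun w => dotV z (J K w)) = expC (cintegral K (fun x => c (f x))).
Proof.
move=> mS sc mf [phi [phif hJ]] iK cR cI.
have bK := inner_bounded iK.
have [mK Kab _ _] := iK.
apply: (limit_chf sc (l := fun n => simple_cells (phi n) K) (J := fun B w => dotV z (J B w))) => //.
- by move=> n; exact: bounded_simple_cells.
- by apply: measurable_funS mf => //; exact: measurable_ereal_ooitv.
- apply: ae_mono phif => x h Kx.
  under eq_fun do rewrite step_simple_cells//.
  exact: h (Kab _ Kx).
- move=> B mB BK; have iB := inner_subset mB BK iK.
  have hB := hJ B iB; split; first by apply: measurable_dotV; case: hB.
  under eq_fun do rewrite restrict_simple_cells//.
  exact: integral_tau.
Qed.

Lemma lincomb_cat (s : set R -> T -> R) l l' w :
  lincomb s (l ++ l') w = lincomb s l w + lincomb s l' w.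
Proof. by rewrite /lincomb big_cat. Qed.

Definition opp_cells (l : seq (R * set R)) := [seq (- p.1, p.2) | p <- l].

Lemma lincomb_opp (s : set R -> T -> R) l w : lincomb s (opp_cells l) w = - lincomb s l w.
Proof. by rewrite /lincomb big_map -sumrN; apply: eq_bigr => p _; rewrite mulNr. Qed.

Lemma step_opp l (x : R) : step (opp_cells l) x = - step l x.
Proof. by rewrite /step big_map -sumrN; apply: eq_bigr => p _; rewrite mulNr. Qed.

Lemma step_cat l l' (x : R) : step (l ++ l') x = step l x + step l' x.
Proof. by rewrite /step big_cat. Qed.

Lemma bounded_cells_cat (l l' : seq (R * set R)) :
  bounded_cells l -> bounded_cells l' -> bounded_cells (l ++ l').
Proof. by move=> bl bl' i; rewrite cell_cat; case: ifP. Qed.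

Lemma bounded_cells_opp (l : seq (R * set R)) : bounded_cells l -> bounded_cells (opp_cells l).
Proof.
elim: l => [//|p l ih] /bounded_cells_cons[bp bl] [|i] //; exact: (ih bl i).
Qed.

(** The difference of two versions of the integral is a limit of integrals of
    step functions that tend to 0; by [limit_chf] its characteristic function
    is 1 everywhere. *)
Lemma integral_unique S (c : 'rV[R]_d -> R -> R[i]) f J J' K :
  (forall B, bounded_Borel B -> measurable_fun setT (S B)) ->
  (forall z, cumulant_process P (fun B w => dotV z (S B w)) (c z)) ->
  is_integral P a b S f J -> is_integral P a b S f J' -> inner_Borel a b K ->
  {ae P, forall w, J K w = J' K w}.
Proof.
move=> mS sc iJ iJ' iK.
have mJ B := integral_measurable iJ (B := B); have mJ' B := integral_measurable iJ' (B := B).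
have mD B : inner_Borel a b B -> measurable_fun setT (fun w => J B w - J' B w).
  by move=> iB; apply: measurable_rVB; [exact: mJ|exact: mJ'].
have [phi [phif hJ]] := iJ; have [phi' [phif' hJ']] := iJ'.
have bK := inner_bounded iK; have [mK Kab _ _] := iK.
have chf1 z : chf P (fun w => dotV z (J K w - J' K w)) = 1.
  pose l n := simple_cells (phi n) K ++ opp_cells (simple_cells (phi' n) K).
  have c0 := cp_cumulant0 (sc z).
  have E0 : cintegral K (fun=> c z 0) = 0.
    by rewrite /cintegral c0 /= !Rintegral_cst// !mul0r.
  rewrite -(@expC0 R) -E0.
  apply: (limit_chf (sc z) (l := l) (f := cst 0) (J := fun B w => dotV z (J B w - J' B w))) => //.
  - move=> n; apply: bounded_cells_cat; first exact: bounded_simple_cells.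
    by apply: bounded_cells_opp; exact: bounded_simple_cells.
  - apply: ae_mono2 phif phif' => x h h' Kx.
    under eq_fun do rewrite step_cat step_opp !step_simple_cells//.
    by rewrite /cst/= -(subrr (f x)); apply: cvgB; [exact: h (Kab _ Kx)|exact: h' (Kab _ Kx)].
  - have -> : EFin \o (fun x : R => complex.Re (c z (cst 0 x))) = cst 0%E.
      by apply/funext => x; rewrite /cst/= c0.
    exact: integrable0.
  - have -> : EFin \o (fun x : R => complex.Im (c z (cst 0 x))) = cst 0%E.
      by apply/funext => x; rewrite /cst/= c0.
    exact: integrable0.
  - move=> B mB BK; have iB := inner_subset mB BK iK; split; first exact: measurable_dotV (mD _ iB).
    have -> : (fun n => tau P (fun w => lincomb (fun B w => dotV z (S B w)) (restrict_cells B (l n)) w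
         - dotV z (J B w - J' B w))) = fun n => tau P (fun w =>
        (lincomb (fun B w => dotV z (S B w)) (simple_cells (phi n) B) w - dotV z (J B w)) +
        (-1) * (lincomb (fun B w => dotV z (S B w)) (simple_cells (phi' n) B) w - dotV z (J' B w))).
      apply/funext => n; congr tau; apply/funext => w.
      rewrite /l /restrict_cells map_cat -/(restrict_cells _ _) restrict_simple_cells//.
      have -> : [seq (p.1, B `&` p.2) | p <- opp_cells (simple_cells (phi' n) K)] =
          opp_cells (simple_cells (phi' n) B).
        rewrite -(restrict_simple_cells (phi' n) BK) /restrict_cells /opp_cells -!map_comp.
        exact: eq_map.
      rewrite lincomb_cat lincomb_opp dotVB; ring.
    have h1 := integral_tau mS iB (hJ B iB) z; have h2 := integral_tau mS iB (hJ' B iB) z.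
    have mm (psi : nat -> simple_fun a b) J0 n : measurable_fun setT (J0 B) -> measurable_fun setT
       (fun w => lincomb (fun B w => dotV z (S B w)) (simple_cells (psi n) B) w - dotV z (J0 B w)).
      move=> mJ0; apply: measurable_funB; last exact: measurable_dotV.
      apply: measurable_lincomb; last exact: bounded_simple_cells (inner_bounded iB).
      by move=> A bA; apply: measurable_dotV; exact: mS.
    apply: (@tau_cvg0_lin _ _ _ _ _ _ (-1) _ _ h1 h2) => n; [exact: mm (mJ _ iB)|exact: mm (mJ' _ iB)].
have := @tau_dotV0_ae _ _ _ _ P (fun w => J K w - J' K w) (mD _ iK).
have H0 z : tau P (fun w => dotV z (J K w - J' K w)) = 0.
  have : tau P (fun w => dotV z (J K w - J' K w)) @[_ --> \oo] --> 0.
    apply: (@tau_cvg_cos _ _ _ P (fun _ w => dotV z (J K w - J' K w))) => [_|t].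
      exact: measurable_dotV (mD _ iK).
    have /(congr1 (@complex.Re R)) := chf1 (t *: z); rewrite /chf/= => h.
    under eq_fun do under eq_Rintegral do rewrite -dotVZl.
    by rewrite h; exact: cvg_cst.
  by move=> /(cvg_unique _ (cvg_cst _)) <-.
move=> /(_ H0); apply: filterS => w /eqP; rewrite subr_eq0 => /eqP.
by [].
Qed.

End simple_integrals.

(** * Improper limits along sequences *)

Section countable_bases.
Context (I : Type).
Implicit Types (F : set_system I) (U : nat -> set I).

Definition countable_base F U := [/\ forall n, F (U n),
  forall A, F A -> exists n, U n `<=` A & forall n, U n.+1 `<=` U n].

Lemma base_decreasing F U m n : countable_base F U -> (m <= n)%N -> U n `<=` U m.
Proof.
move=> [_ _ dU]; elim: n => [|n ih]; first by rewrite leqn0 => /eqP ->.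
by rewrite leq_eqVlt ltnS => /orP[/eqP ->//|/ih]; exact: subset_trans (dU n).
Qed.

Lemma cvg_base F U (FF : Filter F) (Y : topologicalType) (h : I -> Y) (l : Y) :
  countable_base F U ->
  (h i @[i --> F] --> l <->
   forall x : nat -> I, (forall n, U n (x n)) -> h (x n) @[n --> \oo] --> l).
Proof.
move=> bU; have [FU UF dU] := bU; split => [hl x xU A lA|hx A lA].
  have [N UN] := UF _ (hl A lA); exists N => // n /= Nn.
  by apply: UN; exact: base_decreasing bU Nn _ (xU n).
apply: contrapT => nA.
have : forall n, exists i, U n i /\ ~ A (h i).
  move=> n; apply: contrapT => hn; apply: nA.
  apply: (@filterS I F FF _ (h @^-1` A) _ (FU n)) => i Ui /=.
  by apply: contrapT => nAi; apply: hn; exists i.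
move=> /choice[x xP].
have [N _ /(_ N (leqnn N))] := hx x (fun n => (xP n).1) A lA.
exact: (xP N).2.
Qed.

End countable_bases.

Lemma base_prod (I J : Type) (F : set_system I) (G : set_system J) U V :
  countable_base F U -> countable_base G V ->
  countable_base (filter_prod F G) (fun n => U n `*` V n).
Proof.
move=> bU bV; have [FU UF dU] := bU; have [GV VG dV] := bV; split.
- by move=> n; exists (U n, V n); [split; [exact: FU|exact: GV]|].
- move=> A [[B C] /= [FB GC] BCA].
  have [m UB] := UF _ FB; have [n VC] := VG _ GC; exists (maxn m n) => -[i j] [/= Ui Vj].
  apply: BCA; split => /=.
    by apply: UB; exact: base_decreasing bU (leq_maxl _ _) _ Ui.
  by apply: VC; exact: base_decreasing bV (leq_maxr _ _) _ Vj.
- by move=> n [i j] [/= /dU ? /dV ?]; split.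
Qed.

Section improper_filter.
Context (R : realType) (a b : \bar R).
Hypothesis ab : (a < b)%E.

Lemma right_filter_base : exists U, countable_base (right_filter a) U.
Proof.
case: a ab => [r _|h|_]; [|by move: h; rewrite ltNge leey|].
- exists (fun n => `]r, r + n.+1%:R^-1[%classic); split.
  + move=> n; near=> x; rewrite /= in_itv/=; apply/andP; split => //.
    by near: x; apply: nbhs_right_lt; rewrite ltrDl invr_gt0.
  + move=> A [e /= e0 eA]; exists (Num.truncn e^-1) => x /=; rewrite in_itv/= => /andP[rx xr].
    apply: eA => //=; rewrite ltr0_norm ?subr_lt0// opprB ltrBlDl (lt_trans xr)// ltrD2l.
    rewrite invf_plt ?posrE//; exact: truncnS_gt.
  + move=> n x /=; rewrite !in_itv/= => /andP[-> h] /=; rewrite (lt_le_trans h)// lerD2l.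
    by rewrite lef_pV2 ?posrE// ler_nat.
- exists (fun n => `]-oo, - n%:R[%classic); split.
  + by move=> n; exists (- n%:R); split => [|x]; rewrite ?num_real//= in_itv.
  + move=> A [M [_ MA]]; exists (Num.truncn `|M|).+1 => x /=; rewrite in_itv/= => h.
    apply: MA; rewrite (lt_trans h)// ltrNl (le_lt_trans _ (truncnS_gt _))//.
    by rewrite -normrN ler_norm.
  + by move=> n x /=; rewrite !in_itv/= => h; rewrite (lt_le_trans h)// lerN2 ler_nat.
Unshelve. all: by end_near. Qed.

Lemma left_filter_base : exists U, countable_base (left_filter b) U.
Proof.
case: b ab => [r| |]; last by rewrite ltNge leNye.
- move=> _; exists (fun n => `]r - n.+1%:R^-1, r[%classic); split.
  + move=> n; near=> x; rewrite /= in_itv/=; apply/andP; split => //.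
    by near: x; apply: nbhs_left_gt; rewrite gtrBl invr_gt0.
  + move=> A [e /= e0 eA]; exists (Num.truncn e^-1) => x /=; rewrite in_itv/= => /andP[rx xr].
    apply: eA => //=; rewrite gtr0_norm ?subr_gt0// ltrBlDl -ltrBlDr (lt_trans _ rx)//.
    rewrite ltrD2l ltrN2 invf_plt ?posrE//; exact: truncnS_gt.
  + move=> n x /=; rewrite !in_itv/= => /andP[h ->]; rewrite andbT (le_lt_trans _ h)// lerD2l.
    by rewrite lerN2 lef_pV2 ?posrE// ler_nat.
- move=> _; exists (fun n => `]n%:R, +oo[%classic); split.
  + by move=> n; exists n%:R; split => [|x]; rewrite ?num_real//= in_itv/= andbT.
  + move=> A [M [_ MA]]; exists (Num.truncn `|M|).+1 => x /=; rewrite in_itv/= andbT => h.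
    apply: MA; rewrite (lt_trans _ h)// (le_lt_trans (ler_norm _) (truncnS_gt _))//.
  + by move=> n x /=; rewrite !in_itv/= !andbT => h; rewrite (le_lt_trans _ h)// ler_nat.
Unshelve. all: by end_near. Qed.

Instance right_filter_proper : ProperFilter (right_filter a).
Proof. case: a ab => [r _|h|_] /=; [exact: at_right_proper_filter|
  by move: h; rewrite ltNge leey|exact: proper_ninfty_nbhs]. Qed.

Instance left_filter_proper : ProperFilter (left_filter b).
Proof.
case: b ab => [r| |] /=; [by move=> _; exact: at_left_proper_filter|
  by move=> _; exact: proper_pinfty_nbhs|by rewrite ltNge leNye].
Qed.

Lemma improper_filter_proper : ProperFilter (improper_filter a b).
Proof. exact: filter_prod_proper. Qed.

Lemma right_filter_gt : right_filter a [set x | (a < x%:E)%E].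
Proof.
case: a ab => [r _|h|_]; [|by move: h; rewrite ltNge leey|].
  by near=> x; rewrite /= lte_fin.
by exists 0; split => // x _; rewrite /= ltNyr.
Unshelve. all: by end_near. Qed.

Lemma right_filter_lt s : (a < s%:E)%E -> right_filter a [set x | x < s].
Proof.
case: a ab => [r _|h|_]; [|by move: h; rewrite ltNge leey|].
  by rewrite lte_fin => rs; exact: nbhs_right_lt.
by exists s; split => //; rewrite num_real.
Qed.

Lemma left_filter_lt : left_filter b [set x | (x%:E < b)%E].
Proof.
case: b ab => [r| |]; last by rewrite ltNge leNye.
  by move=> _; near=> x; rewrite /= lte_fin.
by move=> _; exists 0; split => // x _; rewrite /= ltry.
Unshelve. all: by end_near. Qed.

Lemma left_filter_gt s : (s%:E < b)%E -> left_filter b [set x | s < x].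
Proof.
case: b ab => [r| |]; last by rewrite ltNge leNye.
  by move=> _; rewrite lte_fin => rs; exact: nbhs_left_gt.
by move=> _ _; exists s; split => //; rewrite num_real.
Qed.

(** A countable base reduces convergence along this filter to convergence along
    sequences, which dominated convergence requires. The intervals of this base
    stay inside (a, b) and exhaust it. *)
Lemma improper_filter_base : exists U, [/\ countable_base (improper_filter a b) U,
  forall n pq, U n pq -> inner_Borel a b `]pq.1, pq.2]%classic,
  forall s, ereal_ooitv a b s -> forall x : nat -> R * R, (forall n, U n (x n)) ->
    \forall n \near \oo, `](x n).1, (x n).2]%classic s
  & forall n, U n !=set0].
Proof.
have [V bV] := right_filter_base; have [W bW] := left_filter_base.
have bb := base_prod bV bW.
have [FU UF dU] := bb.
have [N UN] : exists N, V N `*` W N `<=` [set pq | (a < pq.1%:E)%E /\ (pq.2%:E < b)%E].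
  apply: UF; exists ([set x | (a < x%:E)%E], [set x | (x%:E < b)%E]) => //.
  by split; [exact: right_filter_gt|exact: left_filter_lt].
have shift (A : nat -> set (R * R)) : countable_base (improper_filter a b) A ->
    countable_base (improper_filter a b) (fun n => A (N + n)%N).
  move=> bA; have [FA AF dA] := bA; split.
  - by move=> n; exact: FA.
  - move=> B /AF[n AB]; exists n => x Ax; apply: AB.
    exact: base_decreasing bA (leq_addl N n) _ Ax.
  - by move=> n; rewrite addnS; exact: dA.
exists (fun n => V (N + n)%N `*` W (N + n)%N); split.
- exact: (shift _ bb).
- move=> n pq Upq; have [] := UN pq (base_decreasing bb (leq_addr n N) Upq).
  exact: inner_itv.
- move=> s [as_ sb] x xU.
  have [M UM] : exists M, V M `*` W M `<=` [set pq | pq.1 < s /\ s < pq.2].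
    apply: UF; exists ([set x | x < s], [set x | s < x]) => //.
    by split; [exact: right_filter_lt|exact: left_filter_gt].
  exists M => // n /= Mn.
  have [] := UM (x n) (base_decreasing bb (leq_trans Mn (leq_addl N n)) (xU n)).
  by rewrite /= in_itv/= => -> /ltW ->.
- by move=> n; exact: (@filter_ex _ _ improper_filter_proper _ (FU (N + n)%N)).
Qed.

End improper_filter.

Section completeness.
Context dT (T : measurableType dT) (R : realType) (d : nat) (P : probability T R).
Context (I : Type) (F : set_system I) (U : nat -> set I).
Hypotheses (FF : Filter F) (bU : countable_base F U) (U0 : forall n, U n !=set0).
Variable Z : I -> T -> 'rV[R]_d.
Hypothesis mZ : forall i, U 0%N i -> measurable_fun setT (Z i).

Let mZx (x : nat -> I) n : (forall n, U n (x n)) -> measurable_fun setT (Z (x n)).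
Proof. by move=> xU; apply: mZ; exact: base_decreasing bU (leq0n n) _ (xU n). Qed.

Lemma cvg_in_probability_seq L : cvg_in_probability P F Z L <->
  measurable_fun setT L /\ forall x, (forall n, U n (x n)) ->
   forall z, tau P (fun w => dotV z (Z (x n) w - L w)) @[n --> \oo] --> 0.
Proof.
split => [[mL h]|[mL h]]; split => //.
  move=> x xU; apply: (@cvg_in_probability_tau_seq _ _ _ _ P (fun n => Z (x n)) L _ mL).1.
    by move=> n; exact: mZx.
  split => // e e0; have := h e e0.
  by move=> /(cvg_base FF (fun i => P [set w | e <= `|Z i w - L w|]) 0%E bU) /(_ x xU).
move=> e e0.
apply/(cvg_base FF (fun i => P [set w | e <= `|Z i w - L w|]) 0%E bU) => x xU.
have [_] := (@cvg_in_probability_tau_seq _ _ _ _ P (fun n => Z (x n)) L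
  (fun n => mZx n xU) mL).2 (h x xU).
exact.
Qed.

Lemma cvg_in_probability_cauchy L : cvg_in_probability P F Z L ->
  forall x y, (forall n, U n (x n)) -> (forall n, U n (y n)) ->
  forall z, tau P (fun w => dotV z (Z (x n) w - Z (y n) w)) @[n --> \oo] --> 0.
Proof.
move=> /cvg_in_probability_seq[mL h] x y xU yU z.
have -> : (fun n => tau P (fun w => dotV z (Z (x n) w - Z (y n) w))) =
    fun n => tau P (fun w => dotV z (Z (x n) w - L w) + (-1) * dotV z (Z (y n) w - L w)).
  apply/funext => n; congr tau; apply/funext => w; rewrite !dotVB; ring.
apply: (@tau_cvg0_lin _ _ _ _ _ _ (-1) _ _ (h x xU z) (h y yU z)) => n;
  by apply: measurable_dotV; apply: measurable_rVB => //; exact: mZx.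
Qed.

(** A single sequence gives the limit, and all the others follow it. *)
Lemma cvg_in_probability_complete :
  (forall x y, (forall n, U n (x n)) -> (forall n, U n (y n)) ->
   forall z, tau P (fun w => dotV z (Z (x n) w - Z (y n) w)) @[n --> \oo] --> 0) ->
  exists L, cvg_in_probability P F Z L.
Proof.
move=> cZ; have /choice[x xU] := U0.
have mD n i (y : nat -> I) : (forall n, U n (y n)) -> measurable_fun setT (fun w => Z (y n) w ord0 i).
  by move=> yU; move/measurable_fun_rVP : (mZx n yU).
have /choice[L LP] : forall i : 'I_d, exists L : T -> R, measurable_fun setT L /\
    tau P (fun w => Z (x n) w ord0 i - L w) @[n --> \oo] --> 0.
  move=> i; apply: tau_cauchy; first by move=> n; exact: mD.
  move=> e e0; apply: contrapT => nN.
  have : forall N, exists mn : nat * nat, [/\ (N <= mn.1)%N, (N <= mn.2)%N &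
      e < tau P (fun w => Z (x mn.1) w ord0 i - Z (x mn.2) w ord0 i)].
    move=> N; apply: contrapT => hN; apply: nN; exists N => m n Nm Nn.
    by rewrite leNgt; apply/negP => h; apply: hN; exists (m, n).
  move=> /choice[u uP].
  have := cZ (fun N => x (u N).1) (fun N => x (u N).2) _ _ (delta_mx ord0 i).
  have xu1 N : U N (x (u N).1).
    by have [h _ _] := uP N; exact: base_decreasing bU h _ (xU _).
  have xu2 N : U N (x (u N).2).
    by have [_ h _] := uP N; exact: base_decreasing bU h _ (xU _).
  move=> /(_ xu1 xu2) /cvgrPdist_lt /(_ e e0)[N _ /(_ N (leqnn N))] /=.
  rewrite sub0r normrN ger0_norm ?tau_ge0// => h.
  have [_ _] := uP N; rewrite ltNge => /negP; apply; apply: ltW; move: h.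
  by under [X in tau P X]eq_fun do rewrite dotV_delta !mxE.
pose L' w : 'rV[R]_d := \row_i L i w; exists L'.
have mL' : measurable_fun setT L'.
  by apply/measurable_fun_rVP => i; under eq_fun do rewrite mxE; exact: (LP i).1.
have xL z : tau P (fun w => dotV z (Z (x n) w - L' w)) @[n --> \oo] --> 0.
  move: z; apply: tau_cvg_dotV => [n|j].
    by apply: measurable_rVB => //; exact: mZx.
  by under eq_fun do under [X in tau P X]eq_fun do rewrite !mxE; exact: (LP j).2.
apply: (cvg_in_probability_seq L').2; split; [exact: mL'|move=> y yU z].
have -> : (fun n => tau P (fun w => dotV z (Z (y n) w - L' w))) =
    fun n => tau P (fun w => dotV z (Z (y n) w - Z (x n) w) + 1 * dotV z (Z (x n) w - L' w)).
  apply/funext => n; congr tau; apply/funext => w; rewrite !dotVB; ring.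
apply: (@tau_cvg0_lin _ _ _ _ _ _ 1 _ _ (cZ y x yU xU z) (xL z)) => n;
  by apply: measurable_dotV; apply: measurable_rVB => //; exact: mZx.
Qed.

End completeness.

(** * Integrable cumulants *)

Lemma Rintegral_vanishing dT (T : measurableType dT) (R : realType)
    (mu : {measure set T -> \bar R}) (D : set T) (g : T -> R) (A : nat -> set T) :
  measurable D -> mu.-integrable D (EFin \o g) -> (forall n, measurable (A n)) ->
  (forall n, A n `<=` D) -> (forall x, D x -> \forall n \near \oo, ~ A n x) ->
  \int[mu]_(x in A n) g x @[n --> \oo] --> 0.
Proof.
move=> mD ig mA AD A0.
have mg : measurable_fun D (EFin \o g) by exact: measurable_int ig.
have [|||||] := @dominated_convergence _ _ _ mu D mD
    (fun n => (EFin \o g) \_ (A n)) (cst 0%E) (fun x => `|(EFin \o g) x|%E).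
- move=> n; apply/(measurable_restrict _ (mA n) mD).
  by apply: measurable_funS mg => //; exact: subIsetl.
- exact: measurable_cst.
- apply: aeW => x Dx; apply: cvg_near_cst.
  by apply: filterS (A0 x Dx) => n nA; rewrite patchE memNset.
- exact: integrable_abse.
- by apply: aeW => x n Dx; rewrite patchE; case: ifP => // _; rewrite abse0 abse_ge0.
move=> _ _; rewrite integral0 => h.
rewrite (_ : (fun n => \int[mu]_(x in A n) g x) =
   fun n => fine (\int[mu]_(x in D) ((EFin \o g) \_ (A n)) x)%E); last first.
  apply/funext => n; rewrite /Rintegral; congr fine.
  by rewrite -integral_mkcondr setIidr.
exact: fine_cvg h.
Qed.

Section integral_additivity.
Context dT (T : measurableType dT) (R : realType) (d : nat) (P : probability T R).
Context (a b : \bar R) (S : set R -> T -> 'rV[R]_d) (f : R -> R).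
Hypothesis hS : scattered P S.
Variable J : set R -> T -> 'rV[R]_d.
Hypothesis iJ : is_integral P a b S f J.

Let mS : forall B, bounded_Borel B -> measurable_fun setT (S B) := sp_measurable hS.

Lemma simple_integralU (phi : simple_fun a b) z A B :
  bounded_Borel A -> bounded_Borel B -> A `&` B = set0 ->
  {ae P, forall w, dotV z (simple_integral S phi (A `|` B) w) =
     dotV z (simple_integral S phi A w) + dotV z (simple_integral S phi B w)}.
Proof.
move=> bA bB AB.
have h : forall j, {ae P, forall w, dotV z (S ((A `|` B) `&` sf_piece j) w) =
    dotV z (S (A `&` sf_piece (s := phi) j) w) + dotV z (S (B `&` sf_piece j) w)}.
  move=> j; rewrite setIUl; apply: scattered_dotVU => //.
  - by rewrite setIC; apply: bounded_BorelI => //; exact: measurable_piece.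
  - by rewrite setIC; apply: bounded_BorelI => //; exact: measurable_piece.
  - by rewrite setIACA AB set0I.
apply: filterS (filter_forall _ h) => w E.
rewrite /simple_integral !dotV_sum -big_split/=; apply: eq_bigr => j _.
by rewrite !dotVZ E mulrDr.
Qed.

Lemma integral_additive A B : inner_Borel a b (A `|` B) -> measurable A -> measurable B ->
  A `&` B = set0 -> {ae P, forall w, J (A `|` B) w = J A w + J B w}.
Proof.
move=> iAB mA mB AB.
have iA : inner_Borel a b A by apply: inner_subset iAB => //; exact: subsetUl.
have iB : inner_Borel a b B by apply: inner_subset iAB => //; exact: subsetUr.
have [mJAB mJA mJB] := And3 (integral_measurable iJ iAB) (integral_measurable iJ iA)
  (integral_measurable iJ iB).
have [phi [_ hJ]] := iJ.
pose I n C w := simple_integral S (phi n) C w.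
have mI n C : inner_Borel a b C -> measurable_fun setT (I n C).
  by move=> iC; apply: measurable_simple_integral => //; exact: inner_bounded iC.
have cI C : inner_Borel a b C -> forall z, tau P (fun w => dotV z (I n C w - J C w)) @[n --> \oo] --> 0.
  move=> iC; apply: (@cvg_in_probability_tau_seq _ _ _ _ P (fun n => I n C) (J C) _ _).1.
  - by move=> n; exact: mI.
  - exact: (integral_measurable iJ).
  - exact: hJ.
have mD : measurable_fun setT (fun w => J (A `|` B) w - (J A w + J B w)).
  by apply: measurable_rVB => //; exact: measurable_rVD.
have mE n C z : inner_Borel a b C -> measurable_fun setT (fun w => dotV z (I n C w - J C w)).
  move=> iC; apply: measurable_dotV; apply: measurable_rVB; first exact: mI.
  exact: (integral_measurable iJ).
have : {ae P, forall w, J (A `|` B) w - (J A w + J B w) = 0}.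
  apply: tau_dotV0_ae => // z.
  have h1 := @tau_cvg0_lin _ _ _ P _ _ 1 (fun n => mE n _ z iA) (fun n => mE n _ z iB)
    (cI A iA z) (cI B iB z).
  have mAB n : measurable_fun setT
      (fun w => dotV z (I n A w - J A w) + 1 * dotV z (I n B w - J B w)).
    by apply: measurable_funD; [exact: mE|apply: measurable_funM => //; exact: mE].
  have h2 := @tau_cvg0_lin _ _ _ P _ _ (-1) mAB (fun n => mE n _ z iAB) h1 (cI _ iAB z).
  have : tau P (fun w => dotV z (J (A `|` B) w - (J A w + J B w))) @[n --> \oo] --> 0.
    apply: cvg_trans h2; apply: near_eq_cvg; apply: nearW => n; apply: tau_ae.
    - apply: measurable_funD; first exact: mAB.
      by apply: measurable_funM => //; exact: mE.
    - exact: measurable_dotV.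
    - apply: filterS (simple_integralU (phi n) z (inner_bounded iA) (inner_bounded iB) AB) => w.
      rewrite /I !dotVB dotVD => ->; ring.
  by move=> /(cvg_unique _ (cvg_cst _)) <-.
by apply: filterS => w /eqP; rewrite subr_eq0 => /eqP.
Qed.

(** The common part of the two sets cancels. *)
Lemma integral_sub A B : inner_Borel a b A -> inner_Borel a b B ->
  {ae P, forall w, J A w - J B w = J (A `\` B) w - J (B `\` A) w}.
Proof.
move=> iA iB; have [mA _ _ _] := iA; have [mB _ _ _] := iB.
have H C D : inner_Borel a b C -> measurable D ->
    {ae P, forall w, J C w = J (C `\` D) w + J (C `&` D) w}.
  move=> iC mD; have [mC _ _ _] := iC.
  have := @integral_additive (C `\` D) (C `&` D); rewrite setUC setUIDK; apply => //.
  - exact: measurableD.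
  - exact: measurableI.
  - by apply/seteqP; split => x // -[[_ nD] [_ Dx]].
have hA := H A B iA mB; have hB := H B A iB mA.
apply: filterS2 hA hB => w -> ->; rewrite (setIC B A) opprD addrACA subrr addr0.
by [].
Qed.

End integral_additivity.

Section integrable_cumulant.
Context dT (T : measurableType dT) (R : realType) (d : nat) (P : probability T R).
Context (a b : \bar R) (f : R -> R) (mu : probability 'rV[R]_d R) (C : 'rV[R]_d -> R[i]).
Local Notation leb := (@lebesgue_measure R).
Hypothesis ab : (a < b)%E.
Hypothesis mf : measurable_fun (ereal_ooitv a b) f.
Hypothesis muC : is_cumulant mu C.
Hypothesis Cf : forall z, (\int[leb]_(s in ereal_ooitv a b) (Normc.normc (C (f s *: z)))%:E < +oo)%E.

Let mReC z : measurable_fun (ereal_ooitv a b) (fun s => complex.Re (C (f s *: z))).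
Proof.
have [cRe _ _ _] := muC.
have c : continuous (fun r : R => complex.Re (C (r *: z))).
  move=> r; have h : (fun t : R => t *: z) @ r --> r *: z by apply: cvgZl; exact: cvg_id.
  exact: cvg_comp h (cRe _).
exact: (measurableT_comp (continuous_measurable_fun c) mf).
Qed.

Let mImC z : measurable_fun (ereal_ooitv a b) (fun s => complex.Im (C (f s *: z))).
Proof.
have [_ cIm _ _] := muC.
have c : continuous (fun r : R => complex.Im (C (r *: z))).
  move=> r; have h : (fun t : R => t *: z) @ r --> r *: z by apply: cvgZl; exact: cvg_id.
  exact: cvg_comp h (cIm _).
exact: (measurableT_comp (continuous_measurable_fun c) mf).
Qed.

Let integrable_part (g : R -> R) z : measurable_fun (ereal_ooitv a b) g ->
  (forall s, `|g s| <= Normc.normc (C (f s *: z))) ->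
  leb.-integrable (ereal_ooitv a b) (EFin \o g).
Proof.
move=> mg gC; apply/integrableP; split; first exact/measurable_EFinP.
apply: le_lt_trans (Cf z); apply: ge0_le_integral => //.
- exact: measurable_ereal_ooitv.
- by apply/measurable_EFinP; exact: measurableT_comp.
- apply/measurable_EFinP.
  rewrite (_ : (fun s => _) = fun s => Num.sqrt (complex.Re (C (f s *: z)) ^+ 2 +
     complex.Im (C (f s *: z)) ^+ 2)); last by apply/funext => s; case: (C _).
  apply: measurableT_comp; first exact: (continuous_measurable_fun (@sqrt_continuous R)).
  by apply: measurable_funD; apply: measurable_funX; [exact: mReC|exact: mImC].
- by move=> s _; rewrite /= lee_fin; exact: gC.
Qed.

(** The integrals over two large intervals differ by integrals over sets that
    escape every point of (a, b). Their cumulants, integrals of [C (f s *: z)]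
    over these sets, tend to 0 by dominated convergence. *)
Lemma integrable_cumulant_cvg X J : random_measure P mu X -> is_integral P a b X f J ->
  exists L, cvg_in_probability P (improper_filter a b) (fun pq => J `]pq.1, pq.2]%classic) L.
Proof.
move=> rX iJ; have sX := random_measure_scattered rX.
have [U [bU Ui Us U0]] := improper_filter_base ab.
have FF := improper_filter_proper ab.
apply: (cvg_in_probability_complete (@filter_filter _ _ FF) bU U0).
  by move=> pq Upq; apply: (integral_measurable iJ); exact: Ui Upq.
move=> x y xU yU z.
have normRe (u : R[i]) : `|complex.Re u| <= Normc.normc u.
  case: u => u v /=; rewrite -sqrtr_sqr ler_sqrt ?addr_ge0 ?sqr_ge0//.
  by rewrite lerDl sqr_ge0.
have normIm (u : R[i]) : `|complex.Im u| <= Normc.normc u.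
  case: u => u v /=; rewrite -sqrtr_sqr ler_sqrt ?addr_ge0 ?sqr_ge0//.
  by rewrite lerDr sqr_ge0.
have small (u v : nat -> R * R) : (forall n, U n (u n)) -> (forall n, U n (v n)) ->
    tau P (fun w => dotV z (J (`](u n).1, (u n).2]%classic `\` `](v n).1, (v n).2]%classic) w))
      @[n --> \oo] --> 0.
  move=> uU vU; pose A n : set R := `](u n).1, (u n).2]%classic `\` `](v n).1, (v n).2]%classic.
  have iA n : inner_Borel a b (A n).
    apply: inner_subset (Ui _ _ (uU n)); last exact: subDsetl.
    by apply: measurableD; exact: measurable_itv.
  have A0 s : ereal_ooitv a b s -> \forall n \near \oo, ~ A n s.
    by move=> /Us/(_ v vU); apply: filterS => n vs [].
  apply: (tau_cvg_cos (Z := fun n w => dotV z (J (A n) w))) => [n|t].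
    by apply: measurable_dotV; exact: (integral_measurable iJ).
  have iRe := integrable_part (mReC (t *: z)) (fun s => normRe _).
  have iIm := integrable_part (mImC (t *: z)) (fun s => normIm _).
  have mab := measurable_ereal_ooitv a b.
  have mA n : measurable (A n) by have [] := iA n.
  have Aab n : A n `<=` ereal_ooitv a b by have [] := iA n.
  have E n : chf P (fun w => t * dotV z (J (A n) w)) =
      expC (cintegral (A n) (fun s => C (f s *: (t *: z)))).
    under eq_fun do rewrite -dotVZl.
    apply: (integral_chf (sp_measurable sX)
      (random_measure_cumulant_process (t *: z) rX muC) mf iJ (iA n)).
      by apply: (integrableS _ _ _ iRe); [exact: mab|exact: mA|exact: Aab].
    by apply: (integrableS _ _ _ iIm); [exact: mab|exact: mA|exact: Aab].
  have [h _] : ccvg \oo (fun n => chf P (fun w => t * dotV z (J (A n) w))) (expC 0).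
    under eq_fun do rewrite E.
    apply: ccvg_expC; split; first exact: Rintegral_vanishing iRe mA Aab A0.
    exact: Rintegral_vanishing iIm mA Aab A0.
  by move: h; rewrite expC0.
have mz A : inner_Borel a b A -> measurable_fun setT (fun w => dotV z (J A w)).
  by move=> iA; apply: measurable_dotV; exact: (integral_measurable iJ).
have iD (u v : nat -> R * R) n : (forall n, U n (u n)) -> (forall n, U n (v n)) ->
    inner_Borel a b (`](u n).1, (u n).2]%classic `\` `](v n).1, (v n).2]%classic).
  move=> uU vU; apply: inner_subset (Ui _ _ (uU n)); last exact: subDsetl.
  by apply: measurableD; exact: measurable_itv.
have := @tau_cvg0_lin _ _ _ P _ _ (-1) (fun n => mz _ (iD x y n xU yU))
  (fun n => mz _ (iD y x n yU xU)) (small x y xU yU) (small y x yU xU).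
apply: cvg_trans; apply: near_eq_cvg; apply: nearW => n; apply: tau_ae.
- apply: measurable_funD; first exact: mz (iD _ _ _ _ _).
  by apply: measurable_funM => //; exact: mz (iD _ _ _ _ _).
- apply: measurable_dotV; apply: measurable_rVB.
    exact: (integral_measurable iJ (Ui _ _ (xU n))).
  exact: (integral_measurable iJ (Ui _ _ (yU n))).
- apply: filterS (integral_sub sX iJ (Ui _ _ (xU n)) (Ui _ _ (yU n))) => w E.
  by rewrite E dotVB mulN1r.
Qed.

End integrable_cumulant.

(** * Two independent copies on the product space *)

Lemma set_shiftE (R : realType) (t : R) (B : set R) :
  [set s + t | s in B] = (fun x => x - t) @^-1` B.
Proof.
apply/seteqP; split => x /=; first by move=> [y By <-]; rewrite addrK.
by move=> Bx; exists (x - t) => //; rewrite subrK.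
Qed.

Lemma bounded_Borel_shift (R : realType) (t : R) (B : set R) : bounded_Borel B ->
  bounded_Borel [set s + t | s in B].
Proof.
move=> [mB [M [Mr hM]]]; split.
  rewrite set_shiftE -[X in measurable X]setTI.
  have ms : measurable_fun setT (fun x : R => x - t) by exact: measurable_funB.
  exact: ms.
exists (M + 1 + `|t|); split; first by rewrite num_real.
move=> x Mx _ [y By <-] /=; rewrite (le_trans (ler_normD _ _))// (le_trans _ (ltW Mx))//.
by rewrite lerD2r; apply: hM By; rewrite ltrDl.
Qed.

Section pullback.
Context dT (T : measurableType dT) dT' (T' : measurableType dT') (R : realType).
Variables (P : probability T R) (P' : probability T' R) (pr : T' -> T).
Hypothesis mpr : measurable_fun setT pr.
Hypothesis prP : forall E, measurable E -> P' (pr @^-1` E) = P E.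

Lemma pull_ae (Q : T -> Prop) : {ae P, forall w, Q w} -> {ae P', forall w, Q (pr w)}.
Proof.
move=> [N [mN N0 QN]]; exists (pr @^-1` N); split.
- by rewrite -[X in measurable X]setTI; exact: mpr.
- by rewrite prP.
- by move=> w /= nQ; exact: QN.
Qed.

Lemma pull_Rintegral (Z : T -> R) (M : R) : measurable_fun setT Z ->
  (forall w, `|Z w| <= M) -> \int[P']_w Z (pr w) = \int[P]_w Z w.
Proof.
move=> mZ ZM; pose Xp : {mfun T' >-> T} := mfun_Sub (mem_set mpr).
have mg : measurable_fun setT (EFin \o Z) by exact/measurable_EFinP.
rewrite /Rintegral; congr fine.
rewrite -(@integral_distribution _ _ _ _ _ P' Xp (EFin \o Z))//; last first.
  apply: (@integrable_bounded _ _ _ P' M (fun w => Z (pr w))) => //.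
  exact: measurableT_comp mZ mpr.
by apply: eq_measure_integral => A mA _; exact: prP.
Qed.

Lemma pull_chf (Z : T -> R) : measurable_fun setT Z ->
  chf P' (fun w => Z (pr w)) = chf P Z.
Proof.
move=> mZ; congr Complex.
  apply: (@pull_Rintegral (fun w => cos (Z w)) 1) => [|w]; last exact: cos_max.
  exact: measurableT_comp (continuous_measurable_fun (@continuous_cos R)) mZ.
apply: (@pull_Rintegral (fun w => sin (Z w)) 1) => [|w]; last exact: sin_max.
exact: measurableT_comp (continuous_measurable_fun (@continuous_sin R)) mZ.
Qed.

Context (d : nat).
Implicit Types (X : set R -> T -> 'rV[R]_d).

Lemma pull_random_measure (mu : probability 'rV[R]_d R) X : random_measure P mu X ->
  random_measure P' mu (fun B w => X B (pr w)).
Proof.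
move=> rX; have prP' (Y : T -> 'rV[R]_d) A : measurable_fun setT Y -> measurable A ->
    P' ((fun w => Y (pr w)) @^-1` A) = P (Y @^-1` A).
  move=> mY mA; rewrite -prP//; by rewrite -[X in measurable X]setTI; exact: mY.
split.
- by move=> B bB; apply: measurableT_comp => //; exact: (rm_measurable rX).
- by move=> B bB tB bU; apply: pull_ae (rm_sigma_additive rX bB tB bU).
- move=> n B A bB tB mA.
  have mX (i : 'I_n) := rm_measurable rX (bB i).
  under eq_bigr do rewrite prP'//.
  rewrite -(rm_independent rX bB tB mA) -prP//.
  by apply: (cylinders_measurable mX); exists A.
- by move=> t; exact: (pull_ae (rm_atomless rX t)).
- move=> t B A bB mA; have bBt := bounded_Borel_shift t bB.
  by rewrite !prP'//; [exact: (rm_homogeneous rX)|exact: (rm_measurable rX)|exact: (rm_measurable rX)].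
- move=> t A mA; rewrite prP'//; first exact: (rm_law rX).
  exact: (rm_measurable rX (bounded_Borel_itv _ _)).
Qed.

Lemma pull_cvg_in_probability (Z : nat -> T -> 'rV[R]_d) L :
  (forall n, measurable_fun setT (Z n)) -> cvg_in_probability P \oo Z L ->
  cvg_in_probability P' \oo (fun n w => Z n (pr w)) (fun w => L (pr w)).
Proof.
move=> mZ [mL h]; split; first exact: measurableT_comp.
move=> e e0; rewrite (_ : (fun n => _) = fun n => P [set w | e <= `|Z n w - L w|]); first exact: h.
apply/funext => n; rewrite -prP//; apply: measurable_norm_tail => //.
exact: measurable_rVB.
Qed.

End pullback.

Section two_copies.
Context dT (T : measurableType dT) (R : realType) (P : probability T R).
Local Notation PP := (P \x P)%E.

Lemma fst_law E : measurable E -> PP (fst @^-1` E) = P E.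
Proof.
move=> mE; rewrite (_ : fst @^-1` E = E `*` setT); last first.
  by apply/seteqP; split => w // [].
by rewrite [LHS]product_measure1E// [X in (_ * X)%E](@probability_setT _ _ _ P) mule1.
Qed.

Lemma snd_law E : measurable E -> PP (snd @^-1` E) = P E.
Proof.
move=> mE; rewrite (_ : snd @^-1` E = setT `*` E); last first.
  by apply/seteqP; split => w // [].
by rewrite [LHS]product_measure1E// [X in (X * _)%E](@probability_setT _ _ _ P) mul1e.
Qed.

(** By Fubini's theorem the average over [w1] of the left-hand side is the right-hand side. *)
Lemma tau_section_le (Z : T * T -> R) : measurable_fun setT Z ->
  exists w1, tau P (fun w2 => Z (w1, w2)) <= tau PP Z.
Proof.
move=> mZ; apply: contrapT => nle.
have lt w1 : tau PP Z < tau P (fun w2 => Z (w1, w2)).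
  by rewrite ltNge; apply/negP => h; apply: nle; exists w1.
pose h (w : T * T) : \bar R := (Num.min 1 `|Z w|)%:E.
have mh : measurable_fun setT h by apply/measurable_EFinP; exact: measurable_trunc.
have h0 w : (0 <= h w)%E by rewrite lee_fin le_min ler01 normr_ge0.
have mZ1 w1 : measurable_fun setT (fun w2 => Z (w1, w2)) by exact: measurableT_comp mZ _.
have hE w1 : (\int[P]_w2 h (w1, w2) = (tau P (fun w2 => Z (w1, w2)))%:E)%E.
  by rewrite /tau /Rintegral fineK//; exact: integrable_fin_num (integrable_trunc P (mZ1 w1)).
have E : (\int[PP]_w h w = \int[P]_w1 (tau P (fun w2 => Z (w1, w2)))%:E)%E.
  by rewrite fubini_tonelli1//; apply: eq_integral => w1 _; exact: hE.
have EZ : (\int[PP]_w h w = (tau PP Z)%:E)%E.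
  by rewrite /tau /Rintegral fineK//; exact: integrable_fin_num (integrable_trunc PP mZ).
have mtau : measurable_fun setT (fun w1 => tau P (fun w2 => Z (w1, w2))).
  apply/measurable_EFinP; apply: (eq_measurable_fun (fubini_F P h)).
    by move=> w1 _; rewrite /fubini_F hE.
  exact: measurable_fun_fubini_tonelli_F.
have tau1 w1 : tau P (fun w2 => Z (w1, w2)) <= 1.
  rewrite -[leRHS](Rintegral_prob_cst P); apply: le_Rintegral => //.
  - exact: integrable_trunc.
  - by apply: (@integrable_bounded _ _ _ P 1) => // w; rewrite normr1.
have itau : P.-integrable setT (EFin \o (fun w1 => tau P (fun w2 => Z (w1, w2)))).
  by apply: (@integrable_bounded _ _ _ P 1) => // w; rewrite ger0_norm ?tau_ge0.
have icst : P.-integrable setT (EFin \o (fun _ : T => tau PP Z)).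
  by apply: (@integrable_bounded _ _ _ P `|tau PP Z|).
have z0 : \int[P]_w1 (tau P (fun w2 => Z (w1, w2)) - tau PP Z) = 0.
  rewrite RintegralB// Rintegral_prob_cst.
  by rewrite {1}/Rintegral -E EZ /= subrr.
have mB : measurable_fun setT (fun w1 => tau P (fun w2 => Z (w1, w2)) - tau PP Z).
  exact: measurable_funB.
have : tau P (fun w1 => tau P (fun w2 => Z (w1, w2)) - tau PP Z) = 0.
  apply/eqP; rewrite eq_le tau_ge0 andbT -z0; apply: le_Rintegral => //.
  - exact: integrable_trunc.
  - exact: integrable_fun_sub.
  - move=> w1 _; have z1 : 0 <= tau P (fun w2 => Z (w1, w2)) - tau PP Z.
      by rewrite subr_ge0 ltW.
    by rewrite (ger0_norm z1) ge_min lexx orbT.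
move=> /(tau0_ae mB) [N [mN N0 hN]].
have : P setT = 0%E.
  apply/eqP; rewrite -measure_le0 -N0; apply: le_measure; rewrite ?inE// => w _.
  by apply: hN => /= /eqP; rewrite subr_eq0 gt_eqF.
by rewrite probability_setT => /eqP; rewrite onee_eq0.
Qed.

(** A random variable that is close to an independent copy is close to a constant,
    namely to one of the values of this copy. *)
Lemma tau_sub_cst (U : T -> R) : measurable_fun setT U ->
  exists r, tau P (fun w => U w - r) <= tau PP (fun w => U w.1 - U w.2).
Proof.
move=> mU; have mD : measurable_fun setT (fun w : T * T => U w.1 - U w.2).
  by apply: measurable_funB; [exact: measurableT_comp mU measurable_fst|
    exact: measurableT_comp mU measurable_snd].
have [w1 h] := tau_section_le mD; exists (U w1).
rewrite (le_trans _ h)//; apply: tau_le.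
- exact: measurable_funB.
- by rewrite /=; exact: measurable_funB.
- by move=> w /=; rewrite distrC.
Qed.

Lemma ae_section (Q : T * T -> Prop) : {ae PP, forall w, Q w} ->
  exists w1, {ae P, forall w2, Q (w1, w2)}.
Proof.
move=> [N [mN N0 QN]].
have mI : measurable_fun setT (\1_N : T * T -> R) by exact: measurable_indic.
have [w1 h] := tau_section_le mI; exists w1.
have t0 : tau PP (\1_N : T * T -> R) = 0.
  rewrite /tau /Rintegral (_ : (fun w => _) = fun w => (\1_N w)%:E).
    by rewrite integral_indic// setIT [X in fine X]N0.
  apply/funext => w; rewrite indicE; case: (_ \in _) => /=.
    by rewrite normr1 minxx.
  by rewrite normr0 (min_idPr ler01).
have mI1 : measurable_fun setT (fun w2 => \1_N (w1, w2) : R) by exact: measurableT_comp mI _.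
have : tau P (fun w2 => \1_N (w1, w2) : R) = 0.
  by apply/eqP; rewrite eq_le tau_ge0 andbT -[leRHS]t0.
move=> /(tau0_ae mI1); apply: filterS => w2; rewrite indicE => h0.
apply: contrapT => /QN Nw; move: h0; rewrite mem_set//= => /eqP.
by rewrite oner_eq0.
Qed.

(** On a subsequence the convergence is almost sure; then for some fixed [w1] and
    almost every [w], [U n w - U n w1] tends to [- L (w1, w)], which therefore
    can serve as [Ls w]. *)
Lemma symmetrized_limit (U : nat -> T -> R) (L : T * T -> R) :
  (forall n, measurable_fun setT (U n)) -> measurable_fun setT L ->
  tau PP (fun w => U n w.1 - U n w.2 - L w) @[n --> \oo] --> 0 ->
  exists Ls : T -> R, measurable_fun setT Ls /\
    {ae PP, forall w, L w = Ls w.1 - Ls w.2}.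
Proof.
move=> mU mL cU.
have mUL n : measurable_fun setT (fun w : T * T => U n w.1 - U n w.2 - L w).
  apply: measurable_funB => //; apply: measurable_funB;
    [exact: measurableT_comp (mU n) measurable_fst|
     exact: measurableT_comp (mU n) measurable_snd].
have [u [_ hu]] := tau_subseq_ae mUL cU.
have [w0 hw0] := ae_section hu.
pose Ls w := - L (w0, w); exists Ls.
have mLs : measurable_fun setT Ls by apply: measurableT_comp => //; exact: measurableT_comp mL _.
split => //.
have hLs : {ae P, forall w, U (u k) w - U (u k) w0 @[k --> \oo] --> Ls w}.
  apply: filterS hw0 => w /= h.
  have -> : (fun k => U (u k) w - U (u k) w0) =
      fun k => - (U (u k) w0 - U (u k) w - L (w0, w)) + Ls w.
    by apply/funext => k; rewrite /Ls; ring.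
  by rewrite -[X in _ --> X]add0r -oppr0; apply: cvgD; [exact: cvgN|exact: cvg_cst].
have h1 := pull_ae measurable_fst fst_law hLs.
have h2 := pull_ae measurable_snd snd_law hLs.
apply: filterS3 hu h1 h2 => w h h1w h2w.
have h3 : U (u k) w.1 - U (u k) w.2 @[k --> \oo] --> L w.
  have -> : (fun k => U (u k) w.1 - U (u k) w.2) =
      fun k => (U (u k) w.1 - U (u k) w.2 - L w) + L w.
    by apply/funext => k; rewrite subrK.
  by rewrite -[X in _ --> X]add0r; apply: cvgD => //; exact: cvg_cst.
have h4 : U (u k) w.1 - U (u k) w.2 @[k --> \oo] --> Ls w.1 - Ls w.2.
  have -> : (fun k => U (u k) w.1 - U (u k) w.2) =
      fun k => (U (u k) w.1 - U (u k) w0) - (U (u k) w.2 - U (u k) w0).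
    by apply/funext => k; ring.
  exact: cvgB.
exact: cvg_unique h3 h4.
Qed.

Context (d : nat) (mu : probability 'rV[R]_d R).
Implicit Types (X : set R -> T -> 'rV[R]_d).

Lemma independent_copies X : random_measure P mu X ->
  [/\ random_measure PP mu (fun B w => X B w.1),
      random_measure PP mu (fun B w => X B w.2)
    & independent_measures PP (fun B w => X B w.1) (fun B w => X B w.2)].
Proof.
move=> rX; split.
- exact: (pull_random_measure measurable_fst fst_law rX).
- exact: (pull_random_measure measurable_snd snd_law rX).
- move=> m n B B' A A' bB bB' mA mA'.
  have mE : measurable [set w | forall i, A i (X (B i) w)].
    apply: (cylinders_measurable (U := fun i => X (B i))); last by exists A.
    by move=> i; exact: (rm_measurable rX).
  have mE' : measurable [set w | forall j, A' j (X (B' j) w)].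
    apply: (cylinders_measurable (U := fun j => X (B' j))); last by exists A'.
    by move=> j; exact: (rm_measurable rX).
  have := product_measure1E P P mE mE' => h.
  transitivity (PP ([set w | forall i, A i (X (B i) w)] `*` [set w | forall j, A' j (X (B' j) w)])).
    by [].
  by rewrite h; congr (_ * _)%E; [exact: esym (fst_law mE)|exact: esym (snd_law mE')].
Qed.

Lemma symmetrized_integral a b f X J : random_measure P mu X -> is_integral P a b X f J ->
  is_integral PP a b (fun B w => X B w.1 - X B w.2) f (fun B w => J B w.1 - J B w.2).
Proof.
move=> rX [phi [phif hJ]]; exists phi; split => // B iB.
have mI n : measurable_fun setT (simple_integral X (phi n) B).
  by apply: measurable_simple_integral; [exact: (rm_measurable rX)|exact: inner_bounded iB].
have mJ := (hJ B iB).1.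
have h1 := pull_cvg_in_probability measurable_fst fst_law mI (hJ B iB).
have h2 := pull_cvg_in_probability measurable_snd snd_law mI (hJ B iB).
have m1 n : measurable_fun setT (fun w : T * T => simple_integral X (phi n) B w.1).
  exact: measurableT_comp (mI n) measurable_fst.
have m2 n : measurable_fun setT (fun w : T * T => simple_integral X (phi n) B w.2).
  exact: measurableT_comp (mI n) measurable_snd.
have n1 : measurable_fun setT (fun w : T * T => J B w.1) by exact: measurableT_comp mJ measurable_fst.
have n2 : measurable_fun setT (fun w : T * T => J B w.2) by exact: measurableT_comp mJ measurable_snd.
have -> : (fun n => simple_integral (fun B w => X B w.1 - X B w.2) (phi n) B) =
    fun n (w : T * T) => simple_integral X (phi n) B w.1 - simple_integral X (phi n) B w.2.
  apply/funext => n; apply/funext => w; rewrite /simple_integral -sumrB.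
  by apply: eq_bigr => j _; rewrite scalerBr.
apply: (@cvg_in_probability_tau_seq _ _ _ _ PP _ _ _ _).2.
- by move=> n; exact: measurable_rVB.
- exact: measurable_rVB.
move=> z.
have c1 := (@cvg_in_probability_tau_seq _ _ _ _ PP _ _ m1 n1).1 h1 z.
have c2 := (@cvg_in_probability_tau_seq _ _ _ _ PP _ _ m2 n2).1 h2 z.
have := @tau_cvg0_lin _ _ _ _ _ _ (-1)
  (fun n => measurable_dotV z (measurable_rVB (m1 n) n1))
  (fun n => measurable_dotV z (measurable_rVB (m2 n) n2)) c1 c2.
apply: cvg_trans; apply: near_eq_cvg; apply: nearW => n; congr tau.
by apply/funext => w; rewrite !dotVB; ring.
Qed.

End two_copies.

(** * Symmetrization of integrals *)

Section symmetrization.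
Context (R : realType) (d : nat) (mu : probability 'rV[R]_d R).
Implicit Types (l : seq (R * set R)) (z : 'rV[R]_d).

Lemma bounded_cells_support l : bounded_cells l ->
  exists K, bounded_Borel K /\ restrict_cells K l = l.
Proof.
elim: l => [_|p l ih /bounded_cells_cons[bp /ih[K [bK Kl]]]].
  by exists set0; split => //; exact: bounded_Borel0.
exists (p.2 `|` K); split; first exact: bounded_BorelU.
have -> : restrict_cells (p.2 `|` K) (p :: l) =
    (p.1, (p.2 `|` K) `&` p.2) :: restrict_cells (p.2 `|` K) l by [].
congr cons; first by rewrite setIidr//; case: p {ih bp}.
rewrite -[in RHS]Kl -[in LHS]Kl /restrict_cells -map_comp; apply: eq_map => q /=.
by rewrite setIA (setIidr (@subsetUr _ p.2 K)).
Qed.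

(** By [lincomb_chf], the left-hand side depends on [mu] only, through
    [sym_cumulant]; it is computed with two copies of [X] on the product space. *)
Lemma lincomb_sub_normc dT (T : measurableType dT) (P : probability T R) X Y z l :
  random_measure P mu X -> random_measure P mu Y -> independent_measures P X Y ->
  bounded_cells l ->
  chf P (lincomb (fun B w => dotV z (X B w - Y B w)) l) =
  chf P (lincomb (fun B w => dotV z (X B w)) l) *
  (chf P (lincomb (fun B w => dotV z (X B w)) l))^*%C.
Proof.
move=> rX rY XY bl; have [K [bK Kl]] := bounded_cells_support bl.
have [r1 r2 i12] := independent_copies rX.
have s := sym_cumulant_process z rX rY XY.
have s12 := sym_cumulant_process z r1 r2 i12.
have := lincomb_chf s bK bl; rewrite -(lincomb_chf s12 bK bl) Kl => ->.
rewrite (lincomb_sub_chf z r1 r2 i12 bl).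
have mX : measurable_fun setT (lincomb (fun B w => dotV z (X B w)) l).
  by apply: measurable_lincomb => // B bB; apply: measurable_dotV; exact: (rm_measurable rX).
by congr (_ * _^*%C); [exact: (pull_chf measurable_fst (fst_law P) mX)|
  exact: (pull_chf measurable_snd (snd_law P) mX)].
Qed.

End symmetrization.

Section difference_of_integrals.
Context dT (T : measurableType dT) (R : realType) (d : nat) (P : probability T R).
Context (a b : \bar R) (S : set R -> T -> 'rV[R]_d).
Hypothesis mS : forall B, bounded_Borel B -> measurable_fun setT (S B).
Implicit Types (phi : nat -> simple_fun a b) (J : set R -> T -> 'rV[R]_d).

Definition difference_cells (phi psi : simple_fun a b) A B :=
  simple_cells phi A ++ opp_cells (simple_cells psi B).

Lemma bounded_difference_cells (phi psi : simple_fun a b) A B :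
  inner_Borel a b A -> inner_Borel a b B -> bounded_cells (difference_cells phi psi A B).
Proof.
move=> iA iB; apply: bounded_cells_cat.
  exact: bounded_simple_cells (inner_bounded iA).
by apply: bounded_cells_opp; exact: bounded_simple_cells (inner_bounded iB).
Qed.

Lemma lincomb_difference (phi psi : simple_fun a b) A B z w :
  lincomb (fun B w => dotV z (S B w)) (difference_cells phi psi A B) w =
  dotV z (simple_integral S phi A w - simple_integral S psi B w).
Proof. by rewrite lincomb_cat lincomb_opp dotVB !dotV_simple_integral. Qed.

Lemma difference_chf_cvg phi J A B z : inner_Borel a b A -> inner_Borel a b B ->
  cvg_in_probability P \oo (fun n => simple_integral S (phi n) A) (J A) ->
  cvg_in_probability P \oo (fun n => simple_integral S (phi n) B) (J B) ->
  ccvg \oo (fun n => chf P (lincomb (fun B w => dotV z (S B w))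
      (difference_cells (phi n) (phi n) A B)))
    (chf P (fun w => dotV z (J A w - J B w))).
Proof.
move=> iA iB hA hB; have [mJA _] := hA; have [mJB _] := hB.
have mI n C : inner_Borel a b C -> measurable_fun setT (simple_integral S (phi n) C).
  by move=> iC; apply: measurable_simple_integral => //; exact: inner_bounded iC.
apply: chf_cvg.
- move=> n; rewrite (_ : lincomb _ _ = fun w => dotV z (simple_integral S (phi n) A w -
      simple_integral S (phi n) B w)); last first.
    by apply/funext => w; rewrite lincomb_difference.
  by apply: measurable_dotV; apply: measurable_rVB; exact: mI.
- by apply: measurable_dotV; exact: measurable_rVB.
have cA := (@cvg_in_probability_tau_seq _ _ _ _ P _ _ (fun n => mI n A iA) mJA).1 hA z.
have cB := (@cvg_in_probability_tau_seq _ _ _ _ P _ _ (fun n => mI n B iB) mJB).1 hB z.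
have := @tau_cvg0_lin _ _ _ _ _ _ (-1)
  (fun n => measurable_dotV z (measurable_rVB (mI n A iA) mJA))
  (fun n => measurable_dotV z (measurable_rVB (mI n B iB) mJB)) cA cB.
apply: cvg_trans; apply: near_eq_cvg; apply: nearW => n; congr tau.
by apply/funext => w; rewrite lincomb_difference !dotVB; ring.
Qed.

End difference_of_integrals.

Lemma ccvg_conj (R : realType) (I : Type) (F : set_system I) (FF : Filter F)
    (u : I -> R[i]) l : ccvg F u l -> ccvg F (fun i => (u i)^*%C) (l^*%C).
Proof.
have E (v : R[i]) : complex.Re (v^*%C) = complex.Re v /\ complex.Im (v^*%C) = - complex.Im v.
  by case: v.
move=> [hr hi]; split.
  by under eq_fun do rewrite (E _).1; rewrite (E _).1.
by under eq_fun do rewrite (E _).2; rewrite (E _).2; exact: cvgN.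
Qed.

(** Adding a constant multiplies the characteristic function by a number of
    modulus 1. *)
Lemma chf_shift_normc dT (T : measurableType dT) (R : realType) (P : probability T R)
    (Z : T -> R) r : measurable_fun setT Z ->
  chf P (fun w => Z w + r) * (chf P (fun w => Z w + r))^*%C = chf P Z * (chf P Z)^*%C.
Proof.
move=> mZ; rewrite (@chf_indep _ _ _ P Z (fun=> r))//; last first.
  move=> A B mA mB; have [rB|nrB] := pselect (B r).
    have -> : (fun _ : T => r) @^-1` B = setT by apply/seteqP; split.
    by rewrite setIT [X in (_ * X)%E](@probability_setT _ _ _ P) mule1.
  have -> : (fun _ : T => r) @^-1` B = set0 by apply/seteqP; split.
  by rewrite setI0 measure0 mule0.
have -> : chf P (fun=> r) = Complex (cos r) (sin r).
  by rewrite /chf !Rintegral_prob_cst.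
case: (chf P Z) => x y; apply/eqP; rewrite eq_complex/=.
have h := cos2Dsin2 r; apply/andP; split; apply/eqP; last by ring.
transitivity ((x ^+ 2 + y ^+ 2) * (cos r ^+ 2 + sin r ^+ 2)); first by ring.
by rewrite h; ring.
Qed.

Section symmetrized_definable.
Context dT (T : measurableType dT) (R : realType) (d : nat) (P : probability T R).
Context (a b : \bar R) (f : R -> R) (mu : probability 'rV[R]_d R).
Hypothesis ab : (a < b)%E.
Variables (X Y : set R -> T -> 'rV[R]_d).
Hypotheses (rX : random_measure P mu X) (rY : random_measure P mu Y).
Hypothesis XY : independent_measures P X Y.
Local Notation S := (fun B w => X B w - Y B w).

Let mX B : bounded_Borel B -> measurable_fun setT (X B).
Proof. exact: (rm_measurable rX). Qed.

Let mS B : bounded_Borel B -> measurable_fun setT (S B).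
Proof. by move=> bB; apply: measurable_rVB; [exact: (rm_measurable rX)|exact: (rm_measurable rY)]. Qed.

(** Along the step functions that define the integral with respect to [X], the
    integrals with respect to [X - Y] converge as well: their characteristic
    functions are squared moduli of those for [X]. *)
Lemma sub_integral phi J : 
  (forall B, inner_Borel a b B -> cvg_in_probability P \oo (fun n => simple_integral X (phi n) B) (J B)) ->
  exists JS, forall B, inner_Borel a b B ->
    cvg_in_probability P \oo (fun n => simple_integral S (phi n : simple_fun a b) B) (JS B).
Proof.
move=> hJ.
suff : forall B, exists L, inner_Borel a b B ->
    cvg_in_probability P \oo (fun n => simple_integral S (phi n) B) L.
  by move=> /choice[JS h]; exists JS.
move=> B; have [iB|niB] := pselect (inner_Borel a b B); last by exists (fun=> 0).
have mI n : measurable_fun setT (simple_integral X (phi n) B).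
  by apply: measurable_simple_integral => //; exact: inner_bounded iB.
have mIS n : measurable_fun setT (simple_integral S (phi n) B).
  by apply: measurable_simple_integral => //; exact: inner_bounded iB.
(* The tails form a countable base of the filter of indices. *)
pose U (n : nat) := [set k | (n <= k)%N].
have bU : countable_base \oo U.
  split.
  - by move=> n; exists n.
  - by move=> A [N _ NA]; exists N.
  - by move=> n k /=; exact: ltnW.
have U0 n : U n !=set0 by exists n; rewrite /U /=.
have FF : Filter \oo by apply: filter_filter.
have [L hL] : exists L, cvg_in_probability P \oo (fun n => simple_integral S (phi n) B) L.
  apply: (cvg_in_probability_complete FF bU U0) => [n _|x y xU yU z]; first exact: mIS.
  apply: (tau_cvg_cos (Z := fun n w => dotV z (simple_integral S (phi (x n)) B w -
     simple_integral S (phi (y n)) B w))) => [n|t].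
    by apply: measurable_dotV; exact: measurable_rVB.
  have := cvg_in_probability_cauchy FF bU (fun i _ => mI i) (hJ B iB) xU yU (t *: z).
  move=> h.
  have mD n : measurable_fun setT (fun w => dotV (t *: z) (simple_integral X (phi (x n)) B w -
     simple_integral X (phi (y n)) B w)).
    by apply: measurable_dotV; exact: measurable_rVB.
  have c1 : ccvg \oo (fun n => chf P (fun w => dotV (t *: z) (simple_integral X (phi (x n)) B w -
     simple_integral X (phi (y n)) B w))) 1.
    rewrite -(chf0 P); apply: chf_cvg => //.
    by under eq_fun do under [X in tau P X]eq_fun do rewrite subr0.
  have [c2 _] := ccvgM _ c1 (ccvg_conj _ c1).
  rewrite mul1r conjc1 /= in c2.
  apply: cvg_trans c2; apply: near_eq_cvg; apply: nearW => n.
  have := lincomb_sub_normc (t *: z) rX rY XY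
    (bounded_difference_cells (phi (x n)) (phi (y n)) iB iB).
  under [lincomb _ _]funext do rewrite lincomb_difference.
  rewrite [X in _ = X * X^*%C -> _](_ : _ = chf P (fun w => dotV (t *: z) (simple_integral X (phi (x n)) B w -
     simple_integral X (phi (y n)) B w))); last first.
    by congr chf; apply/funext => w; rewrite (lincomb_difference X).
  move=> /(congr1 (@complex.Re R)); rewrite /chf /= => <-.
  by apply: eq_Rintegral => w _; rewrite dotVZl.
by exists L.
Qed.

(** Adding a constant to the integrals with respect to [X] does not change the
    squared moduli of their characteristic functions, which are the characteristic
    functions of the integrals with respect to [X - Y]. *)
Lemma es_sym J g L : is_integral P a b X f J ->
  cvg_in_probability P (improper_filter a b)
    (fun pq w => J `]pq.1, pq.2]%classic w - g pq) L ->
  improper_definable P a b S f.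
Proof.
move=> [phi [phif hJ]] hL; have [JS hJS] := sub_integral hJ.
have iJ : is_integral P a b X f J by exists phi.
have iJS : is_integral P a b S f JS by exists phi.
have [U [bU Ui _ U0]] := improper_filter_base ab.
have FF : Filter (improper_filter a b) := @filter_filter _ _ (improper_filter_proper ab).
suff [LS hLS] : exists LS, cvg_in_probability P (improper_filter a b)
    (fun pq => JS `]pq.1, pq.2]%classic) LS by exists JS, LS.
have mJS pq : U 0%N pq -> measurable_fun setT (JS `]pq.1, pq.2]%classic).
  by move=> Upq; apply: (integral_measurable iJS); exact: Ui Upq.
have mJ pq : U 0%N pq -> measurable_fun setT (J `]pq.1, pq.2]%classic).
  by move=> Upq; apply: (integral_measurable iJ); exact: Ui Upq.
have mJg pq : U 0%N pq -> measurable_fun setT (fun w => J `]pq.1, pq.2]%classic w - g pq).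
  by move=> /mJ mm; apply: measurable_rVB => //; exact: measurable_cst.
apply: (cvg_in_probability_complete FF bU U0 mJS) => x y xU yU z.
have U0n (u : nat -> R * R) n : (forall n, U n (u n)) -> U 0%N (u n).
  by move=> uU; exact: base_decreasing bU (leq0n n) _ (uU n).
apply: (tau_cvg_cos (Z := fun n w => dotV z (JS `](x n).1, (x n).2]%classic w -
   JS `](y n).1, (y n).2]%classic w))) => [n|t].
  by apply: measurable_dotV; apply: measurable_rVB; apply: mJS; exact: U0n.
pose Dg n w := dotV (t *: z) ((J `](x n).1, (x n).2]%classic w - g (x n)) -
  (J `](y n).1, (y n).2]%classic w - g (y n))).
have mDg n : measurable_fun setT (Dg n).
  by apply: measurable_dotV; apply: measurable_rVB; apply: mJg; exact: U0n.
have c1 : ccvg \oo (fun n => chf P (Dg n)) 1.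
  rewrite -(chf0 P); apply: chf_cvg => //.
  under eq_fun do under [X in tau P X]eq_fun do rewrite subr0.
  exact: (cvg_in_probability_cauchy FF bU mJg hL xU yU (t *: z)).
have [c2 _] := ccvgM _ c1 (ccvg_conj _ c1).
rewrite mul1r conjc1 /= in c2.
apply: cvg_trans c2; apply: near_eq_cvg; apply: nearW => n.
have ix := Ui _ _ (xU n); have iy := Ui _ _ (yU n).
have mD : measurable_fun setT (fun w => dotV (t *: z) (J `](x n).1, (x n).2]%classic w -
    J `](y n).1, (y n).2]%classic w)).
  by apply: measurable_dotV; apply: measurable_rVB; apply: mJ; exact: U0n.
have E1 : chf P (Dg n) * (chf P (Dg n))^*%C =
   chf P (fun w => dotV (t *: z) (J `](x n).1, (x n).2]%classic w - J `](y n).1, (y n).2]%classic w)) *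
   (chf P (fun w => dotV (t *: z) (J `](x n).1, (x n).2]%classic w - J `](y n).1, (y n).2]%classic w)))^*%C.
  rewrite -(chf_shift_normc P (dotV (t *: z) (g (y n) - g (x n))) mD).
  suff -> : Dg n = fun w => dotV (t *: z) (J `](x n).1, (x n).2]%classic w -
    J `](y n).1, (y n).2]%classic w) + dotV (t *: z) (g (y n) - g (x n)) by [].
  by apply/funext => w; rewrite /Dg !dotVB; ring.
have E2 : chf P (fun w => dotV (t *: z) (JS `](x n).1, (x n).2]%classic w -
    JS `](y n).1, (y n).2]%classic w)) = chf P (Dg n) * (chf P (Dg n))^*%C.
  rewrite E1.
  have h1 := difference_chf_cvg (J := JS) mS (t *: z) ix iy (hJS _ ix) (hJS _ iy).
  have h2 := difference_chf_cvg (J := J) mX (t *: z) ix iy (hJ _ ix) (hJ _ iy).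
  rewrite (_ : (fun k => chf P _) = fun k => chf P (lincomb (fun B w => dotV (t *: z) (X B w))
      (difference_cells (phi k) (phi k) `](x n).1, (x n).2]%classic `](y n).1, (y n).2]%classic)) *
    (chf P (lincomb (fun B w => dotV (t *: z) (X B w))
      (difference_cells (phi k) (phi k) `](x n).1, (x n).2]%classic `](y n).1, (y n).2]%classic)))^*%C)
    in h1; last first.
    by apply/funext => k; apply: (lincomb_sub_normc (t *: z) rX rY XY); exact: bounded_difference_cells.
  exact: ccvg_unique h1 (ccvgM _ h2 (ccvg_conj _ h2)).
move: E2 => /(congr1 (@complex.Re R)); rewrite /chf /= => <-.
by apply: eq_Rintegral => w _; rewrite dotVZl.
Qed.

End symmetrized_definable.

(** * Centering *)

Section shifted_measures.
Context (R : realType) (d : nat).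
Local Notation leb := (@lebesgue_measure R).

Lemma convolution_dirac (mu : probability 'rV[R]_d R) (y : 'rV[R]_d) A : measurable A ->
  convolution mu (dirac y) A = mu [set x | A (x + y)].
Proof.
move=> mA; have mB : measurable (@addV R d @^-1` A).
  by rewrite -[X in measurable X]setTI; exact: measurable_addV.
rewrite /convolution /distribution /pushforward /= /product_measure1.
have mAy : measurable [set x : 'rV[R]_d | A (x + y)].
  rewrite -[X in measurable X]setTI.
  have ma : measurable_fun setT (fun x : 'rV[R]_d => x + y).
    by apply: measurable_rVD; [exact: measurable_id|exact: measurable_cst].
  exact: ma.
transitivity (\int[mu]_x (\1_[set x | A (x + y)] x)%:E)%E; last first.
  by rewrite integral_indic// setIT.
apply: eq_integral => x _; rewrite /= diracE indicE.
congr (_%:R%:E); congr nat_of_bool; apply/idP/idP.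
  by rewrite !inE /xsection/= inE.
by rewrite !inE /xsection/= inE.
Qed.

Lemma lebesgue_shift (t : R) (B : set R) : measurable B ->
  leb [set s + t | s in B] = leb B.
Proof.
move=> mB; rewrite set_shiftE.
have ms : measurable_fun [set: measurableTypeR R]
    ((fun x : R => x - t) : _ -> measurableTypeR R) by exact: measurable_funB.
pose sh := @mfun_Sub _ _ (measurableTypeR R) (measurableTypeR R) _ (mem_set ms).
suff : leb B = pushforward leb sh B by [].
apply: lebesgue_measure_unique => // _ [[x y] _ <-] /=; rewrite /pushforward.
have -> : sh @^-1` `]x, y] = `]x + t, y + t]%classic.
  by apply/seteqP; split => s /=; rewrite !in_itv/= ltrBrDr lerBlDr.
by rewrite !lebesgue_measure_itv/= !lte_fin ltrD2r -!EFinB opprD addrACA subrr addr0.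
Qed.

Lemma random_measure_law dT (T : measurableType dT) (P : probability T R)
    (mu nu : probability 'rV[R]_d R) X :
  (forall A, measurable A -> mu A = nu A) -> random_measure P mu X -> random_measure P nu X.
Proof.
move=> munu rX; split.
- exact: (rm_measurable rX).
- exact: (rm_sigma_additive rX).
- exact: (rm_independent rX).
- exact: (rm_atomless rX).
- exact: (rm_homogeneous rX).
- by move=> t A mA; rewrite (rm_law rX)// munu.
Qed.

(** Translating the law translates each value in proportion to the length of the set. *)
Lemma random_measure_shift dT (T : measurableType dT) (P : probability T R)
    (mu : probability 'rV[R]_d R) X (theta : 'rV[R]_d) :
  random_measure P mu X ->
  random_measure P (convolution mu (dirac (- theta)))
    (fun B w => X B w - fine (leb B) *: theta).
Proof.
move=> rX.
have mshift (c : 'rV[R]_d) (A : set 'rV[R]_d) : measurable A -> measurable [set x | A (x - c)].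
  move=> mA; rewrite -[X in measurable X]setTI.
  have ma : measurable_fun setT (fun x : 'rV[R]_d => x - c).
    by apply: measurable_rVB; [exact: measurable_id|exact: measurable_cst].
  exact: ma.
split.
- by move=> B bB; apply: measurable_rVB; [exact: (rm_measurable rX)|exact: measurable_cst].
- move=> B bB tB bU; apply: filterS (rm_sigma_additive rX bB tB bU) => w h.
  have hl : \sum_(k < n) fine (leb (B k)) @[n --> \oo] --> fine (leb (\bigcup_n B n)).
    have mB n : measurable (B n) := (bB n).1.
    have fU : leb (\bigcup_n B n) \is a fin_num.
      by rewrite ge0_fin_numE// bounded_Borel_lebesgue.
    have fB n : leb (B n) \is a fin_num by rewrite ge0_fin_numE// bounded_Borel_lebesgue.
    have := @measure_semi_sigma_additive _ _ _ leb B mB tB bU.1.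
    move=> hs; have h2 : fine (\sum_(0 <= k < n) leb (B k))%E @[n --> \oo] -->
        fine (leb (\bigcup_n B n)) by apply: fine_cvg; rewrite fineK.
    apply: cvg_trans h2; apply: near_eq_cvg.
    by apply: nearW => n /=; rewrite big_mkord sum_fine.
  under eq_fun do rewrite sumrB -scaler_suml.
  by apply: cvgB => //; exact: cvgZl.
- move=> n B A bB tB mA.
  exact: (rm_independent rX (A := fun i => [set x | A i (x - fine (leb (B i)) *: theta)]) bB tB
    (fun i => mshift _ _ (mA i))).
- by move=> t; apply: filterS (rm_atomless rX t) => w ->; rewrite lebesgue_measure_set1 scale0r subrr.
- move=> t B A bB mA; rewrite lebesgue_shift//; last by case: bB.
  exact: (rm_homogeneous rX t bB (mshift (fine (leb B) *: theta) _ mA)).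
- move=> t A mA; rewrite convolution_dirac//.
  have -> : leb `]t, t + 1] = 1%E.
    by rewrite lebesgue_measure_itv/= lte_fin ltrDl ltr01 -EFinB addrAC subrr add0r.
  rewrite /= scale1r.
  exact: (rm_law rX t (mshift theta _ mA)).
Qed.

End shifted_measures.

Section essential_definability.
Context dT (T : measurableType dT) (R : realType) (d : nat) (P : probability T R).
Context (a b : \bar R) (f : R -> R) (mu : probability 'rV[R]_d R).
Hypothesis ab : (a < b)%E.
Variables (X J : set R -> T -> 'rV[R]_d).
Hypotheses (rX : random_measure P mu X) (iJ : is_integral P a b X f J).
Local Notation PP := (P \x P)%E.
Local Notation S := (fun B (w : T * T) => X B w.1 - X B w.2).

Let mS B : bounded_Borel B -> measurable_fun setT (S B).
Proof.
move=> bB; have mX := rm_measurable rX bB; apply: measurable_rVB.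
  exact: measurableT_comp mX measurable_fst.
exact: measurableT_comp mX measurable_snd.
Qed.

Lemma symmetrized_integral_unique J' B : is_integral PP a b S f J' -> inner_Borel a b B ->
  {ae PP, forall w, J' B w = J B w.1 - J B w.2}.
Proof.
move=> iJ' iB; have [r1 r2 i12] := independent_copies rX.
exact: (integral_unique mS (fun z => sym_cumulant_process z r1 r2 i12) iJ'
  (symmetrized_integral rX iJ) iB).
Qed.

(** On the product space [X] and [X'] have the same symmetrization, hence so do
    the two integrals by uniqueness. Their difference equals an independent copy
    of itself, hence it is a constant, which serves as centering. *)
Lemma shifted_es X' J' mu' (h : set R -> 'rV[R]_d) L : random_measure P mu' X' ->
  (forall B w, X' B w = X B w - h B) -> is_integral P a b X' f J' ->
  cvg_in_probability P (improper_filter a b) (fun pq => J' `]pq.1, pq.2]%classic) L ->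
  improper_definable_es P a b X f.
Proof.
move=> rX' X'E iJ' hL.
have iS : is_integral PP a b S f (fun B w => J' B w.1 - J' B w.2).
  have := symmetrized_integral rX' iJ'.
  rewrite (_ : (fun B (w : T * T) => X' B w.1 - X' B w.2) = S)//.
  apply/funext => B; apply/funext => w.
  by rewrite !X'E opprB addrA subrK.
have mD B j : inner_Borel a b B -> measurable_fun setT (fun w => (J B w - J' B w) ord0 j).
  move=> iB; have := measurable_rVB (integral_measurable iJ iB) (integral_measurable iJ' iB).
  by move/measurable_fun_rVP.
have /choice[r rP] : forall p : 'I_d * set R, exists r, inner_Borel a b p.2 ->
    {ae P, forall w, J p.2 w ord0 p.1 - r = J' p.2 w ord0 p.1}.
  move=> [j B] /=; have [iB|] := pselect (inner_Borel a b B); last by exists 0.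
  have [r hr] := tau_sub_cst P (mD B j iB); exists r => _.
  have mr : measurable_fun setT (fun w => (J B w - J' B w) ord0 j - r).
    by apply: measurable_funB => //; exact: mD.
  have : tau P (fun w => (J B w - J' B w) ord0 j - r) = 0.
    apply/eqP; rewrite eq_le tau_ge0 andbT (le_trans hr)//.
    rewrite -(tau0 PP) le_eqVlt; apply/orP; left; apply/eqP; apply: tau_ae => //.
      apply: measurable_funB; [exact: measurableT_comp (mD B j iB) measurable_fst|
        exact: measurableT_comp (mD B j iB) measurable_snd].
    apply: filterS (symmetrized_integral_unique iS iB) => w /(congr1 (fun v : 'rV[R]_d => v ord0 j)).
    by rewrite !mxE => E; lra.
  by move=> /(tau0_ae mr); apply: filterS => w; rewrite !mxE => E; lra.
pose g (p q : R) : 'rV[R]_d := \row_j r (j, `]p, q]%classic).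
exists J, g, L; split => //.
have [U [bU Ui _ U0]] := improper_filter_base ab.
have FF : Filter (improper_filter a b) := @filter_filter _ _ (improper_filter_proper ab).
have mJ pq : U 0%N pq -> measurable_fun setT (J `]pq.1, pq.2]%classic).
  by move=> Upq; exact: (integral_measurable iJ (Ui _ _ Upq)).
have mJ' pq : U 0%N pq -> measurable_fun setT (J' `]pq.1, pq.2]%classic).
  by move=> Upq; exact: (integral_measurable iJ' (Ui _ _ Upq)).
have mJg pq : U 0%N pq -> measurable_fun setT (fun w => J `]pq.1, pq.2]%classic w - g pq.1 pq.2).
  by move=> /mJ mm; apply: measurable_rVB => //; exact: measurable_cst.
have [mL cL] := (cvg_in_probability_seq P FF bU mJ' L).1 hL.
apply: (cvg_in_probability_seq P FF bU mJg L).2; split; first exact: mL.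
move=> x xU z; apply: cvg_trans (cL x xU z); apply: near_eq_cvg; apply: nearW => n.
have Ux : U 0%N (x n) by exact: base_decreasing bU (leq0n n) _ (xU n).
apply: tau_ae.
- by apply: measurable_dotV; apply: measurable_rVB => //; exact: mJ'.
- by apply: measurable_dotV; apply: measurable_rVB => //; exact: mJg.
have hj j := rP (j, `](x n).1, (x n).2]%classic) (Ui _ _ (xU n)).
apply: filterS (filter_forall _ hj) => w E; congr (dotV z (_ - _)).
by apply/rowP => j; rewrite !mxE -(E j).
Qed.

(** The limit of the symmetrized integrals is the symmetrization of some random
    vector [LL]. The integrals minus [LL] are close to an independent copy of
    themselves, hence to constants, which serve as centering. *)
Lemma sym_es : improper_definable PP a b S f -> improper_definable_es P a b X f.
Proof.
move=> [JS [LS [iJS hLS]]].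
have [U [bU Ui _ U0]] := improper_filter_base ab.
have FF : Filter (improper_filter a b) := @filter_filter _ _ (improper_filter_proper ab).
have mJ pq : U 0%N pq -> measurable_fun setT (J `]pq.1, pq.2]%classic).
  by move=> Upq; exact: (integral_measurable iJ (Ui _ _ Upq)).
have mJS pq : U 0%N pq -> measurable_fun setT (JS `]pq.1, pq.2]%classic).
  by move=> Upq; exact: (integral_measurable iJS (Ui _ _ Upq)).
have [mLS cLS] := (cvg_in_probability_seq PP FF bU mJS LS).1 hLS.
have U0x (x : nat -> R * R) n : (forall n, U n (x n)) -> U 0%N (x n).
  by move=> xU; exact: base_decreasing bU (leq0n n) _ (xU n).
pose V j (pq : R * R) w := J `]pq.1, pq.2]%classic w ord0 j.
pose D j pq (w : T * T) := V j pq w.1 - V j pq w.2 - LS w ord0 j.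
have mV j pq : U 0%N pq -> measurable_fun setT (V j pq).
  by move=> Upq; have /measurable_fun_rVP := mJ pq Upq; exact.
have mLj j : measurable_fun setT (fun w => LS w ord0 j) by move/measurable_fun_rVP : mLS.
have mD j pq : U 0%N pq -> measurable_fun setT (D j pq).
  move=> /(mV j) m; apply: measurable_funB => //; apply: measurable_funB;
    [exact: measurableT_comp m measurable_fst|exact: measurableT_comp m measurable_snd].
have cD j x : (forall n, U n (x n)) -> tau PP (D j (x n)) @[n --> \oo] --> 0.
  move=> xU; apply: cvg_trans (cLS x xU (delta_mx ord0 j)); apply: near_eq_cvg.
  apply: nearW => n; apply: tau_ae.
  - by apply: measurable_dotV; apply: measurable_rVB => //; apply: mJS; exact: U0x.
  - by apply: mD; exact: U0x.
  - apply: filterS (symmetrized_integral_unique iJS (Ui _ _ (xU n))) => w E.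
    by rewrite dotV_delta E !mxE.
have /choice[x0 x0U] := U0.
have /choice[Ls LsP] : forall j, exists Ls : T -> R, measurable_fun setT Ls /\
    {ae PP, forall w, LS w ord0 j = Ls w.1 - Ls w.2}.
  move=> j; apply: (symmetrized_limit (U := fun n => V j (x0 n)) _ (mLj j) (cD j x0 x0U)).
  by move=> n; apply: mV; exact: U0x.
(* A centering constant for each coordinate and each interval. *)
have /choice[r rP] : forall p : 'I_d * (R * R), exists r, U 0%N p.2 ->
    tau P (fun w => V p.1 p.2 w - Ls p.1 w - r) <= tau PP (D p.1 p.2).
  move=> [j pq] /=; have [Upq|] := pselect (U 0%N pq); last by exists 0.
  have [mLsj hLsj] := LsP j.
  have mW : measurable_fun setT (fun w => V j pq w - Ls j w).
    by apply: measurable_funB => //; exact: mV.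
  have [r hr] := tau_sub_cst P mW; exists r => _.
  rewrite (le_trans hr)// le_eqVlt; apply/orP; left; apply/eqP; apply: tau_ae.
  - by apply: measurable_funB; [exact: measurableT_comp mW measurable_fst|
      exact: measurableT_comp mW measurable_snd].
  - exact: mD.
  - by apply: filterS hLsj => w E; rewrite /D E; ring.
pose g (p q : R) : 'rV[R]_d := \row_j r (j, (p, q)).
pose LL w : 'rV[R]_d := \row_j Ls j w.
exists J, g, LL; split => //.
have mLL : measurable_fun setT LL.
  by apply/measurable_fun_rVP => j; under eq_fun do rewrite mxE; exact: (LsP j).1.
have mJg pq : U 0%N pq -> measurable_fun setT (fun w => J `]pq.1, pq.2]%classic w - g pq.1 pq.2).
  by move=> /mJ mm; apply: measurable_rVB => //; exact: measurable_cst.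
apply: (cvg_in_probability_seq P FF bU mJg LL).2; split; first exact: mLL.
move=> x xU; apply: tau_cvg_dotV => [n|j].
  by apply: measurable_rVB => //; apply: mJg; exact: U0x.
apply: (squeeze_cvgr _ (cvg_cst 0) (cD j x xU)); apply: nearW => n.
rewrite tau_ge0/=; have := rP (j, x n) (U0x x n xU); rewrite /V /=.
congr (_ <= _); congr tau; apply/funext => w.
by rewrite !mxE -surjective_pairing; ring.
Qed.

End essential_definability.

Theorem theorem4p3 (R : realType) (d : nat) (a b : \bar R) (f : R -> R)
  (hab : (a < b)%E) (hf : measurable_fun (ereal_ooitv a b) f) :
  [/\ Dom0 d a b f `<=` Dom d a b f,
      Dom d a b f `<=` Dom_c d a b f,
      Dom_c d a b f `<=` Dom_es d a b f
    & Dom_es d a b f = Dom_sym d a b f].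
Proof.
split.
- move=> mu [mu_id loc [C [muC Cf]]]; split => // dT T P X rX.
  have [J iJ] := loc _ _ _ _ rX.
  have [L hL] := integrable_cumulant_cvg hab hf muC Cf rX iJ.
  by exists J, L.
- move=> mu [mu_id loc def]; split => //; exists 0 => dT T P X rX; apply: def.
  apply: random_measure_law rX => A mA; rewrite convolution_dirac// oppr0.
  by congr (mu _); apply/seteqP; split => x /=; rewrite addr0.
- move=> mu [mu_id loc [theta def]]; split => // dT T P X rX.
  have [J iJ] := loc _ _ _ _ rX.
  have rX' := random_measure_shift theta rX.
  have [J' [L [iJ' hL]]] := def _ _ _ _ rX'.
  exact: (shifted_es hab rX iJ rX' (h := fun B => fine (lebesgue_measure B) *: theta) _ iJ' hL).
- apply/seteqP; split => mu [mu_id loc def]; split => //.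
    move=> dT T P X Y rX rY XY; have [J [g [L [iJ hL]]]] := def _ _ _ _ rX.
    exact: (es_sym hab rX rY XY (g := fun pq => g pq.1 pq.2) iJ hL).
  move=> dT T P X rX; have [J iJ] := loc _ _ _ _ rX.
  have [r1 r2 i12] := independent_copies rX.
  exact: (sym_es hab rX iJ (def _ _ _ _ _ r1 r2 i12)).
Qed.
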